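(* Let $k\ge 2$ be an integer and $0\le\alpha\le 1$. Let $K\subset\mathbb{R}^n$ be a compact convex set whose interior contains the origin, such that $\partial K$ is $C^{k,\alpha}$ and its principal curvatures are positive at every point. Let $U\subset\mathbb{R}^n$ be a bounded open set with $C^{k,\alpha}$ boundary. Let $\varphi:\mathbb{R}^n\to\mathbb{R}$ be a $C^{k,\alpha}$ function with $\gamma^{\circ}(D\varphi)<1$ everywhere. Suppose $x\in U\setminus R_{\rho,0}$, and let $y$ be the unique $\rho$-closest point to $x$ on $\partial U$. Then $$x\in R_{\rho}\quad\text{if and only if}\quad\det Q(x)=0,$$ where $Q(x):=I-\big(\rho(x)-\varphi(y)\big)W(y)$, $W(y):=-D^2\gamma^{\circ}(\mu(y))\,D^2\rho(y)$, and $I$ is the identity matrix.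
   Context: Gauge and polar: $\gamma(x):=\inf\{t>0: x\in tK\}$ is the gauge function of $K$; $K^{\circ}:=\{x:\langle x,z\rangle\le 1 \text{ for all } z\in K\}$ is the polar of $K$; $\gamma^{\circ}$ is the gauge function of $K^{\circ}$. Under the stated assumptions $\gamma,\gamma^\circ$ are $C^{k,\alpha}$ on $\mathbb{R}^n\setminus\{0\}$. Obstacle: $\rho(x):=\min_{z\in\partial U}[\gamma(x-z)+\varphi(z)]$, regarded as a function on $\overline U$. A point $z\in\partial U$ is called a $\rho$-closest point to $x$ on $\partial U$ if $\rho(x)=\gamma(x-z)+\varphi(z)$. The $\rho$-ridge $R_\rho$ is the set of all $x\in U$ such that $\rho$ is not $C^{1,1}$ in any neighborhood of $x$. $R_{\rho,0}$ is the set of points of $U$ with more than one $\rho$-closest point on $\partial U$. Let $\nu$ be the inward unit normal to $\partial U$. For every $y\in\partial U$ there is a unique scalar $\lambda(y)>0$ with $\gamma^{\circ}(D\varphi(y)+\lambda(y)\nu(y))=1$; set $\mu(y):=D\varphi(y)+\lambda(y)\nu(y)$. Under the stated assumptions $\rho$ is $C^{k,\alpha}$ on $\overline U\cap B_r(y)$ for some $r>0$ for every $y\in\partial U$; $D^2\rho(y)$ for $y\in\partial U$ denotes the Hessian of $\rho|_{\overline U}$ at $y$ (the limit of $D^2\rho$ from inside $U$). *)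

(* Defs.v *)
From HB Require Import structures.
From mathcomp Require Import all_boot all_order all_algebra.
From mathcomp Require Import all_classical all_reals all_analysis.

Set Implicit Arguments.
Unset Strict Implicit.
Unset Printing Implicit Defensive.

Import Order.TTheory GRing.Theory Num.Theory.
Import numFieldNormedType.Exports.

Local Open Scope classical_set_scope.
Local Open Scope ring_scope.

(* R^n is 'rV[R]_n. The library norm `|x| on it is the max norm; it is used
   only for topological and Hölder conditions, which do not depend on the
   choice of the norm. Everything metric goes through [dotv]. *)

Definition dotv (R : realType) (n : nat) (x y : 'rV[R]_n) : R :=
  \sum_(i < n) x 0 i * y 0 i.

Definition boundary (T : topologicalType) (A : set T) : set T :=
  closure A `\` interior A.

Definition partial (R : realType) (n : nat) (i : 'I_n) (f : 'rV[R]_n -> R) :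
    'rV[R]_n -> R :=
  fun x => 'D_(delta_mx 0 i) f x.

Definition grad (R : realType) (n : nat) (f : 'rV[R]_n -> R) (x : 'rV[R]_n) :
    'rV[R]_n :=
  \row_i partial i f x.

Definition hessian (R : realType) (n : nat) (f : 'rV[R]_n -> R)
    (x : 'rV[R]_n) : 'M[R]_n :=
  \matrix_(i, j) partial i (partial j f) x.

Definition loc_holder (R : realType) (n : nat) (alpha : R) (f : 'rV[R]_n -> R)
    (V : set 'rV[R]_n) : Prop :=
  forall x, V x -> exists C : R,
    \forall p & q \near x, `|f p - f q| <= C * `|p - q| `^ alpha.

(* f is C^{k,alpha} on the open set V, in the local sense; for alpha = 0 this
   is C^k, since [loc_holder 0] is then only local boundedness. *)
Fixpoint Ckh (R : realType) (n : nat) (k : nat) (alpha : R)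
    (f : 'rV[R]_n -> R) (V : set 'rV[R]_n) : Prop :=
  (forall x, V x -> {for x, continuous f}) /\
  match k with
  | 0%N => loc_holder alpha f V
  | k'.+1 => forall i : 'I_n,
      (forall x, V x -> derivable f x (delta_mx 0 i)) /\
      Ckh k' alpha (partial i f) V
  end.

(* Near each of its points, the boundary of A is, up to relabeling and
   reorienting the coordinate axes, the graph of a C^{k,alpha} function of the
   n - 1 remaining coordinates [col' i x], with the interior of A on the upper
   side. *)
Definition Ckh_boundary (R : realType) (n : nat) (k : nat) (alpha : R)
    (A : set 'rV[R]_n) : Prop :=
  forall y, boundary A y ->
    exists (i : 'I_n) (b : bool) (g : 'rV[R]_n.-1 -> R),
      Ckh k alpha g setT /\
      \forall x \near y,
        (interior A x <-> g (col' i x) < (-1) ^+ b * x 0 i) /\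
        (boundary A x <-> g (col' i x) = (-1) ^+ b * x 0 i).

Definition boundary_curve (R : realType) (n : nat) (A : set 'rV[R]_n)
    (c : R -> 'rV[R]_n) (y v : 'rV[R]_n) : Prop :=
  [/\ c 0 = y, \forall t \near (0 : R), boundary A (c t)
    & is_derive (0 : R) (1 : R) c v].

Definition tangent_vector (R : realType) (n : nat) (A : set 'rV[R]_n)
    (y v : 'rV[R]_n) : Prop :=
  exists c : R -> 'rV[R]_n, boundary_curve A c y v.

Definition is_inward_normal (R : realType) (n : nat) (A : set 'rV[R]_n)
    (y nu : 'rV[R]_n) : Prop :=
  [/\ dotv nu nu = 1,
      forall v, tangent_vector A y v -> dotv nu v = 0
    & \forall t \near (0 : R)^'+, interior A (y + t *: nu)].

(* Unique when the boundary of A is C^1 and y lies on it. *)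
Definition inward_normal (R : realType) (n : nat) (A : set 'rV[R]_n)
    (y : 'rV[R]_n) : 'rV[R]_n :=
  get [set nu | is_inward_normal A y nu].

(* kappa is an eigenvalue of the shape operator - d nu on the tangent space at
   y, nu being the inward unit normal: the differential of nu in the tangent
   direction v is computed along a curve of the boundary with velocity v.
   With this sign the unit sphere has principal curvatures 1. *)
Definition principal_curvature (R : realType) (n : nat) (A : set 'rV[R]_n)
    (y : 'rV[R]_n) (kappa : R) : Prop :=
  exists (c : R -> 'rV[R]_n) (v : 'rV[R]_n),
    [/\ v != 0, boundary_curve A c y v
      & is_derive (0 : R) (1 : R) (fun t => inward_normal A (c t))
          (- (kappa *: v))].

Definition gauge_fun (R : realType) (n : nat) (K : set 'rV[R]_n)
    (x : 'rV[R]_n) : R :=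
  inf [set t : R | 0 < t /\ exists2 z, K z & x = t *: z].

Definition polar (R : realType) (n : nat) (K : set 'rV[R]_n) :
    set 'rV[R]_n :=
  [set x | forall z, K z -> dotv x z <= 1].

Section Obstacle.
Variables (R : realType) (n : nat).
Variables (K U : set 'rV[R]_n) (phi : 'rV[R]_n -> R).

(* The infimum is a minimum when U is bounded and nonempty. *)
Definition rho (x : 'rV[R]_n) : R :=
  inf [set gauge_fun K (x - z) + phi z | z in boundary U].

Definition rho_closest (x z : 'rV[R]_n) : Prop :=
  boundary U z /\ rho x = gauge_fun K (x - z) + phi z.

Definition rho_ridge : set 'rV[R]_n :=
  [set x | U x /\
    ~ exists V : set 'rV[R]_n, [/\ open V, V x, V `<=` U & Ckh 1 1 rho V]].

Definition rho_ridge0 : set 'rV[R]_n :=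
  [set x | U x /\
    exists z1 z2, [/\ z1 <> z2, rho_closest x z1 & rho_closest x z2]].

Definition lambda (y : 'rV[R]_n) : R :=
  get [set l : R | 0 < l /\
    gauge_fun (polar K) (grad phi y + l *: inward_normal U y) = 1].

Definition mu (y : 'rV[R]_n) : 'rV[R]_n :=
  grad phi y + lambda y *: inward_normal U y.

(* The Hessian of rho restricted to the closure of U at a boundary point, as
   the limit of the Hessian from inside U. *)
Definition rho_bdry_hessian (y : 'rV[R]_n) : 'M[R]_n :=
  lim (hessian rho z @[z --> within U (nbhs y)]).

Definition Wmat (y : 'rV[R]_n) : 'M[R]_n :=
  - (hessian (gauge_fun (polar K)) (mu y) *m rho_bdry_hessian y).

Definition Qmat (x y : 'rV[R]_n) : 'M[R]_n :=
  1%:M - (rho x - phi y) *: Wmat y.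

End Obstacle.

(* Main.v *)
From HB Require Import structures.
Require Import Defs.
From mathcomp Require Import all_boot all_order all_algebra.
From mathcomp Require Import all_classical all_reals all_analysis.
From mathcomp Require Import ring lra.
Import Order.TTheory GRing.Theory Num.Theory.
Import numFieldNormedType.Exports.
Local Open Scope classical_set_scope.
Local Open Scope ring_scope.

(* For z near a boundary point y, rho is C^2 inside U up to y, with
   characteristics z + s V(z), V = D gamma^o (D rho), along which D rho is
   constant. If y is the closest point to x, then x = Phi(ye), where ye lies on
   the segment from y to x at time e from y and Phi(z) = z + (t0 - e) V(z),
   t0 = rho(x) - phi(y). As e tends to 0 the Jacobian of Phi at ye tends to
   J0 = I + t0 H0 D^2 gamma^o(mu(y)), H0 = D^2 rho(y), which is invertible exactly
   when Q(x) is.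

   Each x' near x is Phi(z') for the point z' obtained by moving x' back along its
   segment to a closest boundary point, and D rho(x') = D rho(z').
   If J0 is invertible, Phi is injective near ye with a Lipschitz inverse for some
   small e, so z' is unique and Lipschitz in x', and rho is C^{1,1} near x.
   Conversely, if rho is C^{1,1} near x, then z' = x' - (t0 - e) V(x') is Lipschitz
   in x' uniformly in e, and a covector annihilated by J0 would contradict
   Phi(z') = x' to first order.

   No surjectivity is needed in any local inversion: preimages come from
   minimization, and continuity of the minimizer together with an invertible
   Jacobian gives differentiability. *)

Set Implicit Arguments.
Unset Strict Implicit.

(** * Gradients and strict differentiability *)

(** The boundary point y itself cannot serve as base point: rho is known to be smooth only from
    inside U, so D^2 rho(y) is a one-sided limit and Phi cannot be differentiated at y. Hence the
    interior point ye and the passage e -> 0. For e > 0 the Jacobian at ye may be invertible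
    although J0 is singular; this is why the Lipschitz bound in the converse must not depend on e.
    Positivity of the curvatures enters through the Gauss map of the boundary of K: it makes the
    support point of a covector unique and, by inversion, C^1. The support point is D gamma^o, so
    gamma^o is C^2 off the origin. Regularity of rho up to the boundary comes from one map of the
    ambient space, in which the shift along a coordinate axis encodes the time on a characteristic;
    no chart of the boundary enters. Vectors are rows and Jacobians act on the right, so J0 carries
    the factors of Q in the opposite order; I + AB and I + BA are invertible together. *)

Section dotv_theory.
Context {R : realType} {n : nat}.
Implicit Types (a b c x y : 'rV[R]_n) (r e : R).

Lemma rV_coord_le x i j : `|x i j| <= `|x|.
Proof.
rewrite [leRHS]/Num.Def.normr/= mx_normrE.
exact: (le_bigmax _ (fun ij : 'I_1 * 'I_n => `|x ij.1 ij.2|) (i, j)).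
Qed.

Lemma rV_norm_le x e : 0 <= e -> (forall j, `|x 0 j| <= e) -> `|x| <= e.
Proof.
move=> e0 xe; rewrite [leLHS]/Num.Def.normr/= mx_normrE (bigmax_le _ e0)//=.
by move=> [i j] _ /=; rewrite (ord1 i).
Qed.

Lemma dotvC a b : dotv a b = dotv b a.
Proof. by apply: eq_bigr => i _; rewrite mulrC. Qed.

Lemma dotvDl a b c : dotv (a + b) c = dotv a c + dotv b c.
Proof. by rewrite -big_split/=; apply: eq_bigr => i _; rewrite mxE mulrDl. Qed.

Lemma dotvDr a b c : dotv c (a + b) = dotv c a + dotv c b.
Proof. by rewrite dotvC dotvDl !(dotvC c). Qed.

Lemma dotvZl r a b : dotv (r *: a) b = r * dotv a b.
Proof. by rewrite mulr_sumr; apply: eq_bigr => i _; rewrite mxE mulrA. Qed.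

Lemma dotvZr r a b : dotv a (r *: b) = r * dotv a b.
Proof. by rewrite dotvC dotvZl dotvC. Qed.

Lemma dotvNl a b : dotv (- a) b = - dotv a b.
Proof. by rewrite -scaleN1r dotvZl mulN1r. Qed.

Lemma dotvNr a b : dotv a (- b) = - dotv a b.
Proof. by rewrite dotvC dotvNl dotvC. Qed.

Lemma dotvBl a b c : dotv (a - b) c = dotv a c - dotv b c.
Proof. by rewrite dotvDl dotvNl. Qed.

Lemma dotvBr a b c : dotv c (a - b) = dotv c a - dotv c b.
Proof. by rewrite dotvDr dotvNr. Qed.

Lemma dotv0l a : dotv 0 a = 0.
Proof. by rewrite -(scale0r 0) dotvZl mul0r. Qed.

Lemma dotv0r a : dotv a 0 = 0.
Proof. by rewrite dotvC dotv0l. Qed.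

Lemma dotv_delta a i : dotv a (delta_mx 0 i) = a 0 i.
Proof.
rewrite /dotv (bigD1 i)//= mxE !eqxx mulr1 big1 ?addr0// => j ji.
by rewrite mxE (negbTE ji) andbF mulr0.
Qed.

Lemma dotv_ge0 a : 0 <= dotv a a.
Proof. by apply: sumr_ge0 => i _; rewrite -expr2 sqr_ge0. Qed.

Lemma dotv_eq0 a : (dotv a a == 0) = (a == 0).
Proof.
apply/idP/eqP => [|->]; last by rewrite dotv0l.
rewrite psumr_eq0 => [/allP a0|i _]; last by rewrite -expr2 sqr_ge0.
apply/rowP => i; rewrite mxE; have := a0 i; rewrite mem_index_enum => /(_ isT).
by rewrite /= -expr2 sqrf_eq0 => /eqP.
Qed.

Lemma dotv_gt0 a : (0 < dotv a a) = (a != 0).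
Proof. by rewrite lt_def dotv_eq0 dotv_ge0 andbT. Qed.

Lemma dotv_norm_le a b : `|dotv a b| <= n%:R * `|a| * `|b|.
Proof.
apply: le_trans (ler_norm_sum _ _ _) _.
rewrite -mulrA mulr_natl -[X in _ <= _ *+ X]card_ord -sumr_const.
by apply: ler_sum => i _; rewrite normrM ler_pM// rV_coord_le.
Qed.

Lemma dotv_inj a b : (forall v, dotv a v = dotv b v) -> a = b.
Proof. by move=> ab; apply/rowP => i; rewrite -!dotv_delta ab. Qed.

Lemma dotvE a b : dotv a b = (a *m b^T) 0 0.
Proof. by rewrite mxE; apply: eq_bigr => i _; rewrite mxE. Qed.

End dotv_theory.

Lemma dotv_mulmx {R : realType} {m n : nat} (a : 'rV[R]_m) (A : 'M[R]_(m, n)) b :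
  dotv (a *m A) b = dotv a (b *m A^T).
Proof. by rewrite !dotvE trmx_mul trmxK mulmxA. Qed.

Section near_norm.
Context {R : realType} {V : normedModType R}.
Implicit Types (x y : V) (P : V -> Prop).

Lemma near_normP x P : (\forall y \near x, P y) <->
  exists2 r : R, 0 < r & forall y, `|y - x| < r -> P y.
Proof.
split=> [/nbhs_ballP[r /= r0 rP]|[r r0 rP]].
  by exists r => // y yx; apply: rP; rewrite -ball_normE /= distrC.
by apply/nbhs_ballP; exists r => //= y; rewrite -ball_normE /= distrC; exact: rP.
Qed.

Lemma near_and x P Q : (\forall y \near x, P y) -> (\forall y \near x, Q y) ->
  \forall y \near x, P y /\ Q y.
Proof. exact: filterI. Qed.

Lemma near_cvg {T : topologicalType} (f g : V -> T) x (l : T) :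
  (\forall y \near x, f y = g y) -> g @ x --> l -> f @ x --> l.
Proof.
by move=> fg; apply: cvg_trans; apply: near_eq_cvg; apply: filterS fg => y ->.
Qed.

Lemma near_continuous {W : normedModType R} (f : V -> W) x (P : W -> Prop) :
  {for x, continuous f} -> (\forall z \near f x, P z) -> \forall t \near x, P (f t).
Proof. by move=> fc /fc. Qed.

Lemma near_norm_lt x (r : R) : 0 < r -> \forall y \near x, `|y - x| < r.
Proof. by move=> r0; apply/near_normP; exists r. Qed.

Lemma near_norm_le x (r : R) : 0 < r -> \forall y \near x, `|y - x| <= r.
Proof. by move=> r0; apply/near_normP; exists r => // y /ltW. Qed.

Lemma continuous_normP {W : normedModType R} (f : V -> W) x :
  {for x, continuous f} <->
  forall e, 0 < e -> \forall y \near x, `|f y - f x| <= e.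
Proof.
split=> [fc e e0|fc].
  by have /cvgrPdist_le/(_ e e0) := fc; apply: filterS => y; rewrite distrC.
by apply/cvgrPdist_le => e e0; apply: filterS (fc e e0) => y; rewrite distrC.
Qed.

End near_norm.

Section is_grad.
Context {R : realType} {n : nat}.
Implicit Types (f : 'rV[R]_n -> R) (x y g v : 'rV[R]_n).

(** Fréchet differentiability as an explicit estimate, which combines directly with other
    near-statements; [is_gradP] ties it to [differentiable]. *)
Definition is_grad f x g := forall e, 0 < e ->
  \forall y \near x, `|f y - f x - dotv g (y - x)| <= e * `|y - x|.

Lemma dotv_linear g : linear (dotv g : 'rV[R]_n -> R).
Proof. by move=> r u v; rewrite dotvDr dotvZr. Qed.

Lemma dotv_continuous g : continuous (dotv g).
Proof.
move=> x; apply/(@continuous_normP _ _ R) => e e0.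
have C0 : 0 < n%:R * `|g| + 1 by rewrite ltr_wpDl// mulr_ge0.
have := near_norm_le x (divr_gt0 e0 C0); apply: filterS => y yx.
rewrite -dotvBr (le_trans (dotv_norm_le _ _))//.
apply: (@le_trans _ _ ((n%:R * `|g| + 1) * (e / (n%:R * `|g| + 1)))).
  by rewrite ler_pM ?mulr_ge0// ?lerDl//.
by rewrite mulrCA divff ?mulr1 ?gt_eqF.
Qed.

Lemma diff_dotv f x v : differentiable f x -> 'd f x v = dotv (grad f x) v.
Proof.
move=> df; rewrite {1}[v]row_sum_delta linear_sum; apply: eq_bigr => i _.
by rewrite linearZ mxE /partial deriveE// mulrC.
Qed.

Lemma differentiable_is_grad f x : differentiable f x ->
  is_grad f x (grad f x).
Proof.
move=> df e e0.
have /eqaddoP fo := diff_locally df.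
have /near_normP[r r0 H] := fo e e0.
apply/near_normP; exists r => // y yx; have := H (y - x).
by rewrite subr0 => /(_ yx); rewrite !fctE /= (diff_dotv _ df) opprD addrA subrK.
Qed.

Lemma is_grad_differentiable f x g : is_grad f x g ->
  differentiable f x /\ grad f x = g.
Proof.
move=> fg.
pose dl := GRing.isLinear.Build _ _ _ _ (dotv g : _ -> R) (dotv_linear g).
pose D : {linear 'rV[R]_n -> R} := HB.pack (dotv g : _ -> R) dl.
have Dc : continuous D by exact: dotv_continuous.
have fD : f \o shift x = cst (f x) + D +o_ (0 : 'rV[R]_n) id.
  apply/eqaddoP => e e0; have /near_normP[r r0 H] := fg e e0.
  apply: (near_normP (0 : 'rV[R]_n) _).2; exists r => // y; rewrite subr0 => yr; have := H (y + x).
  by rewrite addrK => /(_ yr); rewrite !fctE /= opprD addrA.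
have dE := diff_unique Dc fD.
have df : differentiable f x by apply/diff_locallyP; rewrite dE.
split => //; apply/rowP => i.
by rewrite mxE /partial deriveE// dE /= dotv_delta.
Qed.

Lemma is_gradP f x g :
  is_grad f x g <-> differentiable f x /\ grad f x = g.
Proof.
split=> [|[df <-]]; [exact: is_grad_differentiable|exact: differentiable_is_grad].
Qed.

End is_grad.

Lemma near_forall_ord {R : realType} {V : normedModType R} m (x : V)
    (P : 'I_m -> V -> Prop) :
  (forall i, \forall y \near x, P i y) -> \forall y \near x, forall i, P i y.
Proof. by move=> H; exact: (@filter_forall _ 'I_m P _ _ H). Qed.

Section is_grad_rules.
Context {R : realType} {n : nat}.
Implicit Types (f h : 'rV[R]_n -> R) (x y g v : 'rV[R]_n).

Lemma is_grad_grad f x g : is_grad f x g -> grad f x = g.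
Proof. by move=> /is_grad_differentiable[]. Qed.

Lemma is_grad_near f h x g : (\forall y \near x, f y = h y) ->
  is_grad f x g -> is_grad h x g.
Proof.
move=> fh fg e e0; have fhx := nbhs_singleton fh.
by apply: filterS2 fh (fg e e0) => y <-; rewrite fhx.
Qed.

Lemma is_grad_partial f x g i : is_grad f x g ->
  derivable f x (delta_mx 0 i) /\ partial i f x = g 0 i.
Proof.
move=> fg; have [df <-] := is_grad_differentiable fg.
by split; [exact: diff_derivable|rewrite mxE].
Qed.

Lemma is_grad_continuous f x g : is_grad f x g -> {for x, continuous f}.
Proof.
by move=> /is_grad_differentiable[df _]; exact: differentiable_continuous.
Qed.

Lemma is_grad_cst (c : R) x : is_grad (fun=> c) x 0.
Proof.
by move=> e e0; near=> y; rewrite subrr dotv0l subr0 normr0 mulr_ge0// ltW.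
Unshelve. all: by end_near. Qed.

Lemma is_grad_dotv g x : is_grad (dotv g) x g.
Proof.
by move=> e e0; near=> y; rewrite -dotvBr subrr normr0 mulr_ge0// ltW.
Unshelve. all: by end_near. Qed.

Lemma is_grad_coord i x : is_grad (fun y => y 0 i) x (delta_mx 0 i).
Proof.
rewrite (_ : (fun y => _) = dotv (delta_mx 0 i : 'rV[R]_n)).
  exact: is_grad_dotv.
by apply/funext => y; rewrite dotvC dotv_delta.
Qed.

Lemma is_gradD f h x df dh : is_grad f x df -> is_grad h x dh ->
  is_grad (fun y => f y + h y) x (df + dh).
Proof.
move=> fd hd e e0; have e20 : 0 < e / 2 by rewrite divr_gt0.
apply: filterS2 (fd _ e20) (hd _ e20) => y; rewrite dotvDl => A B.
rewrite (_ : _ - _ = (f y - f x - dotv df (y - x)) +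
  (h y - h x - dotv dh (y - x))); last by ring.
by rewrite (le_trans (ler_normD _ _))// [e]splitr mulrDl lerD.
Qed.

Lemma is_gradM f h x df dh : is_grad f x df -> is_grad h x dh ->
  is_grad (fun y => f y * h y) x (f x *: dh + h x *: df).
Proof.
move=> /is_grad_differentiable[fd <-] /is_grad_differentiable[hd <-].
apply/is_gradP; split; first exact: differentiableM.
apply/rowP => i; rewrite !mxE /partial.
by rewrite deriveM//; exact: diff_derivable.
Qed.

Lemma is_gradZ (r : R) f x df : is_grad f x df ->
  is_grad (fun y => r * f y) x (r *: df).
Proof.
by move=> fd; have := is_gradM (is_grad_cst r x) fd; rewrite scaler0 addr0.
Qed.

Lemma is_gradN f x df : is_grad f x df -> is_grad (fun y => - f y) x (- df).
Proof.
move=> /(is_gradZ (-1)); rewrite scaleN1r.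
by under eq_fun do rewrite mulN1r.
Qed.

Lemma is_gradB f h x df dh : is_grad f x df -> is_grad h x dh ->
  is_grad (fun y => f y - h y) x (df - dh).
Proof. by move=> fd /is_gradN; exact: is_gradD. Qed.

Lemma is_gradV f x df : f x != 0 -> is_grad f x df ->
  is_grad (fun y => (f y)^-1) x (- (f x) ^- 2 *: df).
Proof.
move=> fx0 /is_grad_differentiable[fd <-].
apply/is_gradP; split; first exact: differentiableV.
apply/rowP => i; rewrite !mxE /partial.
by rewrite deriveV//; exact: diff_derivable.
Qed.

Lemma is_grad_sum m (F : 'I_m -> 'rV[R]_n -> R) x (dF : 'I_m -> 'rV[R]_n) :
  (forall i, is_grad (F i) x (dF i)) ->
  is_grad (fun y => \sum_i F i y) x (\sum_i dF i).
Proof.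
elim: m F dF => [|m IH] F dF H.
  by under eq_fun do rewrite big_ord0; rewrite big_ord0; exact: is_grad_cst.
under eq_fun do rewrite big_ord_recl; rewrite big_ord_recl.
by apply: is_gradD => //; apply: IH => i; exact: H.
Qed.

Lemma is_grad_lipschitz f x g : is_grad f x g ->
  \forall y \near x, `|f y - f x| <= (n%:R * `|g| + 1) * `|y - x|.
Proof.
move=> /(_ 1 ltr01); apply: filterS => y; rewrite mul1r => A.
rewrite -(subrK (dotv g (y - x)) (f y - f x)) (le_trans (ler_normD _ _))//.
by rewrite addrC mulrDl mul1r lerD// dotv_norm_le.
Qed.

Lemma is_grad_comp m (F : 'rV[R]_m -> R) (G : 'rV[R]_n -> 'rV[R]_m) x
    (dF : 'rV[R]_m) (dG : 'I_m -> 'rV[R]_n) :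
  is_grad F (G x) dF -> (forall j, is_grad (fun y => G y 0 j) x (dG j)) ->
  is_grad (fun y => F (G y)) x (\sum_j dF 0 j *: dG j).
Proof.
move=> Fd Gd.
have [C C0 GC] : exists2 C, 0 < C &
    \forall y \near x, `|G y - G x| <= C * `|y - x|.
  exists (\sum_j (n%:R * `|dG j| + 1) + 1).
    by rewrite ltr_wpDl// sumr_ge0// => j _; rewrite addr_ge0// mulr_ge0.
  have H : \forall y \near x, forall j,
      `|G y 0 j - G x 0 j| <= (n%:R * `|dG j| + 1) * `|y - x|.
    by apply: near_forall_ord => j; exact: is_grad_lipschitz.
  apply: filterS H => y Hy; apply: rV_norm_le => [|j].
    by rewrite mulr_ge0// addr_ge0// sumr_ge0// => j _; rewrite addr_ge0// mulr_ge0.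
  rewrite !mxE (le_trans (Hy j))// ler_wpM2r// (bigD1 j)//= -addrA lerDl.
  by rewrite addr_ge0// sumr_ge0// => k _; rewrite addr_ge0// mulr_ge0.
have Gc : {for x, continuous G}.
  apply/continuous_normP => e e0.
  have := near_norm_le x (divr_gt0 e0 C0).
  apply: filterS2 GC => y Gy yx; rewrite (le_trans Gy)//.
  by rewrite mulrC -ler_pdivlMr.
pose D := \sum_j dF 0 j *: dG j.
have L : is_grad (fun y => dotv dF (G y)) x D.
  by apply: is_grad_sum => j; exact: is_gradZ.
move=> e e0.
have e1 : 0 < e / 2 / C by rewrite !divr_gt0.
have e2 : 0 < e / 2 by rewrite divr_gt0.
have FG : \forall y \near x, `|F (G y) - F (G x) - dotv dF (G y - G x)| <=
    e / 2 / C * `|G y - G x| := Gc _ (Fd _ e1).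
apply: filterS3 FG (L _ e2) GC => y A B GCy.
rewrite -/D.
rewrite (_ : _ - _ = (F (G y) - F (G x) - dotv dF (G y - G x)) +
  (dotv dF (G y) - dotv dF (G x) - dotv D (y - x))); last first.
  by rewrite (dotvBr (G y)); ring.
rewrite (le_trans (ler_normD _ _))// [e]splitr mulrDl lerD//.
rewrite (le_trans A)// [leRHS](_ : _ = e / 2 / C * (C * `|y - x|)).
  by rewrite ler_pM2l.
by field; rewrite gt_eqF.
Qed.

End is_grad_rules.

Section strict_grad.
Context {R : realType} {n : nat}.
Implicit Types (f h : 'rV[R]_n -> R) (x y p q g v : 'rV[R]_n).

(** Strict differentiability: both points move. It yields local injectivity and Lipschitz bounds,
    and controls increments of a function whose base point moves along with a minimizer. *)
Definition strict_grad f x g := forall e, 0 < e -> exists2 r, 0 < r &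
  forall p q, `|p - x| < r -> `|q - x| < r ->
    `|f p - f q - dotv g (p - q)| <= e * `|p - q|.

Lemma strict_grad_is_grad f x g : strict_grad f x g -> is_grad f x g.
Proof.
move=> fg e /fg[r r0 H]; apply/near_normP; exists r => // y yx.
by apply: H => //; rewrite subrr normr0.
Qed.

Lemma is_derive_line f u v (t : R) : derivable f (u + t *: v) v ->
  is_derive t 1 (fun s : R => f (u + s *: v)) ('D_v f (u + t *: v)).
Proof.
pose F (s : R) := f (u + s *: v).
have E : (fun h : R => h^-1 *: ((F \o shift t) (h *: (1 : R)) - F t)) =
    (fun h : R => h^-1 *: ((f \o shift (u + t *: v)) (h *: v) - f (u + t *: v))).
  apply/funext => k; rewrite /F /=; congr (_ *: (f _ - _)).
  by rewrite [k *: 1]mulr1 scalerDl addrCA.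
by move=> df; split; [move: df; rewrite /derivable -E|rewrite /derive -E].
Qed.

(** Mean value theorem on a segment parallel to an axis; the segment stays in the ball because its
    points are convex combinations of its ends. A negative s is handled by exchanging the ends. *)
Lemma partial_increment f x g i (e r : R) :
  (forall u, `|u - x| < r -> derivable f u (delta_mx 0 i) /\
     `|partial i f u - g 0 i| <= e) ->
  forall u s, `|u - x| < r -> `|u + s *: delta_mx 0 i - x| < r ->
    `|f (u + s *: delta_mx 0 i) - f u - s * g 0 i| <= e * `|s|.
Proof.
move=> H.
have P u s : 0 < s -> `|u - x| < r -> `|u + s *: delta_mx 0 i - x| < r ->
    `|f (u + s *: delta_mx 0 i) - f u - s * g 0 i| <= e * `|s|.
  move=> s0 ux usx.
  have B t : t \in `[0, s] -> `|u + t *: delta_mx 0 i - x| < r.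
    rewrite in_itv/= => /andP[t0 ts].
    rewrite (_ : u + _ - x = (1 - t / s) *: (u - x) +
       (t / s) *: (u + s *: delta_mx 0 i - x)); last first.
      by apply/rowP => j; rewrite !mxE; field; rewrite gt_eqF.
    have ts0 : 0 <= t / s by rewrite divr_ge0// ltW.
    have ts1 : t / s <= 1 by rewrite ler_pdivrMr// mul1r.
    rewrite (le_lt_trans (ler_normD _ _))// (normrZ (1 - t / s)) (normrZ (t / s)) (ger0_norm ts0).
    have /ger0_norm -> : 0 <= 1 - t / s by rewrite subr_ge0.
    have [->|ts'] := eqVneq (t / s) 0.
      by rewrite subr0 mul1r mul0r addr0.
    have : (t / s) * `|u + s *: delta_mx 0 i - x| < t / s * r.
      by rewrite ltr_pM2l// lt_def ts'.
    have : (1 - t / s) * `|u - x| <= (1 - t / s) * r.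
      by rewrite ler_wpM2l ?subr_ge0// ltW.
    by lra.
  have Df w : w \in `[0, s] -> is_derive w 1 (fun z : R => f (u + z *: delta_mx 0 i))
      (partial i f (u + w *: delta_mx 0 i)).
    by move=> /B/H[? _]; exact: is_derive_line.
  have Dc : {within `[0, s], continuous (fun z : R => f (u + z *: delta_mx 0 i))}.
    by apply: derivable_within_continuous => w /Df[].
  have Dfo w : w \in `]0, s[ -> is_derive w 1 (fun z : R => f (u + z *: delta_mx 0 i))
      (partial i f (u + w *: delta_mx 0 i)).
    by move=> /subset_itv_oo_cc/Df.
  have [c /B/H[_ ce] /=] := MVT_segment (ltW s0) Dfo Dc.
  rewrite (scale0r (delta_mx 0 i)) (addr0 u) (subr0 s) => ->.
  by rewrite mulrC -mulrBr normrM mulrC ler_wpM2r.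
move=> u s ux usx; have [s0|s0|<-] := ltgtP 0 s.
- exact: P.
- have := P (u + s *: delta_mx 0 i) (- s).
  rewrite oppr_gt0 scaleNr addrK => /(_ s0 usx ux).
  move=> Q; rewrite -normrN -[leRHS]/(e * `|s|) -(normrN s).
  by apply: le_trans Q; rewrite le_eqVlt; apply/orP; left; apply/eqP; congr (`| _ |); ring.
- by rewrite scale0r addr0 subrr mul0r subr0 normr0 mulr0.
Qed.

(** The passage from q to p changes one coordinate at a time, and each change is controlled by the
    mean value theorem along that axis. *)
Lemma strict_grad_partial f x :
  (\forall y \near x, forall i, derivable f y (delta_mx 0 i)) ->
  (forall i, {for x, continuous (partial i f)}) -> strict_grad f x (grad f x).
Proof.
move=> fd fc e e0.
have e1 : 0 < e / (n%:R + 1) by rewrite divr_gt0// ltr_wpDl.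
have : \forall y \near x, forall i, `|partial i f y - partial i f x| <= e / (n%:R + 1).
  by apply: near_forall_ord => i; apply: (continuous_normP _ _).1.
move=> {}fc; have /near_normP[r r0 H] := near_and fd fc.
exists r => // p q px qx.
(* The first k coordinates come from p, the others from q. In the max norm such a mixture is no
   farther from x than the farther of p and q. *)
pose m k : 'rV[R]_n := \row_i (if (i < k)%N then p 0 i else q 0 i).
have mx k : `|m k - x| < r.
  rewrite (le_lt_trans (y := Num.max `|p - x| `|q - x|))// ?gt_max ?px//.
  apply: rV_norm_le => [|j]; first by rewrite le_max normr_ge0.
  rewrite !mxE; case: ifP => _; rewrite le_max.
    by have := rV_coord_le (p - x) 0 j; rewrite !mxE => ->.
  by have := rV_coord_le (q - x) 0 j; rewrite !mxE => ->; rewrite orbT.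
have m0 : m 0%N = q by apply/rowP => j; rewrite mxE.
have mn : m n = p by apply/rowP => j; rewrite mxE ltn_ord.
have mS (k : 'I_n) : m k.+1 = m k + (p - q) 0 k *: delta_mx 0 k.
  apply/rowP => j; rewrite !mxE ltnS /=.
  have [->|jk] := eqVneq j k; first by rewrite leqnn ltnn mulr1 addrC subrK.
  by rewrite mulr0 addr0 leq_eqVlt (negbTE (jk : nat_of_ord j != k)).
have -> : f p - f q - dotv (grad f x) (p - q) = \sum_(k < n)
    (f (m k.+1) - f (m k) - (p - q) 0 k * grad f x 0 k).
  rewrite big_split/= sumrN; congr (_ - _).
    rewrite -(big_mkord xpredT (fun k => f (m k.+1) - f (m k))).
    by rewrite (telescope_sumr (fun k => f (m k)))// mn m0.
  by apply: eq_bigr => i _; rewrite mulrC.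
apply: (@le_trans _ _ (\sum_(k < n) e / (n%:R + 1) * `|p - q|)).
  apply: le_trans (ler_norm_sum _ _ _) _; apply: ler_sum => k _.
  rewrite mS (le_trans (@partial_increment f x (grad f x) k (e / (n%:R + 1)) r _ _ _ _ _))//.
  - by move=> u /H[? ?]; rewrite mxE.
  - by rewrite -mS.
  - by rewrite ler_pM2l// rV_coord_le.
rewrite sumr_const card_ord -[leLHS]mulr_natl mulrA ler_wpM2r//.
rewrite mulrCA; apply: ler_piMr; first exact: ltW.
by rewrite ler_pdivrMr ?mul1r ?lerDl// ltr_wpDl.
Qed.

End strict_grad.

(** * Limits of matrices *)

Section matrix_limits.
Context {R : realType} {T : Type} {F : set_system T} {FF : ProperFilter F}.

Lemma cvg_mxP m n (A : T -> 'M[R]_(m, n)) (A0 : 'M[R]_(m, n)) :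
  A @ F --> A0 <-> forall i j, A x i j @[x --> F] --> A0 i j.
Proof.
split=> [AA i j|H].
  by apply: (@continuous_cvg _ _ _ _ _ A (fun M : 'M[R]_(m, n) => M i j) A0) => //;
    exact: coord_continuous.
apply/cvgrPdist_le => e e0.
have : \forall x \near F, forall ij : 'I_m * 'I_n, `|A0 ij.1 ij.2 - A x ij.1 ij.2| <= e.
  apply: (@filter_forall _ ('I_m * 'I_n)%type) => ij.
  by have /cvgrPdist_le := H ij.1 ij.2; apply.
apply: filterS => x Hx.
rewrite [leLHS]/Num.Def.normr/= mx_normrE (bigmax_le _ (ltW e0))//= => ij _.
by rewrite !mxE; exact: Hx.
Qed.

Lemma cvg_sum_ord m (f : 'I_m -> T -> R) (a : 'I_m -> R) :
  (forall i, f i @ F --> a i) -> \sum_i f i x @[x --> F] --> \sum_i a i.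
Proof. by move=> H; apply: cvg_big => //; exact: add_continuous. Qed.

Lemma cvg_mulmx m n p (A : T -> 'M[R]_(m, n)) (B : T -> 'M[R]_(n, p))
    (A0 : 'M[R]_(m, n)) (B0 : 'M[R]_(n, p)) :
  A @ F --> A0 -> B @ F --> B0 -> A x *m B x @[x --> F] --> A0 *m B0.
Proof.
move=> /cvg_mxP AA /cvg_mxP BB; apply/cvg_mxP => i j; rewrite mxE.
under eq_fun do rewrite mxE.
by apply: cvg_sum_ord => k; apply: cvgM.
Qed.

Lemma cvg_det n (A : T -> 'M[R]_n) (A0 : 'M[R]_n) : A @ F --> A0 ->
  \det (A x) @[x --> F] --> \det A0.
Proof.
move=> /cvg_mxP AA; apply: cvg_big => [|s _]; first exact: add_continuous.
apply: cvgM; first exact: cvg_cst.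
by apply: cvg_big => [|i _]; [exact: mul_continuous|exact: AA].
Qed.

Lemma cvg_invmx n (A : T -> 'M[R]_n) (A0 : 'M[R]_n) : A0 \in unitmx -> A @ F --> A0 ->
  invmx (A x) @[x --> F] --> invmx A0.
Proof.
move=> A0u AA.
have d0 : \det A0 != 0 by rewrite -unitfE -unitmxE.
have dA := cvg_det AA.
have Au : \forall x \near F, \det (A x) != 0 by exact: cvgr_neq0 dA d0.
rewrite /invmx A0u.
have H : (\det (A x))^-1 *: \adj (A x) @[x --> F] --> (\det A0)^-1 *: \adj A0.
  apply: cvgZ; first exact: cvgV.
  move/cvg_mxP : AA => AA; apply/cvg_mxP => i j; rewrite mxE.
  under eq_fun do rewrite mxE.
  apply: cvgM; first exact: cvg_cst.
  apply: cvg_det; apply/cvg_mxP => k l; rewrite !mxE.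
  by under eq_fun do rewrite !mxE; exact: AA.
apply: cvg_trans H; apply: near_eq_cvg.
by apply: filterS Au => x; rewrite -unitfE -unitmxE => ->.
Qed.

End matrix_limits.

Lemma cvg_mx_atP {R : realType} {V : normedModType R} m n (A : V -> 'M[R]_(m, n))
    (A0 : 'M[R]_(m, n)) (x : V) :
  A @ x --> A0 <-> forall i j, A y i j @[y --> x] --> A0 i j.
Proof. exact: cvg_mxP. Qed.

Section continuous_at.
Context {R : realType} {V : normedModType R}.

Lemma continuous_atD {W : normedModType R} (f g : V -> W) x :
  {for x, continuous f} -> {for x, continuous g} ->
  {for x, continuous (fun y => f y + g y)}.
Proof. exact: cvgD. Qed.

Lemma continuous_atB {W : normedModType R} (f g : V -> W) x :
  {for x, continuous f} -> {for x, continuous g} ->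
  {for x, continuous (fun y => f y - g y)}.
Proof. exact: cvgB. Qed.

Lemma continuous_atN {W : normedModType R} (f : V -> W) x :
  {for x, continuous f} -> {for x, continuous (fun y => - f y)}.
Proof. exact: cvgN. Qed.

Lemma continuous_atZ {W : normedModType R} (f : V -> R) (g : V -> W) x :
  {for x, continuous f} -> {for x, continuous g} ->
  {for x, continuous (fun y => f y *: g y)}.
Proof. exact: cvgZ. Qed.

Lemma continuous_atM (f g : V -> R) x :
  {for x, continuous f} -> {for x, continuous g} ->
  {for x, continuous (fun y => f y * g y)}.
Proof. exact: cvgM. Qed.

Lemma continuous_atV (f : V -> R) x : f x != 0 ->
  {for x, continuous f} -> {for x, continuous (fun y => (f y)^-1)}.
Proof. exact: cvgV. Qed.

Lemma continuous_at_cst {W : topologicalType} (c : W) (x : V) :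
  {for x, continuous (fun=> c)}.
Proof. exact: cvg_cst. Qed.

Lemma continuous_at_comp {W : normedModType R} {Z : topologicalType}
    (f : V -> W) (g : W -> Z) x :
  {for x, continuous f} -> {for f x, continuous g} ->
  {for x, continuous (fun y => g (f y))}.
Proof. by move=> fc gc; exact: continuous_cvg fc. Qed.

Lemma continuous_at_near {W : topologicalType} (f g : V -> W) x :
  (\forall y \near x, f y = g y) -> {for x, continuous f} -> {for x, continuous g}.
Proof.
move=> fg fc; rewrite /prop_for /continuous_at -(nbhs_singleton fg).
by apply: near_cvg fc; apply: filterS fg.
Qed.

Lemma continuous_at_sum {W : normedModType R} m (f : 'I_m -> V -> W) x :
  (forall i, {for x, continuous (f i)}) ->
  {for x, continuous (fun y => \sum_i f i y)}.
Proof.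
elim: m f => [|m IH] f H; rewrite /prop_for /continuous_at.
  by under eq_fun do rewrite big_ord0; rewrite big_ord0; exact: continuous_at_cst.
under eq_fun do rewrite big_ord_recl; rewrite big_ord_recl.
by apply: continuous_atD => //; apply: IH => i; exact: H.
Qed.

Lemma continuous_at_mxP m n (A : V -> 'M[R]_(m, n)) x :
  {for x, continuous A} <-> forall i j, {for x, continuous (fun y => A y i j)}.
Proof. exact: cvg_mx_atP. Qed.

Lemma continuous_at_dotv n (f g : V -> 'rV[R]_n) x :
  {for x, continuous f} -> {for x, continuous g} ->
  {for x, continuous (fun y => dotv (f y) (g y))}.
Proof.
move=> /continuous_at_mxP fc /continuous_at_mxP gc.
by apply: continuous_at_sum => i; exact: continuous_atM.
Qed.

Lemma near_neq0 (f : V -> R) x : {for x, continuous f} -> f x != 0 ->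
  \forall y \near x, f y != 0.
Proof. exact: cvgr_neq0. Qed.

Lemma near_gt0 (f : V -> R) x : {for x, continuous f} -> 0 < f x ->
  \forall y \near x, 0 < f y.
Proof.
move=> fc fx0; have := (continuous_normP f x).1 fc (f x / 2).
rewrite divr_gt0// => /(_ isT); apply: filterS => y.
by rewrite ler_norml => /andP[A _]; lra.
Qed.

End continuous_at.

(** * Continuously differentiable maps and their local inverses *)

Section C1at.
Context {R : realType}.

(** The gradient exists near x but is continuous only at x: enough for strict differentiability at
    x, and stable under sums, products, quotients and composition. *)
Definition C1at {n} (f : 'rV[R]_n -> R) (x : 'rV[R]_n) :=
  (\forall y \near x, is_grad f y (grad f y)) /\ {for x, continuous (grad f)}.

Section rules.
Context {n : nat}.
Implicit Types (f h : 'rV[R]_n -> R) (x y g v : 'rV[R]_n).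

Lemma C1at_intro f x (G : 'rV[R]_n -> 'rV[R]_n) :
  (\forall y \near x, is_grad f y (G y)) -> {for x, continuous G} -> C1at f x.
Proof.
move=> fG Gc.
have E : \forall y \near x, grad f y = G y.
  by apply: filterS fG => y /is_grad_grad.
split; first by apply: filterS fG => y /[dup] /is_grad_grad ->.
rewrite /prop_for /continuous_at (nbhs_singleton E).
exact: near_cvg E Gc.
Qed.

Lemma C1at_is_grad f x : C1at f x -> is_grad f x (grad f x).
Proof. by move=> [fG _]; exact: nbhs_singleton fG. Qed.

Lemma C1at_near f h x : (\forall y \near x, f y = h y) -> C1at f x -> C1at h x.
Proof.
move=> fh [fG fc]; apply: C1at_intro fc.
have {}fh := near_join fh; apply: filterS2 fh fG => y fh; exact: is_grad_near.
Qed.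

Lemma C1at_continuous f x : C1at f x -> {for x, continuous f}.
Proof. by move=> /C1at_is_grad; exact: is_grad_continuous. Qed.

Lemma C1at_partial_continuous f x i : C1at f x -> {for x, continuous (partial i f)}.
Proof.
move=> [_ /cvg_mx_atP /(_ 0 i)]; rewrite mxE.
by under eq_fun do rewrite mxE.
Qed.

Lemma C1at_strict f x : C1at f x -> strict_grad f x (grad f x).
Proof.
move=> C; apply: strict_grad_partial.
  case: C => fG _; apply: filterS fG => y fG i.
  by have [] := is_grad_partial i fG.
by move=> i; exact: C1at_partial_continuous.
Qed.

Lemma C1at_partial f x :
  (\forall y \near x, (forall i, derivable f y (delta_mx 0 i)) /\
    forall i, {for y, continuous (partial i f)}) -> C1at f x.
Proof.
move=> H; have H2 := near_join H; split.
  apply: filterS H2 => y Hy; apply/strict_grad_is_grad/strict_grad_partial.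
    by apply: filterS Hy => z [].
  by have [] := nbhs_singleton Hy.
have [_ Hc] := nbhs_singleton H.
by apply/cvg_mx_atP => k i; rewrite mxE; under eq_fun do rewrite mxE; exact: Hc.
Qed.

Lemma C1at_cst (c : R) x : C1at (fun=> c) x.
Proof.
apply: (@C1at_intro _ _ (fun=> 0)); last exact: continuous_at_cst.
by near=> y; exact: is_grad_cst.
Unshelve. all: by end_near. Qed.

Lemma C1at_coord i x : C1at (fun y => y 0 i) x.
Proof.
apply: (@C1at_intro _ _ (fun=> delta_mx 0 i)); last exact: continuous_at_cst.
by near=> y; exact: is_grad_coord.
Unshelve. all: by end_near. Qed.

Lemma C1atD f h x : C1at f x -> C1at h x -> C1at (fun y => f y + h y) x.
Proof.
move=> [fG fc] [hG hc]; apply: (@C1at_intro _ _ (fun y => grad f y + grad h y)).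
  by apply: filterS2 fG hG => y; exact: is_gradD.
exact: (@continuous_atD _ _ _ (grad f) (grad h)).
Qed.

Lemma C1atM f h x : C1at f x -> C1at h x -> C1at (fun y => f y * h y) x.
Proof.
move=> Cf Ch; have [fG fc] := Cf; have [hG hc] := Ch.
apply: (@C1at_intro _ _ (fun y => f y *: grad h y + h y *: grad f y)).
  by apply: filterS2 fG hG => y; exact: is_gradM.
apply: (@continuous_atD _ _ _ (fun y => f y *: grad h y) (fun y => h y *: grad f y)).
  exact: (continuous_atZ (C1at_continuous Cf) hc).
exact: (continuous_atZ (C1at_continuous Ch) fc).
Qed.

Lemma C1atN f x : C1at f x -> C1at (fun y => - f y) x.
Proof.
move=> [fG fc]; apply: (@C1at_intro _ _ (fun y => - grad f y)).
  by apply: filterS fG => y; exact: is_gradN.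
exact: continuous_atN.
Qed.

Lemma C1atB f h x : C1at f x -> C1at h x -> C1at (fun y => f y - h y) x.
Proof. by move=> Cf Ch; exact: (@C1atD f (fun y => - h y) x Cf (C1atN Ch)). Qed.

Lemma C1atV f x : f x != 0 -> C1at f x -> C1at (fun y => (f y)^-1) x.
Proof.
move=> fx0 Cf; have [fG fc] := Cf; have cf := C1at_continuous Cf.
apply: (@C1at_intro _ _ (fun y => - (f y) ^- 2 *: grad f y)).
  have f0 : \forall y \near x, f y != 0 by exact: near_neq0.
  by apply: filterS2 fG f0 => y ? ?; exact: is_gradV.
apply: continuous_atZ => //; apply: continuous_atN; apply: continuous_atV.
  by rewrite expf_eq0.
rewrite (_ : (fun y => f y ^+ 2) = fun y => f y * f y).
  exact: continuous_atM.
by apply/funext => y; rewrite expr2.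
Qed.

End rules.

Lemma C1at_comp n m (F : 'rV[R]_m -> R) (G : 'rV[R]_n -> 'rV[R]_m) x :
  C1at F (G x) -> (forall j, C1at (fun y => G y 0 j) x) -> C1at (fun y => F (G y)) x.
Proof.
move=> [FG Fc] CG.
have Gc : {for x, continuous G}.
  by apply/continuous_at_mxP => k j; rewrite (ord1 k); exact: (C1at_continuous (CG j)).
apply: (@C1at_intro _ _ _
    (fun y => \sum_j grad F (G y) 0 j *: grad (fun y => G y 0 j) y)).
  have FG' : \forall y \near x, is_grad F (G y) (grad F (G y)) := Gc _ FG.
  have GG : \forall y \near x, forall j, is_grad (fun y => G y 0 j) y (grad (fun y => G y 0 j) y).
    by apply: near_forall_ord => j; have [] := CG j.
  by apply: filterS2 FG' GG => y; exact: is_grad_comp.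
apply: continuous_at_sum => j; apply: continuous_atZ; last by have [] := CG j.
have /continuous_at_mxP : {for x, continuous (fun y => grad F (G y))}.
  exact: continuous_at_comp.
exact.
Qed.

End C1at.

(** * Jacobian matrices, local inverses and local injectivity *)

Section jac.
Context {R : realType}.

(** The transpose of the usual Jacobian matrix: the derivative in the direction v is [v *m jac F x],
    and the chain rule multiplies from left to right. *)
Definition jac {m n} (F : 'rV[R]_m -> 'rV[R]_n) (x : 'rV[R]_m) : 'M[R]_(m, n) :=
  \matrix_(i, j) grad (fun y => F y 0 j) x 0 i.

Lemma mulmx_bound m n (A : 'M[R]_(m, n)) :
  exists2 c, 0 < c & forall v : 'rV[R]_m, `|v *m A| <= c * `|v|.
Proof.
exists (\sum_j (m%:R * `|(col j A)^T|) + 1).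
  by rewrite ltr_wpDl// sumr_ge0// => j _; rewrite mulr_ge0.
move=> v; apply: rV_norm_le => [|j].
  by rewrite mulr_ge0// addr_ge0// sumr_ge0// => j _; rewrite mulr_ge0.
have -> : (v *m A) 0 j = dotv (col j A)^T v.
  by rewrite mxE; apply: eq_bigr => i _; rewrite !mxE mulrC.
rewrite (le_trans (dotv_norm_le _ _))// ler_wpM2r// (bigD1 j)//= -addrA lerDl.
by rewrite addr_ge0// sumr_ge0// => k _; rewrite mulr_ge0.
Qed.

Lemma is_jacE m n (F : 'rV[R]_m -> 'rV[R]_n) x (A : 'M[R]_(m, n)) :
  (forall j, is_grad (fun y => F y 0 j) x (col j A)^T) <->
  forall e, 0 < e ->
    \forall y \near x, `|F y - F x - (y - x) *m A| <= e * `|y - x|.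
Proof.
have E y j : (F y - F x - (y - x) *m A) 0 j =
    F y 0 j - F x 0 j - dotv (col j A)^T (y - x).
  by rewrite !mxE; congr (_ - _); apply: eq_bigr => i _; rewrite !mxE mulrC.
split=> [H e e0|H j e e0].
  have : \forall y \near x, forall j, `|F y 0 j - F x 0 j - dotv (col j A)^T (y - x)| <=
      e * `|y - x| by apply: near_forall_ord => j; exact: H.
  apply: filterS => y Hy; apply: rV_norm_le => [|j].
    by rewrite mulr_ge0// ltW.
  by rewrite E.
apply: filterS (H e e0) => y; apply: le_trans.
by rewrite -E rV_coord_le.
Qed.

Lemma jac_is_grad m n (F : 'rV[R]_m -> 'rV[R]_n) x :
  (forall j, is_grad (fun y => F y 0 j) x (grad (fun y => F y 0 j) x)) ->
  forall j, is_grad (fun y => F y 0 j) x (col j (jac F x))^T.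
Proof.
move=> H j; rewrite (_ : (col _ _)^T = grad (fun y => F y 0 j) x)//.
by apply/rowP => i; rewrite !mxE.
Qed.

Lemma is_grad_jac m n (F : 'rV[R]_m -> 'rV[R]_n) x (A : 'M[R]_(m, n)) :
  (forall j, is_grad (fun y => F y 0 j) x (col j A)^T) -> jac F x = A.
Proof.
by move=> H; apply/matrixP => i j; rewrite mxE (is_grad_grad (H j)) !mxE.
Qed.

(* Only the differentiability of a given continuous local inverse is claimed:
   in the applications its existence comes from a minimization. *)
Lemma is_grad_inverse m n (F : 'rV[R]_n -> 'rV[R]_n) (P q : 'rV[R]_m -> 'rV[R]_n)
    x (J : 'M[R]_n) (A : 'M[R]_(m, n)) :
  (forall j, is_grad (fun y => F y 0 j) (P x) (col j J)^T) -> J \in unitmx ->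
  {for x, continuous P} -> (\forall y \near x, F (P y) = q y) ->
  (forall j, is_grad (fun y => q y 0 j) x (col j A)^T) ->
  forall j, is_grad (fun y => P y 0 j) x (col j (A *m invmx J))^T.
Proof.
move=> /is_jacE FJ Ju Pc FP /is_jacE qA; apply/is_jacE => e e0.
have [c c0 Hc] := mulmx_bound (invmx J).
have [a a0 Ha] := mulmx_bound A.
pose e2 := e / (2 * c).
(* The first entry lets the increment of P be absorbed in the bound [W1]; the second turns that
   bound into an error of at most half of e. *)
pose e1 := Num.min (2 * c)^-1 (e / (4 * c ^+ 2 * (a + 1))).
have c20 : 0 < 2 * c by rewrite mulr_gt0.
have e20 : 0 < e2 by rewrite divr_gt0.
have ca0 : 0 < 4 * c ^+ 2 * (a + 1) by rewrite !mulr_gt0 ?exprn_gt0 ?addr_gt0.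
have e10 : 0 < e1 by rewrite lt_min invr_gt0 c20 divr_gt0.
have B : \forall y \near x, `|F (P y) - F (P x) - (P y - P x) *m J| <=
  e1 * `|P y - P x| := Pc _ (FJ _ e10).
have FPx := nbhs_singleton FP.
apply: filterS3 FP B (near_and (qA _ e20) (qA _ ltr01)) => y -> {}B [C D].
rewrite FPx in B.
set w := P y - P x in B *; set h := y - x in C D *; set Q := q y - q x in B C D.
have Q1 : `|Q| <= (a + 1) * `|h|.
  rewrite -(subrK (h *m A) Q) (le_trans (ler_normD _ _))// addrC mulrDl lerD//.
have wE : w = (Q - (Q - w *m J)) *m invmx J by rewrite subKr mulmxK.
(* An a priori Lipschitz bound for P at x: the linearization error is at most half of the norm of w
   and moves to the left side. *)
have W1 : `|w| <= 2 * c * (a + 1) * `|h|.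
  have : `|w| <= c * (`|Q| + e1 * `|w|).
    rewrite {1}wE (le_trans (Hc _))// ler_pM2l// (le_trans (ler_normB _ _))//.
    by rewrite lerD.
  have : e1 * `|w| <= (2 * c)^-1 * `|w| by rewrite ler_wpM2r// ge_min lexx.
  move=> /(ler_wpM2l (ltW c0)).
  rewrite (_ : c * ((2 * c)^-1 * `|w|) = `|w| / 2); last by field; rewrite gt_eqF.
  move: Q1 => /(ler_wpM2l (ltW c0)); rewrite mulrDr; nra.
rewrite mulmxA {1}wE -mulmxBl (_ : _ - _ = (Q - h *m A) - (Q - w *m J)); last first.
  by rewrite addrAC.
rewrite (le_trans (Hc _))//.
have : `|(Q - h *m A) - (Q - w *m J)| <= e2 * `|h| + e1 * `|w|.
  by rewrite (le_trans (ler_normB _ _))// lerD.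
move=> /(ler_wpM2l (ltW c0))/le_trans; apply.
rewrite mulrDr [leRHS](_ : _ = c * (e2 * `|h|) + e / 2 * `|h|); last first.
  by rewrite /e2; field; rewrite gt_eqF.
rewrite lerD2l.
apply: (@le_trans _ _ (c * (e / (4 * c ^+ 2 * (a + 1)) * (2 * c * (a + 1) * `|h|)))).
  rewrite ler_pM2l// ler_pM// ?(ltW e10)//.
  by rewrite ge_min lexx orbT.
rewrite le_eqVlt; apply/orP; left; apply/eqP; field.
by rewrite !gt_eqF// addr_gt0.
Qed.

(** If c bounds the inverse Jacobian, strict differentiability with error 1 / (2c) leaves at least
    half of the distance of p and q visible in F p - F q, up to the factor c. *)
Lemma local_injectivity n (F : 'rV[R]_n -> 'rV[R]_n) x :
  (forall j, C1at (fun y => F y 0 j) x) -> jac F x \in unitmx ->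
  exists2 C, 0 < C & exists2 r, 0 < r & forall p q, `|p - x| < r -> `|q - x| < r ->
    `|p - q| <= C * `|F p - F q|.
Proof.
move=> FC Ju; have [c c0 Hc] := mulmx_bound (invmx (jac F x)).
exists (2 * c); first by rewrite mulr_gt0.
have e0 : 0 < (2 * c)^-1 by rewrite invr_gt0 mulr_gt0.
have H : \forall r \near (0 : R)^'+, forall j, forall p q, `|p - x| < r -> `|q - x| < r ->
    `|F p 0 j - F q 0 j - dotv (grad (fun y => F y 0 j) x) (p - q)| <=
      (2 * c)^-1 * `|p - q|.
  apply: filter_forall => j; have [r r0 Hr] := C1at_strict (FC j) e0.
  near=> s => p q ps qs.
  have sr : s <= r by near: s; exact: nbhs_right_le.
  by apply: Hr; [exact: lt_le_trans ps sr|exact: lt_le_trans qs sr].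
have [r [r0 Hr]] : exists r, 0 < r /\ forall j, forall p q, `|p - x| < r -> `|q - x| < r ->
    `|F p 0 j - F q 0 j - dotv (grad (fun y => F y 0 j) x) (p - q)| <=
      (2 * c)^-1 * `|p - q|.
  near (0 : R)^'+ => r; exists r; split => //.
  by near: r; exact: H.
exists r => // p q pr qr.
have A : `|F p - F q - (p - q) *m jac F x| <= (2 * c)^-1 * `|p - q|.
  apply: rV_norm_le => [|j]; first by rewrite mulr_ge0// ltW.
  rewrite (le_trans _ (Hr j p q pr qr))// !mxE; rewrite le_eqVlt; apply/orP; left.
  apply/eqP; congr (`| _ - _ |); apply: eq_bigr => i _.
  by rewrite !mxE mulrC.
have E : p - q = (F p - F q - (F p - F q - (p - q) *m jac F x)) *m invmx (jac F x).
  by rewrite subKr mulmxK.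
have : `|p - q| <= c * (`|F p - F q| + (2 * c)^-1 * `|p - q|).
  rewrite {1}E (le_trans (Hc _))// ler_pM2l// (le_trans (ler_normB _ _))//.
  by rewrite lerD.
rewrite mulrDr (_ : c * ((2 * c)^-1 * `|p - q|) = `|p - q| / 2); last first.
  by field; rewrite gt_eqF.
by lra.
Unshelve. all: by end_near. Qed.

End jac.

(** * Gauge and support function of a convex body *)

Lemma le_of_forall_gt {R : realFieldType} (a b : R) :
  (forall t, a < t -> b <= t) -> b <= a.
Proof. by move=> H; apply/ler_addgt0Pr => e e0; apply: H; rewrite ltrDl. Qed.

Section gauge.
Context {R : realType} {n : nat}.

Record convex_body (K : set 'rV[R]_n) : Prop := ConvexBody {
  body_compact : compact K ;
  body_convex : convex_set K ;
  body_origin : interior K 0 }.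

Context (K : set 'rV[R]_n) (KB : convex_body K).
Let K_compact := body_compact KB.
Let K_convex := body_convex KB.
Let K_origin := body_origin KB.
Implicit Types (x y z xi : 'rV[R]_n) (s t : R).
Local Notation gamma := (gauge_fun K).

Lemma convex_comb t x y : 0 <= t <= 1 -> K x -> K y -> K (t *: x + (1 - t) *: y).
Proof.
move=> /andP[t0 t1] Kx Ky.
have := @K_convex x y (Itv01 t0 t1); rewrite !inE => /(_ Kx Ky).
by rewrite /conv /=.
Qed.

Lemma origin_ball : exists2 r, 0 < r & forall x, `|x| < r -> K x.
Proof.
have /near_normP[r r0 H] : \forall y \near (0 : 'rV[R]_n), K y := K_origin.
by exists r => // x xr; apply: H; rewrite subr0.
Qed.

Lemma body0 : K 0. Proof. exact: interior_subset K_origin. Qed.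

Lemma body_bounded : exists2 M, 0 < M & forall x, K x -> `|x| <= M.
Proof.
have /ex_strict_bound_gt0[M M0 H] := compact_bounded K_compact.
by exists M => // x Kx; apply/ltW/H.
Qed.

Lemma body_closed : closed K.
Proof. by apply: compact_closed => //; exact: norm_hausdorff. Qed.

Let gset x := [set t : R | 0 < t /\ exists2 z, K z & x = t *: z].

Lemma gsetP x t : gset x t <-> 0 < t /\ K (t^-1 *: x).
Proof.
split=> [[t0 [z Kz ->]]|[t0 Kx]]; split=> //.
  by rewrite scalerA mulVf ?gt_eqF// scale1r.
by exists (t^-1 *: x) => //; rewrite scalerA divff ?gt_eqF// scale1r.
Qed.

Lemma gset_up x s t : gset x s -> s <= t -> gset x t.
Proof.
move=> /gsetP[s0 Ks] st; have t0 := lt_le_trans s0 st; apply/gsetP; split=> //.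
rewrite (_ : _ *: x = (s / t) *: (s^-1 *: x) + (1 - s / t) *: 0).
  apply: convex_comb => //; last exact: body0.
  by rewrite divr_ge0 ?(ltW t0) ?(ltW s0)//= ler_pdivrMr// mul1r.
by apply/rowP => j; rewrite !mxE; field; rewrite !gt_eqF.
Qed.

Lemma gset_nonempty x : gset x !=set0.
Proof.
have [r r0 H] := origin_ball.
exists ((`|x| + 1) / r); apply/gsetP.
have x1 : 0 < `|x| + 1 by rewrite ltr_wpDl.
split; first by rewrite divr_gt0.
apply: H; rewrite normrZ gtr0_norm ?invr_gt0 ?divr_gt0// invf_div.
by rewrite mulrAC ltr_pdivrMr// ltr_pM2l// ltrDl.
Qed.

Lemma gset_lbound x : has_lbound (gset x).
Proof. by exists 0 => t /gsetP[/ltW]. Qed.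

Lemma gauge_le x t : 0 < t -> K (t^-1 *: x) -> gamma x <= t.
Proof. by move=> t0 Kx; apply: (ge_inf (gset_lbound x)); apply/gsetP. Qed.

Lemma gauge_ge0 x : 0 <= gamma x.
Proof. by apply: lb_le_inf; [exact: gset_nonempty|move=> t /gsetP[/ltW]]. Qed.

Lemma gauge_lt x t : gamma x < t -> K (t^-1 *: x).
Proof.
move=> xt; have e0 : 0 < t - gamma x by rewrite subr_gt0.
have [|s Es] := inf_adherent e0 (E := gset x).
  by split; [exact: gset_nonempty|exact: gset_lbound].
rewrite -/(gamma x) addrC subrK => st.
by have /gsetP[] := gset_up Es (ltW st).
Qed.

Lemma gauge_leP x s : (forall t, s < t -> 0 < t -> gamma x <= t) -> 0 <= s -> gamma x <= s.
Proof.
by move=> H s0; apply: le_of_forall_gt => t st; apply: H => //; exact: le_lt_trans st.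
Qed.

Lemma gauge0 : gamma 0 = 0.
Proof.
apply/eqP; rewrite eq_le gauge_ge0 andbT; apply: gauge_leP => // t _ t0.
by apply: gauge_le => //; rewrite scaler0; exact: body0.
Qed.

Lemma gauge_gtZ s x : 0 < s -> gamma (s *: x) <= s * gamma x.
Proof.
move=> s0; rewrite -ler_pdivrMl//; apply: le_of_forall_gt => t xt.
have t0 : 0 < t := le_lt_trans (gauge_ge0 x) xt.
rewrite ler_pdivrMl//; apply: gauge_le; first by rewrite mulr_gt0.
rewrite scalerA invfM mulrAC mulVf ?gt_eqF// mul1r; exact: gauge_lt.
Qed.

Lemma gaugeZ s x : 0 <= s -> gamma (s *: x) = s * gamma x.
Proof.
rewrite le_eqVlt => /orP[/eqP <-|s0]; first by rewrite scale0r mul0r gauge0.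
apply/eqP; rewrite eq_le gauge_gtZ//=.
have := @gauge_gtZ s^-1 (s *: x); rewrite invr_gt0 => /(_ s0).
by rewrite scalerA mulVf ?gt_eqF// scale1r ler_pdivlMl.
Qed.

Lemma gaugeD x y : gamma (x + y) <= gamma x + gamma y.
Proof.
rewrite -lerBlDr; apply: le_of_forall_gt => t xt.
rewrite lerBlDr -lerBlDl; apply: le_of_forall_gt => s ys.
have t0 : 0 < t := le_lt_trans (gauge_ge0 x) xt.
have s0 : 0 < s := le_lt_trans (gauge_ge0 y) ys.
have st0 : 0 < t + s by rewrite addr_gt0.
rewrite lerBlDl; apply: gauge_le => //.
rewrite (_ : _ *: _ = (t / (t + s)) *: (t^-1 *: x) + (1 - t / (t + s)) *: (s^-1 *: y)).
  apply: convex_comb; [|exact: gauge_lt..].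
  by rewrite divr_ge0 ?(ltW t0) ?(ltW st0)//= ler_pdivrMr// mul1r lerDl ltW.
by apply/rowP => j; rewrite !mxE; field; rewrite !gt_eqF.
Qed.

Lemma gaugeB x y : gamma x - gamma y <= gamma (x - y).
Proof. by rewrite lerBlDr -{1}(subrK y x) gaugeD. Qed.

Lemma gauge_le_norm : exists2 C, 0 < C & forall x, gamma x <= C * `|x|.
Proof.
have [r r0 H] := origin_ball; exists (2 / r); first by rewrite divr_gt0.
move=> x; have [->|x0] := eqVneq x 0; first by rewrite gauge0 normr0 mulr0.
have t0 : 0 < 2 / r * `|x| by rewrite !mulr_gt0 ?normr_gt0 ?invr_gt0.
apply: gauge_le => //; apply: H.
rewrite normrZ gtr0_norm ?invr_gt0// [ltLHS](_ : _ = r / 2).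
  by rewrite ltr_pdivrMr// ltr_pMr// ltr1n.
by field; rewrite normr_eq0 x0 gt_eqF.
Qed.

Lemma norm_le_gauge : exists2 M, 0 < M & forall x, `|x| <= M * gamma x.
Proof.
have [M M0 H] := body_bounded; exists M => // x.
rewrite mulrC -ler_pdivrMr//; apply: le_of_forall_gt => t xt.
have t0 : 0 < t := le_lt_trans (gauge_ge0 x) xt.
have := H _ (gauge_lt xt).
by rewrite normrZ gtr0_norm ?invr_gt0// ler_pdivrMl// ler_pdivrMr.
Qed.

Lemma gauge_gt0 x : x != 0 -> 0 < gamma x.
Proof.
move=> x0; have [M M0 /(_ x) H] := norm_le_gauge.
by rewrite -(pmulr_rgt0 _ M0) (lt_le_trans _ H)// normr_gt0.
Qed.

Lemma gauge_lipschitz : exists2 C, 0 < C &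
  forall x y, `|gamma x - gamma y| <= C * `|x - y|.
Proof.
have [C C0 H] := gauge_le_norm; exists C => // x y.
rewrite ler_norml (le_trans (gaugeB x y) (H _)) andbT.
by rewrite lerNl opprB (le_trans (gaugeB y x))// distrC.
Qed.

Lemma gauge_continuous : continuous gamma.
Proof.
move=> x; apply/continuous_normP => e e0.
have [C C0 H] := gauge_lipschitz.
apply: filterS (near_norm_le x (divr_gt0 e0 C0)) => y yx.
by rewrite (le_trans (H _ _))// mulrC -ler_pdivlMr.
Qed.

(** The infimum only gives x / t in K for t > 1. Since K is closed, x outside K would leave (1 - e)
    x outside K for small e, although 1 / (1 - e) exceeds 1. *)
Lemma gauge_le1P x : K x <-> gamma x <= 1.
Proof.
split=> [Kx|x1]; first by apply: gauge_le => //; rewrite invr1 scale1r.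
apply: contrapT => nKx.
have /near_normP[r r0 H] : \forall y \near x, ~ K y.
  by apply: (@open_nbhs_nbhs _ _ (~` K)); split=> //; rewrite openC; exact: body_closed.
pose e := Num.min 2^-1 (r / 2 / (`|x| + 1)).
have x10 : 0 < `|x| + 1 by rewrite ltr_wpDl.
have e0 : 0 < e by rewrite lt_min invr_gt0 ltr0n !divr_gt0.
have e12 : e <= 2^-1 by rewrite ge_min lexx.
have e1 : e < 1 by lra.
apply: (H ((1 - e) *: x)).
  rewrite scalerBl scale1r addrC addKr normrN normrZ gtr0_norm//.
  apply: (@le_lt_trans _ _ (r / 2 / (`|x| + 1) * (`|x| + 1))).
    by rewrite ler_pM ?(ltW e0)// ?lerDl// ge_min lexx orbT.
  by rewrite divfK ?gt_eqF// ltr_pdivrMr// ltr_pMr// ltr1n.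
have e1' : 0 < 1 - e by rewrite subr_gt0.
rewrite -[1 - e]invrK; apply: gauge_lt.
by rewrite (le_lt_trans x1)// invf_gt1// ltrBlDr ltrDl.
Qed.

Lemma interior_gaugeP x : interior K x <-> gamma x < 1.
Proof.
split=> [Kx|x1].
  have [->|x0] := eqVneq x 0; first by rewrite gauge0.
  have /near_normP[r r0 H] : \forall y \near x, K y := Kx.
  pose e := r / 2 / `|x|.
  have nx0 : 0 < `|x| by rewrite normr_gt0.
  have e0 : 0 < e by rewrite !divr_gt0.
  have /gauge_le1P : K ((1 + e) *: x).
    apply: H; rewrite scalerDl scale1r addrC addKr normrZ gtr0_norm//.
    by rewrite divfK ?gt_eqF// ltr_pdivrMr// ltr_pMr// ltr1n.
  have e1 : 0 <= 1 + e by rewrite addr_ge0// ltW.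
  rewrite (gaugeZ _ e1) => A.
  by rewrite (lt_le_trans _ A)// mulrDl mul1r ltrDl mulr_gt0 ?gauge_gt0.
have /near_gt0 : {for x, continuous (fun y => 1 - gamma y)}.
  by apply: continuous_atB; [exact: continuous_at_cst|exact: gauge_continuous].
rewrite subr_gt0 => /(_ x1) H; rewrite /interior /=.
by apply: filterS H => y; rewrite subr_gt0 => /ltW/gauge_le1P.
Qed.

Lemma boundary_gaugeP x : boundary K x <-> gamma x = 1.
Proof.
rewrite /boundary; have /closure_id <- := body_closed.
split=> [[/gauge_le1P x1 /interior_gaugeP nx]|x1].
  by apply/eqP; rewrite eq_le x1 leNgt; apply/negP.
by split; [apply/gauge_le1P; rewrite x1|move/interior_gaugeP; rewrite x1 ltxx].
Qed.

Lemma gauge_normalized x : x != 0 -> gamma ((gamma x)^-1 *: x) = 1.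
Proof.
move=> x0; have g0 := gauge_gt0 x0.
by rewrite gaugeZ ?invr_ge0 ?ltW// mulVf ?gt_eqF.
Qed.

(** * The gauge of the polar as the support function of the body *)

Local Notation h := (gauge_fun (polar K)).

(** A positive t puts xi into t times the polar exactly when t bounds [dotv xi] on K. So the gauge
    of the polar is the support function of K, and compactness provides a maximizer. *)
Lemma support_funP xi : (forall z, K z -> dotv xi z <= h xi) /\
  exists2 z, K z & dotv xi z = h xi.
Proof.
have cont : {within K, continuous (dotv xi)}.
  by apply: continuous_subspaceT; exact: dotv_continuous.
have [z zK zmax] := EVT_max_rV (ex_intro _ _ body0) K_compact cont.
rewrite inE in zK.
have z0 : 0 <= dotv xi z by rewrite -[0](dotv0r xi) zmax// inE; exact: body0.
suff -> : h xi = dotv xi z by split; [move=> w Kw; rewrite zmax ?inE|exists z].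
have S t : dotv xi z < t -> 0 < t /\ exists2 w, polar K w & xi = t *: w.
  move=> zt; have t0 := le_lt_trans z0 zt; split => //; exists (t^-1 *: xi).
    move=> w Kw; rewrite dotvZl ler_pdivrMl// mulr1.
    by rewrite (le_trans _ (ltW zt))// zmax ?inE.
  by rewrite scalerA divff ?gt_eqF// scale1r.
apply/eqP; rewrite eq_le; apply/andP; split.
  apply: le_of_forall_gt => t /S St; apply: ge_inf => //.
  by exists 0 => s [/ltW].
apply: lb_le_inf.
  by exists (dotv xi z + 1); apply: S; rewrite ltrDl.
move=> t [t0 [w Pw ->]]; rewrite dotvZl -[leRHS]mulr1 ler_pM2l//.
exact: Pw.
Qed.

Lemma support_ge xi z : K z -> dotv xi z <= h xi.
Proof. by have [+ _] := support_funP xi; exact. Qed.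

Lemma support_attained xi : exists2 z, K z & dotv xi z = h xi.
Proof. by have [] := support_funP xi. Qed.

(** The Cauchy-Schwarz inequality of the dual pair of gauges. *)
Lemma dotv_le_support_gauge xi x : dotv xi x <= h xi * gamma x.
Proof.
have [->|x0] := eqVneq x 0; first by rewrite dotv0r gauge0 mulr0.
have g0 := gauge_gt0 x0.
have /support_ge : K ((gamma x)^-1 *: x) by apply/gauge_le1P; rewrite gauge_normalized.
by move=> /(_ xi); rewrite dotvZr ler_pdivrMl// mulrC.
Qed.

Lemma support_ge0 xi : 0 <= h xi.
Proof. by rewrite -[0](dotv0r xi) support_ge//; exact: body0. Qed.

Lemma support_gt0 xi : xi != 0 -> 0 < h xi.
Proof.
move=> x0; have := dotv_le_support_gauge xi xi; rewrite leNgt => /negP H.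
rewrite lt_def support_ge0 andbT; apply/eqP => h0; apply: H.
by rewrite h0 mul0r dotv_gt0.
Qed.

Lemma support0 : h 0 = 0.
Proof. by have [z _ <-] := support_attained 0; rewrite dotv0l. Qed.

Lemma supportZ s xi : 0 <= s -> h (s *: xi) = s * h xi.
Proof.
move=> s0; apply/eqP; rewrite eq_le; apply/andP; split.
  by have [z Kz <-] := support_attained (s *: xi); rewrite dotvZl ler_wpM2l// support_ge.
by have [z Kz <-] := support_attained xi; rewrite -dotvZl support_ge.
Qed.

Lemma supportD xi eta : h (xi + eta) <= h xi + h eta.
Proof.
have [z Kz <-] := support_attained (xi + eta).
by rewrite dotvDl lerD// support_ge.
Qed.

Lemma support_lipschitz : exists2 C, 0 < C &
  forall x y, `|h x - h y| <= C * `|x - y|.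
Proof.
have [M M0 HM] := body_bounded.
exists (n%:R * M + 1); first by rewrite ltr_wpDl// mulr_ge0// ltW.
have P x y : h x - h y <= (n%:R * M + 1) * `|x - y|.
  have [z Kz <-] := support_attained x.
  apply: (@le_trans _ _ (dotv (x - y) z)).
    by rewrite dotvBl lerB// support_ge.
  rewrite (le_trans (ler_norm _))// (le_trans (dotv_norm_le _ _))//.
  rewrite mulrAC ler_wpM2r// (le_trans (ler_wpM2l _ (HM _ Kz)))//.
  by rewrite lerDl.
by move=> x y; rewrite ler_norml P andbT lerNl opprB distrC P.
Qed.

Lemma support_continuous : continuous h.
Proof.
move=> x; apply/continuous_normP => e e0.
have [C C0 H] := support_lipschitz.
apply: filterS (near_norm_le x (divr_gt0 e0 C0)) => y yx.
by rewrite (le_trans (H _ _))// mulrC -ler_pdivlMr.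
Qed.

End gauge.

(** * Defining functions, normals and curvature of a boundary *)

Section C2.
Context {R : realType}.

Definition C2 {n} (f : 'rV[R]_n -> R) :=
  forall x, C1at f x /\ forall i, C1at (partial i f) x.

Lemma Ckh_C2 n k (alpha : R) (f : 'rV[R]_n -> R) : (2 <= k)%N ->
  Ckh k alpha f setT -> C2 f.
Proof.
case: k => [|[|k]]// _ /= [_ fk] x.
have pc i y : {for y, continuous (partial i f)} by have [_ [+ _]] := fk i; apply.
split.
  by apply: C1at_partial; near=> y; split=> // i; have [+ _] := fk i; apply.
move=> i; apply: C1at_partial; near=> y; split => j.
  by have [_ [_ /(_ j)[+ _]]] := fk i; apply.
by have [_ [_ /(_ j)[_]]] := fk i; case: (k) => [|k'] /= [+ _]; apply.
Unshelve. all: by end_near. Qed.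

End C2.

Section defining_function.
Context {R : realType} {n : nat}.
Implicit Types (A : set 'rV[R]_n) (d : 'rV[R]_n -> R) (x y v nu : 'rV[R]_n).

(* The function [d x = s * x 0 i - g (col' i x)] with s = 1 or -1 of a local graph
   representation of the boundary. *)
Definition defining A y (i : 'I_n) (s : R) d :=
  [/\ C2 d, s * s = 1, forall x, partial i d x = s,
      forall x t, d (x + t *: delta_mx 0 i) = d x + t * s &
      \forall x \near y, (interior A x <-> 0 < d x) /\ (boundary A x <-> d x = 0)].

Lemma defining_exists k (alpha : R) A y : (2 <= k)%N -> Ckh_boundary k alpha A ->
  boundary A y -> exists i s d, defining A y i s d.
Proof.
move=> k2 Ab /Ab [i [b [g [/(Ckh_C2 k2) gC near_y]]]].
pose s : R := (-1) ^+ b; pose d x := s * x 0 i - g (col' i x).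
exists i, s, d.
have colC j x : C1at (fun y => (col' i y) 0 j) x.
  by apply: C1at_near (C1at_coord (lift i j) x); near=> z; rewrite mxE.
have gcolC x : C1at (fun y => g (col' i y)) x.
  by apply: C1at_comp => //; have [] := gC (col' i x).
have C1d x : C1at d x.
  apply: C1atB; last exact: gcolC.
  by apply: C1atM; [exact: C1at_cst|exact: C1at_coord].
have dg x : is_grad d x (s *: delta_mx 0 i -
    \sum_j partial j g (col' i x) *: delta_mx 0 (lift i j)).
  apply: is_gradB; first by apply: is_gradZ; exact: is_grad_coord.
  have [/C1at_is_grad gx _] := gC (col' i x).
  have H j : is_grad (fun z => (col' i z) 0 j) x (delta_mx 0 (lift i j)).
    by apply: is_grad_near (is_grad_coord (lift i j) x); near=> z; rewrite mxE.
  have := is_grad_comp gx H.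
  by under eq_bigr do rewrite mxE.
have pi x : partial i d x = s.
  have [_ ->] := is_grad_partial i (dg x).
  rewrite !mxE summxE !eqxx mulr1 big1 ?subr0// => j _.
  by rewrite !mxE eqxx /= (negbTE (neq_lift i j)) mulr0.
have pj j x : partial (lift i j) d x = - partial j g (col' i x).
  have [_ ->] := is_grad_partial (lift i j) (dg x).
  rewrite !mxE summxE eqxx /= eq_sym (negbTE (neq_lift i j)) mulr0 sub0r.
  congr (- _); rewrite (bigD1 j)//= big1 => [|k' kj].
    by rewrite !mxE !eqxx mulr1 addr0.
  by rewrite !mxE (inj_eq lift_inj) eq_sym (negbTE kj) andbF mulr0.
split => //.
- move=> x; split => // j; case: (unliftP i j) => [j' ->|->].
    apply: (@C1at_near _ _ (fun z => - partial j' g (col' i z))).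
      by near=> z; rewrite pj.
    apply: C1atN; apply: C1at_comp => //.
    by have [_] := gC (col' i x).
  by apply: C1at_near (C1at_cst s x); near=> z; rewrite pi.
- by rewrite /s; case: b {s d C1d dg pi pj near_y} => /=; rewrite ?expr1 ?expr0; lra.
- move=> x t; rewrite /d !mxE !eqxx mulr1.
  rewrite (_ : col' i (x + _) = col' i x); first by ring.
  apply/rowP => j; rewrite !mxE eqxx /=.
  by rewrite eq_sym (negbTE (neq_lift i j)) mulr0 addr0.
- apply: filterS near_y => x [Hi Hb]; split.
    by rewrite Hi /d subr_gt0.
  rewrite Hb /d /s; split=> [->|/eqP]; first by rewrite subrr.
  by rewrite subr_eq0 => /eqP.
Unshelve. all: by end_near. Qed.

(** One triple i, s, d serves a whole neighborhood, so normals and gradients at neighboring boundary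
    points can be compared and differentiated. *)
Lemma defining_near A y i s d : defining A y i s d ->
  \forall x \near y, defining A x i s d.
Proof. by move=> [? ? ? ? /near_join]; apply: filterS => x; split. Qed.

Lemma defining_boundary A y i s d : defining A y i s d ->
  boundary A y <-> d y = 0.
Proof. by move=> [_ _ _ _ /nbhs_singleton []]. Qed.

Section at_point.
Context (A : set 'rV[R]_n) (y : 'rV[R]_n) (i : 'I_n) (s : R) (d : 'rV[R]_n -> R).
Hypothesis (Ad : defining A y i s d).

Lemma def_grad x : is_grad d x (grad d x).
Proof. by have [+ _ _ _ _] := Ad => /(_ x)[/C1at_is_grad]. Qed.

Lemma def_gradi x : grad d x 0 i = s.
Proof. by have [_ _ H _ _] := Ad; rewrite mxE. Qed.

Lemma def_grad_ge1 x : 1 <= dotv (grad d x) (grad d x).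
Proof.
have [_ ss _ _ _] := Ad.
rewrite /dotv (bigD1 i)//= def_gradi ss lerDl sumr_ge0// => j _.
by rewrite -expr2 sqr_ge0.
Qed.

Lemma def_grad_neq0 x : grad d x != 0.
Proof. by rewrite -dotv_gt0 (lt_le_trans ltr01 (def_grad_ge1 x)). Qed.

(** Projection along the i-th axis onto the zero set of d. It is exact, since d is affine with slope
    s on lines parallel to this axis and s squared is 1. *)
Definition bproj x := x - (s * d x) *: delta_mx 0 i.

Lemma bproj0 x : d (bproj x) = 0.
Proof.
have [_ ss _ H _] := Ad; rewrite /bproj -scaleNr H.
by rewrite mulNr mulrAC ss mul1r subrr.
Qed.

Lemma bproj_id x : d x = 0 -> bproj x = x.
Proof. by move=> dx; rewrite /bproj dx mulr0 scale0r subr0. Qed.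

Lemma bproj_C1 x j : C1at (fun z => bproj z 0 j) x.
Proof.
have [dC _ _ _ _] := Ad.
have E : C1at (fun z => z 0 j - s * d z * (delta_mx 0 i : 'rV[R]_n) 0 j) x.
  apply: C1atB; first exact: C1at_coord.
  apply: C1atM; last exact: C1at_cst.
  by apply: C1atM; [exact: C1at_cst|have [] := dC x].
by apply: C1at_near E; near=> z; rewrite !mxE.
Unshelve. all: by end_near. Qed.

Lemma bproj_grad x j v : dotv (grad (fun z => bproj z 0 j) x) v =
  v 0 j - s * dotv (grad d x) v * (delta_mx 0 i : 'rV[R]_n) 0 j.
Proof.
have H : is_grad (fun z => bproj z 0 j) x (delta_mx 0 j -
    (delta_mx 0 i : 'rV[R]_n) 0 j *: (s *: grad d x)).
  apply: (@is_grad_near _ _ (fun z => z 0 j - (delta_mx 0 i : 'rV[R]_n) 0 j * (s * d z))).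
    by near=> z; rewrite !mxE; ring.
  apply: is_gradB; first exact: is_grad_coord.
  by apply: is_gradZ; apply: is_gradZ; exact: def_grad.
rewrite (is_grad_grad H) dotvBl dotvC dotv_delta !dotvZl; congr (_ - _).
by rewrite mulrC.
Unshelve. all: by end_near. Qed.

End at_point.

End defining_function.

(** * Derivatives along curves *)

Section curves.
Context {R : realType}.

Lemma is_derive0P {W : normedModType R} (c : R -> W) (v : W) :
  is_derive (0 : R) (1 : R) c v <->
  forall e : R, 0 < e -> \forall t \near (0 : R), `|c t - c 0 - t *: v| <= e * `|t|.
Proof.
have E (h : R) : h != 0 -> h^-1 *: (c (h *: 1 + 0) - c 0) =
    v + h^-1 *: (c h - c 0 - h *: v).
  move=> h0; rewrite addr0 [h *: 1]mulr1 [in RHS]scalerBr scalerA mulVf//.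
  by rewrite scale1r [in RHS]addrCA subrr addr0.
have H : (forall e : R, 0 < e ->
    \forall t \near (0 : R), `|c t - c 0 - t *: v| <= e * `|t|) <->
    h^-1 *: (c (h *: 1 + 0) - c 0) @[h --> (0 : R)^'] --> v.
  split=> [H|/cvgrPdist_le H e e0].
    apply/cvgrPdist_le => e e0; rewrite near_withinE.
    apply: filterS (H e e0) => h Hh h0.
    rewrite E// opprD addrA subrr sub0r normrN normrZ normfV.
    by rewrite ler_pdivrMl ?normr_gt0// mulrC.
  have := H e e0; rewrite near_withinE; apply: filterS => h Hh.
  have [->|h0] := eqVneq h 0.
    by rewrite scale0r subr0 subrr !normr0 mulr0.
  have := Hh h0; rewrite E// opprD addrA subrr sub0r normrN normrZ normfV.
  by rewrite ler_pdivrMl ?normr_gt0// mulrC.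
rewrite H; split=> [[]|cv].
  by rewrite /derivable /derive => /[swap] <-.
by split; [apply/cvg_ex; exists v|apply: cvg_lim].
Qed.

Lemma curve_chain {n} (f : 'rV[R]_n -> R) (c : R -> 'rV[R]_n) g v :
  is_grad f (c 0) g -> is_derive (0 : R) (1 : R) c v ->
  is_derive (0 : R) (1 : R) (fun t => f (c t)) (dotv g v).
Proof.
move=> fg /is_derive0P cv; apply/is_derive0P => e e0.
have C0 : 0 < n%:R * `|g| + 1 by rewrite ltr_wpDl// mulr_ge0.
have v0 : 0 < `|v| + 1 by rewrite ltr_wpDl.
have c1 : \forall t \near (0 : R), `|c t - c 0| <= (`|v| + 1) * `|t|.
  apply: filterS (cv 1 ltr01) => t; rewrite mul1r => Ht.
  rewrite -(subrK (t *: v) (c t - c 0)) (le_trans (ler_normD _ _))//.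
  by rewrite normrZ addrC mulrDl mul1r lerD// mulrC.
have cc : {for 0, continuous c}.
  apply/continuous_normP => e' e'0.
  have := near_norm_le (0 : R) (divr_gt0 e'0 v0); apply: filterS2 c1 => t ct.
  by rewrite subr0 ler_pdivlMr// mulrC => /(le_trans ct).
have e1 : 0 < e / 2 / (`|v| + 1) by rewrite !divr_gt0.
have e2 : 0 < e / 2 / (n%:R * `|g| + 1) by rewrite !divr_gt0.
have fg' : \forall t \near (0 : R), `|f (c t) - f (c 0) - dotv g (c t - c 0)| <=
  e / 2 / (`|v| + 1) * `|c t - c 0| := cc _ (fg _ e1).
apply: filterS3 fg' c1 (cv _ e2) => t P1 P2 P3.
rewrite (_ : _ - _ = (f (c t) - f (c 0) - dotv g (c t - c 0)) +
  dotv g (c t - c 0 - t *: v)); last first.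
  by rewrite (dotvBr (c t - c 0)) dotvZr /GRing.scale/=; ring.
rewrite (le_trans (ler_normD _ _))// [e]splitr mulrDl lerD//.
  rewrite (le_trans P1)// -[leRHS](_ : e / 2 / (`|v| + 1) * ((`|v| + 1) * `|t|) = _).
    by rewrite ler_pM2l.
  by rewrite mulrA divfK ?gt_eqF.
rewrite (le_trans (dotv_norm_le _ _))//.
rewrite (le_trans (ler_wpM2l _ P3)) ?mulr_ge0//.
rewrite mulrA ler_wpM2r// mulrCA; apply: ler_piMr.
  by rewrite divr_ge0// ltW.
by rewrite ler_pdivrMr// mul1r lerDl.
Qed.

Lemma is_derive_near {W : normedModType R} (c c' : R -> W) v :
  (\forall t \near (0 : R), c t = c' t) ->
  is_derive (0 : R) (1 : R) c v -> is_derive (0 : R) (1 : R) c' v.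
Proof. exact: near_eq_is_derive. Qed.

Lemma is_derive_unique {W : normedModType R} (c : R -> W) v v' :
  is_derive (0 : R) (1 : R) c v -> is_derive (0 : R) (1 : R) c v' -> v = v'.
Proof. by move=> [_ <-] [_ <-]. Qed.

Lemma is_derive_rV {n} (c : R -> 'rV[R]_n) (v : 'rV[R]_n) :
  (forall j, is_derive (0 : R) (1 : R) (fun t => c t 0 j) (v 0 j)) ->
  is_derive (0 : R) (1 : R) c v.
Proof.
move=> H; apply/is_derive0P => e e0.
have : \forall t \near (0 : R), forall j,
    `|c t 0 j - c 0 0 j - t *: v 0 j| <= e * `|t|.
  by apply: near_forall_ord => j; apply: (is_derive0P _ _).1.
apply: filterS => t Ht; apply: rV_norm_le => [|j]; first by rewrite mulr_ge0// ltW.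
by rewrite !mxE; exact: Ht.
Qed.

Lemma is_derive_affine {n} (y v : 'rV[R]_n) :
  is_derive (0 : R) (1 : R) (fun t => y + t *: v) v.
Proof.
apply/is_derive0P => e e0; near=> t.
by rewrite scale0r addr0 (addrC y) addrK subrr normr0 mulr_ge0// ltW.
Unshelve. all: by end_near. Qed.

Lemma affine_continuous {n} (y v : 'rV[R]_n) : continuous (fun t : R => y + t *: v).
Proof.
move=> t.
have c1 : {for t, continuous (fun t : R => t *: v)}.
  apply: (@continuous_atZ R R _ id (fun=> v)); last exact: continuous_at_cst.
  exact: cvg_id.
by have := continuous_atD (@continuous_at_cst R R _ y t) c1.
Qed.

End curves.

(** * Tangent vectors and the inward unit normal *)

Section normal.
Context {R : realType} {n : nat}.
Implicit Types (A : set 'rV[R]_n) (d : 'rV[R]_n -> R) (x y v nu g : 'rV[R]_n).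

Lemma is_derive0_continuous (c : R -> 'rV[R]_n) v :
  is_derive (0 : R) (1 : R) c v -> {for 0, continuous c}.
Proof.
by move=> [dc _]; apply: differentiable_continuous; apply/derivable1_diffP.
Qed.

Lemma tangent_grad A y i s d v : defining A y i s d -> tangent_vector A y v ->
  dotv (grad d y) v = 0.
Proof.
move=> Ad [c [c0 cA cv]]; have cc := is_derive0_continuous cv.
have [_ _ _ _ near_y] := Ad.
have dc : \forall t \near (0 : R), d (c t) = 0.
  rewrite -c0 in near_y; have near_t := near_continuous cc near_y.
  by apply: filterS2 cA near_t => t bt [_ [H _]]; exact: H.
have := def_grad Ad (c 0) => /curve_chain/(_ cv); rewrite c0 => D.
apply: is_derive_unique D _.
apply: (@is_derive_near _ _ (fun=> 0)).
  by apply: filterS dc => t ->.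
Qed.

(** The line through y with velocity v is projected onto the boundary. The derivative of [bproj]
    changes v only by a multiple of [dotv (grad d y) v], which is 0, so every vector orthogonal to
    [grad d y] is a velocity. *)
Lemma bproj_curve A y i s d v : defining A y i s d -> d y = 0 ->
  dotv (grad d y) v = 0 -> boundary_curve A (fun t => bproj i s d (y + t *: v)) y v.
Proof.
move=> Ad dy gv; have [_ _ _ _ near_y] := Ad.
have c0 : bproj i s d (y + 0 *: v) = y by rewrite scale0r addr0 bproj_id.
have cv : is_derive (0 : R) (1 : R) (fun t => bproj i s d (y + t *: v)) v.
  apply: is_derive_rV => j.
  have G : is_grad (fun z => bproj i s d z 0 j) (y + 0 *: v) (grad (fun z => bproj i s d z 0 j) y).
    by rewrite scale0r addr0; exact: C1at_is_grad (bproj_C1 Ad y j).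
  have := curve_chain G (is_derive_affine y v).
  by rewrite (bproj_grad Ad) gv mulr0 mul0r subr0.
split=> //; rewrite -c0 in near_y.
have := near_continuous (is_derive0_continuous cv) near_y.
by apply: filterS => t [_ H]; apply/H; exact: (bproj0 Ad).
Qed.

Definition norm2 v := Num.sqrt (dotv v v).

Lemma norm2_sq v : norm2 v ^+ 2 = dotv v v.
Proof. by rewrite sqr_sqrtr// dotv_ge0. Qed.

Lemma norm2_gt0 v : (0 < norm2 v) = (v != 0).
Proof. by rewrite sqrtr_gt0 dotv_gt0. Qed.

Lemma grad_pos_interior A y i s d v : defining A y i s d -> d y = 0 ->
  0 < dotv (grad d y) v -> \forall t \near (0 : R)^'+, interior A (y + t *: v).
Proof.
move=> Ad dy gv; have [_ _ _ _ near_y] := Ad.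
have cv := is_derive_affine y v.
have G : is_grad d (y + 0 *: v) (grad d y).
  by rewrite scale0r addr0; exact: def_grad Ad y.
have /is_derive0P := curve_chain G cv.
have e0 : 0 < dotv (grad d y) v / 2 by rewrite divr_gt0.
move=> /(_ _ e0); rewrite scale0r addr0 dy => H.
have near_c : \forall t \near (0 : R), interior A (y + t *: v) <-> 0 < d (y + t *: v).
  have y0 : y = y + 0 *: v by rewrite scale0r addr0.
  rewrite {1}y0 in near_y; have := near_continuous (is_derive0_continuous cv) near_y.
  by apply: filterS => t [].
rewrite near_withinE; apply: filterS2 H near_c => t Ht -> t0.
move: Ht; rewrite subr0 (gtr0_norm t0) /GRing.scale/= ler_norml => /andP[+ _].
have := mulr_gt0 gv t0; lra.
Qed.

Lemma interior_grad_ge0 A y i s d v : defining A y i s d -> d y = 0 ->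
  (\forall t \near (0 : R)^'+, interior A (y + t *: v)) -> 0 <= dotv (grad d y) v.
Proof.
move=> Ad dy intA; rewrite leNgt; apply/negP => gv.
have [_ _ _ _ near_y] := Ad.
have cv := is_derive_affine y v.
have G : is_grad d (y + 0 *: v) (grad d y).
  by rewrite scale0r addr0; exact: def_grad Ad y.
have /is_derive0P := curve_chain G cv.
have e0 : 0 < - dotv (grad d y) v / 2 by rewrite divr_gt0// oppr_gt0.
move=> /(_ _ e0); rewrite scale0r addr0 dy => H.
have near_c : \forall t \near (0 : R), interior A (y + t *: v) <-> 0 < d (y + t *: v).
  have y0 : y = y + 0 *: v by rewrite scale0r addr0.
  rewrite {1}y0 in near_y; have := near_continuous (is_derive0_continuous cv) near_y.
  by apply: filterS => t [].
near (0 : R)^'+ => t.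
have t0 : 0 < t by [].
have d0 : 0 < d (y + t *: v).
  have <- : interior A (y + t *: v) <-> 0 < d (y + t *: v).
    by near: t; apply: cvg_within near_c.
  by near: t.
have : `|d (y + t *: v) - 0 - t *: dotv (grad d y) v| <= - dotv (grad d y) v / 2 * `|t|.
  by near: t; apply: cvg_within H.
rewrite subr0 (gtr0_norm t0) /GRing.scale/= ler_norml => /andP[_].
have : t * dotv (grad d y) v < 0 by rewrite pmulr_rlt0.
by lra.
Unshelve. all: by end_near. Qed.

(** By [bproj_curve] the normal is orthogonal to everything orthogonal to [grad d y], hence a
    multiple of it; unit length fixes the factor up to sign, and pointing inward fixes the sign. *)
Lemma is_inward_normalP A y i s d nu : defining A y i s d -> d y = 0 ->
  is_inward_normal A y nu <-> nu = (norm2 (grad d y))^-1 *: grad d y.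
Proof.
move=> Ad dy; set g := grad d y.
have g0 : 0 < norm2 g by rewrite norm2_gt0 (def_grad_neq0 Ad).
have gg : dotv g g = norm2 g ^+ 2 by rewrite norm2_sq.
split=> [[nn nt ni]|->].
  have E : nu = (dotv nu g / dotv g g) *: g.
    apply: dotv_inj => w.
    have : dotv nu (w - (dotv g w / dotv g g) *: g) = 0.
      apply: nt; exists (fun t => bproj i s d (y + t *: (w - (dotv g w / dotv g g) *: g))).
      apply: bproj_curve => //; rewrite dotvBr dotvZr divfK ?subrr//.
      by rewrite dotv_eq0 (def_grad_neq0 Ad).
    rewrite dotvBr dotvZr dotvZl => /eqP; rewrite subr_eq0 => /eqP ->.
    by rewrite mulrAC [in RHS]mulrAC [dotv g w * _]mulrC.
  have p0 : 0 <= dotv nu g by rewrite dotvC; exact: interior_grad_ge0 Ad dy ni.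
  rewrite E; congr (_ *: _); rewrite gg.
  suff -> : dotv nu g = norm2 g by field; rewrite gt_eqF.
  have : dotv nu g ^+ 2 = norm2 g ^+ 2.
    move: nn; rewrite {1}E dotvZl => H.
    have : dotv nu g * dotv nu g = dotv g g.
      rewrite -[RHS]mulr1 -H {1}[dotv nu g](dotvC) (dotvC nu); field.
      by rewrite dotv_eq0 (def_grad_neq0 Ad).
    by rewrite expr2 gg.
  by move=> /(congr1 Num.sqrt); rewrite !sqrtr_sqr !ger0_norm// ltW.
split.
- by rewrite dotvZl dotvZr gg; field; rewrite gt_eqF.
- by move=> v /(tangent_grad Ad) H; rewrite dotvZl H mulr0.
- apply: (grad_pos_interior Ad dy).
  by rewrite dotvZr mulr_gt0 ?invr_gt0// -/g dotv_gt0 (def_grad_neq0 Ad).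
Qed.

Lemma inward_normalE A y i s d : defining A y i s d -> d y = 0 ->
  inward_normal A y = (norm2 (grad d y))^-1 *: grad d y.
Proof.
move=> Ad dy; have P nu := is_inward_normalP nu Ad dy.
apply/P; apply: (@getPex _ [set nu | is_inward_normal A y nu]).
by exists ((norm2 (grad d y))^-1 *: grad d y); apply/P.
Qed.

End normal.

(** * Positive curvature as nondegeneracy of the second derivative *)

Section curvature.
Context {R : realType} {n : nat} (K : set 'rV[R]_n).
Hypothesis K_curv : forall (z : 'rV[R]_n) (kappa : R),
  boundary K z -> principal_curvature K z kappa -> 0 < kappa.

(** Transfers a vanishing derivative from the squared length of [grad d] to the normalizing factor
    without differentiating a square root. *)
Lemma norm2_inv_lipschitz (p q : 'rV[R]_n) : 1 <= dotv p p -> 1 <= dotv q q ->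
  `|(norm2 p)^-1 - (norm2 q)^-1| <= `|dotv p p - dotv q q|.
Proof.
move=> p1 q1.
have P1 : 1 <= norm2 p by rewrite -sqrtr1 ler_sqrt// (le_trans ler01).
have Q1 : 1 <= norm2 q by rewrite -sqrtr1 ler_sqrt// (le_trans ler01).
rewrite -!norm2_sq; move: (norm2 p) (norm2 q) P1 Q1 => a b a1 b1.
have a0 : 0 < a by lra.
have b0 : 0 < b by lra.
rewrite (_ : a^-1 - b^-1 = (b - a) / (a * b)); last by field; rewrite !gt_eqF.
have ab0 := mulr_gt0 a0 b0.
rewrite normrM normfV (gtr0_norm ab0) (distrC b a) subr_sqr normrM.
rewrite (gtr0_norm (addr_gt0 a0 b0)) ler_wpM2l//.
by rewrite (@le_trans _ _ 1)//; [rewrite invf_le1//; nra|lra].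
Qed.

(* A tangent vector annihilated by the differential of [grad d] is a direction
   of principal curvature 0. *)
Lemma curvature_nondegenerate z i s d v : defining K z i s d -> boundary K z ->
  dotv (grad d z) v = 0 -> (forall j, dotv (grad (partial j d) z) v = 0) -> v = 0.
Proof.
move=> Kd bz gv hv; apply/eqP; apply: contrapT => /negP v0.
have dz := (defining_boundary Kd).1 bz.
suff : 0 < (0 : R) by rewrite ltxx.
apply: (K_curv bz).
pose c t := bproj i s d (z + t *: v).
have bc : boundary_curve K c z v by exact: bproj_curve.
have [c0 cK cv] := bc.
exists c, v; split => //.
rewrite scale0r oppr0.
have [dC2 _ _ _ _] := Kd.
have Kd_near : \forall t \near (0 : R), defining K (c t) i s d.
  have Kn : \forall x \near c 0, defining K x i s d.
    by rewrite c0; exact: defining_near Kd.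
  exact: near_continuous (is_derive0_continuous cv) Kn.
have nE : \forall t \near (0 : R), (norm2 (grad d (c t)))^-1 *: grad d (c t) =
    inward_normal K (c t).
  apply: filterS Kd_near => t Kdt; rewrite (inward_normalE Kdt)//.
  exact: (bproj0 Kd).
apply: is_derive_near nE _.
have pc j : is_derive (0 : R) (1 : R) (fun t => partial j d (c t)) 0.
  have G : is_grad (partial j d) (c 0) (grad (partial j d) z).
    by rewrite c0; have [_ /(_ j)/C1at_is_grad] := dC2 z.
  by have := curve_chain G cv; rewrite hv.
pose N t := (norm2 (grad d (c t)))^-1.
have Nd : is_derive (0 : R) (1 : R) N 0.
  have D : is_derive (0 : R) (1 : R) (fun t => dotv (grad d (c t)) (grad d (c t))) 0.
    have pp j : is_derive (0 : R) (1 : R) (fun t => partial j d (c t) * partial j d (c t)) 0.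
      by have := is_deriveM (pc j) (pc j); rewrite !scaler0 addr0.
    have := is_derive_sum (h := fun j t => partial j d (c t) * partial j d (c t)) pp.
    rewrite (_ : \sum_(j < n) (0 : R) = 0); last by rewrite big1.
    apply: is_derive_near; near=> t.
    by rewrite fct_sumE; apply: eq_bigr => j _; rewrite !mxE.
  apply/is_derive0P => e e0; apply: filterS ((is_derive0P _ _).1 D e e0) => t.
  rewrite !scaler0 !subr0; apply: le_trans.
  by apply: norm2_inv_lipschitz; exact: def_grad_ge1 Kd _.
apply: is_derive_rV => j; rewrite mxE.
have := @is_deriveM _ _ N (fun t => partial j d (c t)) 0 1 0 0 Nd (pc j).
rewrite !scaler0 addr0; apply: is_derive_near; near=> t.
by rewrite !mxE.
Unshelve. all: by end_near. Qed.

End curvature.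

(** * Differentiability of continuous inverses *)

Section inverse_C1.
Context {R : realType}.

Lemma unitmx_injective n (A : 'M[R]_n) :
  (forall v : 'rV[R]_n, v *m A = 0 -> v = 0) -> A \in unitmx.
Proof.
move=> H; rewrite -row_free_unit -kermx_eq0; apply/eqP/row_matrixP => i.
by rewrite row0; apply: H; rewrite -row_mul mulmx_ker row0.
Qed.

Lemma mulmx_jac m n (F : 'rV[R]_m -> 'rV[R]_n) x (v : 'rV[R]_m) j :
  (v *m jac F x) 0 j = dotv (grad (fun y => F y 0 j) x) v.
Proof. by rewrite mxE; apply: eq_bigr => i _; rewrite !mxE mulrC. Qed.

Lemma jac_continuous m n (F : 'rV[R]_m -> 'rV[R]_n) x :
  (forall j, C1at (fun y => F y 0 j) x) -> {for x, continuous (jac F)}.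
Proof.
move=> FC; apply/continuous_at_mxP => i j.
have := @C1at_partial_continuous _ _ _ _ i (FC j).
by apply: continuous_at_near; near=> y; rewrite !mxE.
Unshelve. all: by end_near. Qed.

Lemma continuous_at_unitmx {V : normedModType R} n (A : V -> 'M[R]_n) x :
  {for x, continuous A} -> A x \in unitmx -> \forall y \near x, A y \in unitmx.
Proof.
move=> Ac Au; have dc : {for x, continuous (fun y => \det (A y))} by exact: cvg_det.
have := near_neq0 dc; rewrite -unitfE -unitmxE => /(_ Au).
by apply: filterS => y; rewrite -unitfE -unitmxE.
Qed.

(** The derivative formula of [is_grad_inverse] holds at all points near x, and its right side is
    continuous at x. A general q allows the inverse to be composed with a known map, possibly from a
    space of another dimension. *)
Lemma C1at_inverse m n (F : 'rV[R]_n -> 'rV[R]_n) (P q : 'rV[R]_m -> 'rV[R]_n) x :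
  (forall j, C1at (fun z => F z 0 j) (P x)) -> jac F (P x) \in unitmx ->
  (\forall y \near x, {for y, continuous P} /\ F (P y) = q y) ->
  (forall j, C1at (fun y => q y 0 j) x) ->
  (forall j, C1at (fun y => P y 0 j) x) /\
  jac P x = jac q x *m invmx (jac F (P x)).
Proof.
move=> FC Ju H qC.
have [Pc _] := nbhs_singleton H.
have JFc := jac_continuous FC.
have JPc : {for x, continuous (fun y => jac F (P y))} by exact: continuous_at_comp.
have Ju' := continuous_at_unitmx JPc Ju.
have FC' : \forall y \near x, forall j, is_grad (fun z => F z 0 j) (P y) (col j (jac F (P y)))^T.
  have FG : \forall z \near P x, forall j, is_grad (fun z => F z 0 j) z (grad (fun z => F z 0 j) z).
    by apply: near_forall_ord => j; have [] := FC j.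
  by have := near_continuous Pc FG; apply: filterS => y; exact: jac_is_grad.
have qG : \forall y \near x, forall j, is_grad (fun z => q z 0 j) y (col j (jac q y))^T.
  have qG : \forall y \near x, forall j, is_grad (fun z => q z 0 j) y (grad (fun z => q z 0 j) y).
    by apply: near_forall_ord => j; have [] := qC j.
  by apply: filterS qG => y; exact: jac_is_grad.
have PG : \forall y \near x, forall j, is_grad (fun z => P z 0 j) y
    (col j (jac q y *m invmx (jac F (P y))))^T.
  apply: filterS3 (near_join H) Ju' (near_and FC' qG) => y Hy Jy [FCy qGy].
  have [Py _] := nbhs_singleton Hy.
  apply: is_grad_inverse FCy Jy Py _ qGy.
  by apply: filterS Hy => z [].
split; last exact: is_grad_jac (nbhs_singleton PG).
move=> j; apply: (@C1at_intro _ _ _ _ (fun y => (col j (jac q y *m invmx (jac F (P y))))^T)).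
  by apply: filterS PG => y.
have c : {for x, continuous (fun y => jac q y *m invmx (jac F (P y)))}.
  exact: cvg_mulmx (jac_continuous qC) (cvg_invmx Ju JPc).
apply/continuous_at_mxP => k i.
have /continuous_at_mxP /(_ i j) := c.
by apply: continuous_at_near; near=> y; rewrite !mxE.
Unshelve. all: by end_near. Qed.

End inverse_C1.

(** * One-sided estimates for gradients and stability of minimizers *)

Section directional.
Context {R : realType} {n : nat}.

Lemma is_grad_dir_le (f : 'rV[R]_n -> R) x g v a : is_grad f x g ->
  (forall t : R, 0 < t < 1 -> f (x + t *: v) <= f x + t * a) -> dotv g v <= a.
Proof.
move=> fg H; apply/ler_addgt0Pr => e e0.
have G : is_grad f (x + 0 *: v) g by rewrite scale0r addr0.
have /is_derive0P/(_ _ e0) := curve_chain G (is_derive_affine x v).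
rewrite scale0r addr0 => /near_normP[r r0 Hr].
pose t := Num.min (1 / 2) (r / 2) : R.
have t0 : 0 < t by rewrite lt_min !divr_gt0.
have t1 : t < 1 by rewrite (@le_lt_trans _ _ (1 / 2))// ?ge_min ?lexx//; lra.
have tr : t < r.
  by rewrite (@le_lt_trans _ _ (r / 2))// ?ge_min ?lexx ?orbT//; lra.
have := Hr t; rewrite subr0 gtr0_norm// => /(_ tr).
rewrite /GRing.scale/= ler_norml => /andP[A _].
have := H t; rewrite t0 t1 => /(_ isT) B.
rewrite -(ler_pM2l t0); lra.
Qed.

Lemma is_grad_dir_ge (f : 'rV[R]_n -> R) x g v a : is_grad f x g ->
  (forall t : R, 0 < t < 1 -> f x + t * a <= f (x + t *: v)) -> a <= dotv g v.
Proof.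
move=> /is_gradN fg H; rewrite -lerN2 -dotvNl.
apply: is_grad_dir_le fg _ => t /H; rewrite mulrN; lra.
Qed.

Lemma is_grad_line_cst (f : 'rV[R]_n -> R) x g v a : is_grad f x g ->
  (forall t : R, 0 < t < 1 -> f (x + t *: v) = f x + t * a) -> dotv g v = a.
Proof.
move=> fg H; apply/eqP; rewrite eq_le (is_grad_dir_le fg) ?(is_grad_dir_ge fg)//.
  by move=> t /H ->.
by move=> t /H ->.
Qed.

(** On the compact part of P at distance at least e from y, the function exceeds its minimum by a
    positive gap. A perturbation of at most a third of the gap cannot move a minimizer there. *)
Lemma argmin_stable (P : set 'rV[R]_n) (f0 : 'rV[R]_n -> R) y e :
  compact P -> continuous f0 -> (forall z, P z -> z <> y -> f0 y < f0 z) -> P y ->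
  0 < e -> exists2 r, 0 < r & forall f, (forall z, P z -> `|f z - f0 z| <= r) ->
    forall y', P y' -> (forall z, P z -> f y' <= f z) -> `|y' - y| < e.
Proof.
move=> cP fc ymin Py e0.
pose P' := P `&` [set z | e <= `|z - y|].
have cl : closed [set z : 'rV[R]_n | e <= `|z - y|].
  have -> : [set z : 'rV[R]_n | e <= `|z - y|] = ~` [set z | `|z - y| < e].
    by apply/seteqP; split=> z /=; rewrite leNgt => /negP.
  rewrite closedC openE => z /= ze; rewrite /interior.
  apply: (near_normP z _).2; exists (e - `|z - y|); first by rewrite subr_gt0.
  move=> w wz /=; rewrite -(subrK z w) -addrA (le_lt_trans (ler_normD _ _))//.
  by rewrite -ltrBrDr.
have cP' : compact P' by exact: compact_closedI.
have [P'0|] := pselect (P' !=set0); last first.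
  move=> P'0; exists 1 => // f _ y' Py' _; rewrite ltNge; apply/negP => ey.
  by apply: P'0; exists y'.
have [z0] := EVT_min_rV P'0 cP' (continuous_subspaceT fc).
rewrite inE => -[Pz0 /= ez0] z0min.
have z0y : z0 <> y by move=> z0y; move: ez0; rewrite z0y subrr normr0 leNgt e0.
have D := ymin _ Pz0 z0y.
exists ((f0 z0 - f0 y) / 3); first by rewrite divr_gt0// subr_gt0.
move=> f Hf y' Py' y'min; rewrite ltNge; apply/negP => ey.
have A : f0 z0 <= f0 y' by apply: z0min; rewrite inE.
have := Hf _ Py'; have := Hf _ Py; rewrite !ler_norml => /andP[_ B] /andP[C _].
have := y'min _ Py; lra.
Qed.

End directional.

(** * Convex bodies with positive curvatures *)

Section regular_body.
Context {R : realType} {n : nat}.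

Record regular_body (K : set 'rV[R]_n) : Prop := RegularBody {
  regular_convex_body : convex_body K ;
  body_defining : forall V, boundary K V -> exists i s d, defining K V i s d ;
  body_curv : forall (z : 'rV[R]_n) (kappa : R),
    boundary K z -> principal_curvature K z kappa -> 0 < kappa }.

Context (K : set 'rV[R]_n) (KB : regular_body K).
Let CB := regular_convex_body KB.
Implicit Types (x y z V v xi : 'rV[R]_n) (d : 'rV[R]_n -> R).
Local Notation gamma := (gauge_fun K).
Local Notation h := (gauge_fun (polar K)).

(** K contains a small multiple u = - t g of the gradient g, and the direction from V to u / 2
    enters the interior. So the product of g with u / 2 - V is nonnegative, while that with u is
    negative. *)
Lemma def_grad_transversal V i s d : defining K V i s d -> boundary K V ->
  dotv (grad d V) V < 0.
Proof.
move=> Kd bV; have gV := (boundary_gaugeP CB V).1 bV.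
have dV := (defining_boundary Kd).1 bV.
set g := grad d V.
have g0 : g != 0 by exact: (def_grad_neq0 Kd).
have [r r0 Hr] := origin_ball CB.
pose t := r / 2 / `|g|.
have t0 : 0 < t by rewrite !divr_gt0 ?normr_gt0.
pose u := - t *: g.
have Ku : K u.
  apply: Hr; rewrite normrZ normrN (gtr0_norm t0) divfK ?normr_eq0//.
  by rewrite ltr_pdivrMr// ltr_pMr// ltr1n.
have H : \forall a \near (0 : R)^'+, interior K (V + a *: (2^-1 *: u - V)).
  near=> a.
  have a0 : 0 < a by [].
  have a1 : a < 1 by near: a; exact: nbhs_right_lt.
  apply/(interior_gaugeP CB).
  rewrite (_ : V + _ = (1 - a) *: V + (a / 2) *: u); last first.
    by apply/rowP => j; rewrite !mxE; ring.
  rewrite (le_lt_trans (gaugeD CB _ _))//.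
  have a1' : 0 <= 1 - a by rewrite subr_ge0 ltW.
  have a2' : 0 <= a / 2 by rewrite divr_ge0 ?(ltW a0).
  rewrite (gaugeZ CB V a1') (gaugeZ CB u a2') gV.
  have : gamma u <= 1 by apply/(gauge_le1P CB).
  by nra.
have := interior_grad_ge0 Kd dV H.
rewrite -/g dotvBr !dotvZr.
have : 0 < t * dotv g g by rewrite mulr_gt0// dotv_gt0.
by lra.
Unshelve. all: by end_near. Qed.

Lemma normalized_continuous x : x != 0 ->
  {for x, continuous (fun y => (gamma y)^-1 *: y)}.
Proof.
move=> x0; apply: continuous_atZ => //.
apply: continuous_atV; last exact: (gauge_continuous CB).
by rewrite gt_eqF// (gauge_gt0 CB).
Qed.

(** Implicit differentiation of d (y / gamma y) = 0. Differentiability of gamma is not presupposed: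
    its Lipschitz bound controls the motion of the normalized point, and transversality permits
    solving for the increment of gamma. *)
Lemma gauge_is_grad x i s d : x != 0 ->
  let V := (gamma x)^-1 *: x in defining K V i s d ->
  is_grad gamma x ((dotv (grad d V) V)^-1 *: grad d V).
Proof.
move=> x0 V Kd e e0.
have gx0 : 0 < gamma x by exact: (gauge_gt0 CB).
have bV : boundary K V by apply/(boundary_gaugeP CB); exact: (gauge_normalized CB).
have dV := (defining_boundary Kd).1 bV.
set g := grad d V; set a := dotv g V.
have a0 : a < 0 by exact: def_grad_transversal Kd bV.
have [C C0 HC] := gauge_lipschitz CB.
pose B := 1 + `|V| * C.
have B0 : 0 < B by rewrite ltr_pwDl// mulr_ge0// ltW.
have e1 : 0 < e * - a / B by rewrite !mulr_gt0 ?oppr_gt0 ?invr_gt0.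
have Vc := normalized_continuous x0.
have N1 := near_continuous Vc (def_grad Kd V e1).
have N2 : \forall y \near x, 0 < gamma y.
  by apply: near_gt0 => //; exact: (gauge_continuous CB).
have N3 : \forall y \near x, defining K ((gamma y)^-1 *: y) i s d.
  exact: near_continuous Vc (defining_near Kd).
apply: filterS3 N1 N2 N3 => y H1 gy0 Kdy.
set W := (gamma y)^-1 *: y in H1 Kdy *.
have y0 : y != 0 by apply: contraTneq gy0 => ->; rewrite (gauge0 CB) ltxx.
have dW : d W = 0.
  apply/(defining_boundary Kdy); apply/(boundary_gaugeP CB).
  exact: (gauge_normalized CB).
have WV : gamma y *: (W - V) = (y - x) - (gamma y - gamma x) *: V.
  by apply/rowP => j; rewrite !mxE; field; rewrite !gt_eqF.
move: H1; rewrite dW dV subrr sub0r normrN => H1.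
have H2 : `|dotv g (y - x) - (gamma y - gamma x) * a| <= e * - a * `|y - x|.
  rewrite /a -dotvZr -dotvBr -WV dotvZr normrM gtr0_norm//.
  apply: (@le_trans _ _ (gamma y * (e * - a / B * `|W - V|))).
    by rewrite ler_pM2l.
  rewrite mulrCA -[X in _ * (X * _) <= _](gtr0_norm gy0) -normrZ WV.
  rewrite (_ : e * - a * `|y - x| = e * - a / B * (B * `|y - x|)); last first.
    by field; rewrite gt_eqF.
  rewrite ler_pM2l// (le_trans (ler_normB _ _))// /B mulrDl mul1r lerD2l.
  by rewrite normrZ mulrC -mulrA ler_wpM2l.
rewrite dotvZl (_ : _ - _ = - a^-1 * (dotv g (y - x) - (gamma y - gamma x) * a)); last first.
  by field; rewrite lt_eqF.
rewrite normrM normrN normfV (ltr0_norm a0).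
rewrite ler_pdivrMl ?oppr_gt0// (le_trans H2)// le_eqVlt; apply/orP; left.
by apply/eqP; ring.
Qed.

Lemma body_normalized_defining x : x != 0 ->
  exists i s d, defining K ((gamma x)^-1 *: x) i s d.
Proof.
move=> x0; apply: (body_defining KB); apply/(boundary_gaugeP CB).
exact: (gauge_normalized CB).
Qed.

Lemma gauge_C1 x : x != 0 -> C1at gamma x.
Proof.
move=> x0; have [i [s [d Kd]]] := body_normalized_defining x0.
have Vc := normalized_continuous x0.
pose V y := (gamma y)^-1 *: y.
apply: (@C1at_intro _ _ _ _ (fun y => (dotv (grad d (V y)) (V y))^-1 *: grad d (V y))).
  have N0 : \forall y \near x, y != 0.
    apply/near_normP; exists `|x|; first by rewrite normr_gt0.
    by move=> y yx; apply: contraTneq yx => ->; rewrite sub0r normrN ltxx.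
  have N1 := near_continuous Vc (defining_near Kd).
  apply: filterS2 N0 N1 => y y0 Kdy; exact: (gauge_is_grad y0 Kdy).
have gc : {for x, continuous (fun y => grad d (V y))}.
  by apply: continuous_at_comp Vc _; have [/(_ ((gamma x)^-1 *: x))[[_ ?] _] _ _ _ _] := Kd.
apply: continuous_atZ (gc); apply: continuous_atV; last exact: (continuous_at_dotv gc Vc).
rewrite lt_eqF// (def_grad_transversal Kd)//.
by apply/(boundary_gaugeP CB); exact: (gauge_normalized CB).
Qed.

Lemma gauge_grad x : x != 0 -> is_grad gamma x (grad gamma x).
Proof. by move=> /gauge_C1/C1at_is_grad. Qed.

Lemma gauge_grad_self x : x != 0 -> dotv (grad gamma x) x = gamma x.
Proof.
move=> x0; apply: is_grad_line_cst (gauge_grad x0) _ => t /andP[t0 _].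
have t1 : 0 <= 1 + t by rewrite addr_ge0// ltW.
by rewrite -[X in X + _]scale1r -scalerDl (gaugeZ CB _ t1) mulrDl mul1r.
Qed.

Lemma gauge_grad_le x z : x != 0 -> dotv (grad gamma x) z <= gamma z.
Proof.
move=> x0; apply: is_grad_dir_le (gauge_grad x0) _ => t /andP[t0 _].
by rewrite (le_trans (gaugeD CB _ _))// (gaugeZ CB _ (ltW t0)).
Qed.

(** For the positively homogeneous gamma these two conditions say that xi is a subgradient at x;
    where gamma is differentiable there is only one. *)
Lemma gauge_grad_unique x xi : x != 0 -> (forall z, dotv xi z <= gamma z) ->
  dotv xi x = gamma x -> xi = grad gamma x.
Proof.
move=> x0 H Hx.
have P v : dotv xi v <= dotv (grad gamma x) v.
  apply: is_grad_dir_ge (gauge_grad x0) _ => t _.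
  by rewrite -Hx -dotvZr -dotvDr H.
apply: dotv_inj => v; apply/eqP; rewrite eq_le P /=.
by have := P (- v); rewrite !dotvNr lerN2.
Qed.

Lemma gauge_gradZ x t : 0 < t -> x != 0 -> grad gamma (t *: x) = grad gamma x.
Proof.
move=> t0 x0; have tx0 : t *: x != 0 by rewrite scaler_eq0 gt_eqF.
apply: gauge_grad_unique => //; first by move=> z; exact: gauge_grad_le.
have := gauge_grad_self tx0; rewrite dotvZr (gaugeZ CB _ (ltW t0)).
by move=> /(mulfI (lt0r_neq0 t0)).
Qed.

Lemma support_gauge_grad x : x != 0 -> h (grad gamma x) = 1.
Proof.
move=> x0; apply/eqP; rewrite eq_le; apply/andP; split.
  have [z Kz <-] := support_attained CB (grad gamma x).
  by rewrite (le_trans (gauge_grad_le z x0))//; exact/(gauge_le1P CB).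
have := dotv_le_support_gauge CB (grad gamma x) x.
by rewrite gauge_grad_self// ler_pMl// (gauge_gt0 CB).
Qed.

(** The Lagrange condition at a maximizer: xi divided by h xi is a subgradient of gamma at z. *)
Lemma support_max_grad xi z : xi != 0 -> K z -> dotv xi z = h xi ->
  [/\ z != 0, gamma z = 1 & xi = h xi *: grad gamma z].
Proof.
move=> xi0 Kz xiz; have hx0 := support_gt0 CB xi0.
have z0 : z != 0 by apply: contraTneq hx0 => z0; rewrite -xiz z0 dotv0r ltxx.
have gz : gamma z = 1.
  apply/eqP; rewrite eq_le; apply/andP; split; first exact/(gauge_le1P CB).
  by have := dotv_le_support_gauge CB xi z; rewrite xiz ler_pMr.
split => //.
rewrite -(@gauge_grad_unique z ((h xi)^-1 *: xi))//.
- by rewrite scalerA divff ?scale1r// gt_eqF.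
- by move=> w; rewrite dotvZl ler_pdivrMl// (dotv_le_support_gauge CB).
- by rewrite dotvZl xiz gz mulVf// gt_eqF.
Qed.

(** Strict convexity from positive curvature: two maximizers would span a boundary segment along
    which the normal is constant, a direction excluded by [curvature_nondegenerate]. *)
Lemma support_max_unique xi z1 z2 : xi != 0 -> K z1 -> K z2 ->
  dotv xi z1 = h xi -> dotv xi z2 = h xi -> z1 = z2.
Proof.
move=> xi0 K1 K2 e1 e2; have hx0 := support_gt0 CB xi0.
pose v := z2 - z1.
(* The midpoint, so that the segment extends to both sides and derivatives at m in the direction v
   are two-sided. *)
pose m := z1 + 2^-1 *: v.
have vv : dotv xi v = 0 by rewrite dotvBr e1 e2 subrr.
have onK t : `|t| <= 2^-1 -> K (m + t *: v) /\ dotv xi (m + t *: v) = h xi.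
  rewrite ler_norml => /andP[t1 t2]; split; last first.
    by rewrite !dotvDr !dotvZr vv e1 !mulr0 !addr0.
  rewrite (_ : m + _ = (2^-1 - t) *: z1 + (1 - (2^-1 - t)) *: z2); last first.
    by apply/rowP => j; rewrite !mxE; field.
  by apply: (convex_comb CB) => //; apply/andP; split; lra.
have [Km em] : K m /\ dotv xi m = h xi.
  by have := onK 0; rewrite scale0r addr0 normr0; apply; rewrite invr_ge0.
have [m0 gm _] := support_max_grad xi0 Km em.
have bm : boundary K m by exact/(boundary_gaugeP CB).
have [i [s [d Kd]]] := body_defining KB bm.
have [dC ss di _ _] := Kd.
have s0 : s != 0 by apply/eqP => s0; move: ss; rewrite s0 mulr0 => /eqP; rewrite eq_sym oner_eq0.
have near_m : \forall t \near (0 : R), defining K (m + t *: v) i s d.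
  have cc := is_derive0_continuous (is_derive_affine m v).
  have Kn : \forall z \near m + 0 *: v, defining K z i s d.
    by rewrite scale0r addr0; exact: defining_near Kd.
  exact: near_continuous cc Kn.
(* All these gradients are parallel to xi and have i-th component s, hence they coincide. *)
have near_E : \forall t \near (0 : R), d (m + t *: v) = 0 /\
    grad d (m + t *: v) = (s / xi 0 i) *: xi.
  have n2 : \forall t \near (0 : R), `|t| <= 2^-1.
    by have := @near_norm_le R R 0 2^-1; rewrite invr_gt0 => /(_ (ltr0Sn _ 1)); apply: filterS => t; rewrite subr0.
  apply: filterS2 near_m n2 => t Kdt /onK[Kt et].
  have [t0 gt Et] := support_max_grad xi0 Kt et.
  set p := m + t *: v in t0 gt Et Kt et Kdt *.
  have bp : boundary K p by exact/(boundary_gaugeP CB).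
  split; first exact/(defining_boundary Kdt).
  have := gauge_is_grad t0; rewrite gt invr1 scale1r => /(_ _ _ _ Kdt)/is_grad_grad G.
  have a0 : dotv (grad d p) p != 0 by rewrite lt_eqF// (def_grad_transversal Kdt).
  rewrite G in Et.
  have : xi 0 i = h xi * ((dotv (grad d p) p)^-1 * s).
    by rewrite {1}Et !mxE di.
  move=> ->; rewrite {2}Et !scalerA.
  rewrite [X in _ = X *: _](_ : _ = 1) ?scale1r//; field.
  by rewrite a0 s0 gt_eqF.
suff v0 : v = 0 by apply/esym/eqP; rewrite -subr_eq0 -/v v0.
apply: (curvature_nondegenerate (body_curv KB) Kd bm) => [|j].
  have G : is_grad d (m + 0 *: v) (grad d m) by rewrite scale0r addr0; exact: def_grad Kd m.
  have := curve_chain G (is_derive_affine m v); move/is_derive_unique; apply.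
  by apply: (@is_derive_near _ _ (fun=> 0)); apply: filterS near_E => t [].
have G : is_grad (partial j d) (m + 0 *: v) (grad (partial j d) m).
  by rewrite scale0r addr0; exact: C1at_is_grad ((dC m).2 j).
have := curve_chain G (is_derive_affine m v); move/is_derive_unique; apply.
apply: (@is_derive_near _ _ (fun=> ((s / xi 0 i) *: xi) 0 j)).
by apply: filterS near_E => t [_ <-]; rewrite mxE.
Qed.

End regular_body.

(** * Support points and second derivatives of the support function *)

Section support_point.
Context {R : realType} {n : nat} (K : set 'rV[R]_n) (KB : regular_body K).
Let CB := regular_convex_body KB.
Implicit Types (x y z V v xi : 'rV[R]_n) (d : 'rV[R]_n -> R).
Local Notation gamma := (gauge_fun K).
Local Notation h := (gauge_fun (polar K)).

Definition support_pt xi : 'rV[R]_n := xget 0 [set z | K z /\ dotv xi z = h xi].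

Lemma support_ptP xi : K (support_pt xi) /\ dotv xi (support_pt xi) = h xi.
Proof.
have [z Kz zx] := support_attained CB xi.
by rewrite /support_pt; case: xgetP => [y -> //|/(_ z)]; case.
Qed.

Lemma support_pt_unique xi z : xi != 0 -> K z -> dotv xi z = h xi ->
  support_pt xi = z.
Proof.
by move=> xi0 Kz xz; have [Ks xs] := support_ptP xi; exact: support_max_unique xi0 _ _ xs xz.
Qed.

Lemma support_pt_gauge_grad x : x != 0 ->
  support_pt (grad gamma x) = (gamma x)^-1 *: x.
Proof.
move=> x0; have h1 := support_gauge_grad KB x0.
have g0 := gauge_gt0 CB x0.
apply: support_pt_unique.
- apply: contraTneq (ltr01 : 0 < (1 : R)) => N0.
  by rewrite -h1 N0 (support0 CB) ltxx.
- by apply/(gauge_le1P CB); rewrite gauge_normalized.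
- by rewrite dotvZr (gauge_grad_self KB)// mulVf ?gt_eqF// h1.
Qed.

Lemma near_neq x : x != 0 -> \forall y \near x, y != 0.
Proof.
move=> x0; apply/near_normP; exists `|x|; first by rewrite normr_gt0.
by move=> y yx; apply: contraTneq yx => ->; rewrite sub0r normrN ltxx.
Qed.

(** The maximizer is unique, and on the bounded set K a small change of xi changes the linear
    functional uniformly little, so [argmin_stable] applies. *)
Lemma support_pt_continuous xi : xi != 0 -> {for xi, continuous support_pt}.
Proof.
move=> xi0; apply/continuous_normP => e e0.
have [Ks xs] := support_ptP xi.
have [M M0 HM] := body_bounded CB.
have fc : continuous (fun z => - dotv xi z).
  by move=> z; apply: continuous_atN; exact: dotv_continuous.
have min z : K z -> z <> support_pt xi -> - dotv xi (support_pt xi) < - dotv xi z.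
  move=> Kz zs; rewrite ltrN2 xs lt_neqAle (support_ge CB)// andbT.
  by apply/eqP => /(support_pt_unique xi0 Kz)/esym.
have [r r0 Hr] := argmin_stable (body_compact CB) fc min Ks e0.
have C0 : 0 < n%:R * M + 1 by rewrite ltr_wpDl// mulr_ge0// ltW.
apply: filterS2 (near_neq xi0) (near_norm_le xi (divr_gt0 r0 C0)) => eta eta0 Heta.
apply/ltW; have [Ke ee] := support_ptP eta.
apply: (Hr (fun z => - dotv eta z)) => // z Kz; last first.
  by rewrite lerN2 ee (support_ge CB).
rewrite -opprD normrN -dotvBl (le_trans (dotv_norm_le _ _))//.
rewrite mulrAC (@le_trans _ _ ((n%:R * M + 1) * `|eta - xi|))//.
  by rewrite ler_wpM2r// (le_trans (ler_wpM2l _ (HM _ Kz)))// lerDl.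
by rewrite mulrC -ler_pdivlMr.
Qed.

(** Each maximizer is a competitor for the other covector. This squeezes the linearization error
    between 0 and the product of the increments of the support point and of the covector, and
    support points are continuous. *)
Lemma support_is_grad xi : xi != 0 -> is_grad h xi (support_pt xi).
Proof.
move=> xi0 e e0.
have C0 : 0 < e / (n%:R + 1) by rewrite divr_gt0// ltr_wpDl.
have := (continuous_normP _ _).1 (support_pt_continuous xi0) _ C0.
apply: filterS => eta Heta.
have [Ks xs] := support_ptP xi; have [Ke ee] := support_ptP eta.
have A : 0 <= h eta - h xi - dotv (support_pt xi) (eta - xi).
  rewrite dotvC dotvBl xs; have := support_ge CB eta Ks; lra.
have B : h eta - h xi - dotv (support_pt xi) (eta - xi) <=
    dotv (support_pt eta - support_pt xi) (eta - xi).
  rewrite dotvBl lerD2r dotvC dotvBl ee.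
  by have := support_ge CB xi Ke; lra.
rewrite ger0_norm// (le_trans B)// (le_trans (ler_norm _))//.
rewrite (le_trans (dotv_norm_le _ _))// ler_wpM2r//.
rewrite (le_trans (ler_wpM2l _ Heta))// mulrCA; apply: ler_piMr; first exact: ltW.
by rewrite ler_pdivrMr ?mul1r ?lerDl// ltr_wpDl.
Qed.

(** Inverts the Gauss map of the boundary of K. At the support point of eta the gradient of d is
    parallel to eta with i-th component s, so it is s eta / eta_i; positive curvature makes the
    Jacobian invertible. *)
Lemma support_pt_C1 xi j : xi != 0 -> C1at (fun eta => support_pt eta 0 j) xi.
Proof.
move=> xi0; have [Ks xs] := support_ptP xi.
have [s0 gs _] := support_max_grad KB xi0 Ks xs.
have bs : boundary K (support_pt xi) by exact/(boundary_gaugeP CB).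
have [i [s [d Kd]]] := body_defining KB bs.
have [dC ss di _ _] := Kd.
have s0' : s != 0 by apply/eqP => s0'; move: ss; rewrite s0' mulr0 => /eqP; rewrite eq_sym oner_eq0.
(* On the boundary, where d = 0, this map is [grad d]; the extra term in the
   constant i-th component makes it a local diffeomorphism. *)
pose F (z : 'rV[R]_n) : 'rV[R]_n := \row_j (partial j d z + d z * (j == i)%:R).
pose q (eta : 'rV[R]_n) : 'rV[R]_n := \row_j (s * eta 0 j / eta 0 i).
have FE k : (fun z => F z 0 k) = (fun z => partial k d z + d z * (k == i)%:R).
  by apply/funext => z; rewrite mxE.
have FC k z : C1at (fun z => F z 0 k) z.
  have [C1 C2] := dC z.
  have CM := @C1atM _ _ d (fun=> (k == i)%:R) z C1 (C1at_cst _ z).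
  by rewrite FE; exact: (@C1atD _ _ (partial k d) _ z (C2 k) CM).
have FG k z v : dotv (grad (fun z => F z 0 k) z) v =
    dotv (grad (partial k d) z) v + (k == i)%:R * dotv (grad d z) v.
  have [C1 C2] := dC z.
  have := is_gradD (C1at_is_grad (C2 k))
    (is_gradM (C1at_is_grad C1) (is_grad_cst (k == i)%:R z)).
  by rewrite FE => /is_grad_grad ->; rewrite scaler0 add0r dotvDl dotvZl.
have Ju : jac F (support_pt xi) \in unitmx.
  apply: unitmx_injective => v vJ.
  have E k : dotv (grad (partial k d) (support_pt xi)) v +
      (k == i)%:R * dotv (grad d (support_pt xi)) v = 0.
    by rewrite -FG -mulmx_jac vJ mxE.
  (* As [partial i d] is constant, the i-th equation reduces to tangency of v, which removes the
     extra term from the other equations. *)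
  have ci : grad (partial i d) (support_pt xi) = 0.
    apply: is_grad_grad; apply: is_grad_near (is_grad_cst s _).
    by near=> z; rewrite di.
  have gv : dotv (grad d (support_pt xi)) v = 0.
    by have := E i; rewrite ci dotv0l add0r eqxx mul1r.
  apply: (curvature_nondegenerate (body_curv KB) Kd bs) => // k.
  by have := E k; rewrite gv mulr0 addr0.
have scale_xi eta : eta != 0 -> defining K (support_pt eta) i s d ->
    eta 0 i != 0 /\ F (support_pt eta) = q eta.
  move=> eta0 Kde; have [Ke ee] := support_ptP eta.
  have [e0 ge Ee] := support_max_grad KB eta0 Ke ee.
  have be : boundary K (support_pt eta) by exact/(boundary_gaugeP CB).
  have dE : d (support_pt eta) = 0 by exact/(defining_boundary Kde).
  have := gauge_is_grad KB e0; rewrite ge invr1 scale1r => /(_ _ _ _ Kde)/is_grad_grad G.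
  have a0 := def_grad_transversal KB Kde be.
  set g := grad d _ in G a0; set a := dotv g _ in G a0.
  have h0 := support_gt0 CB eta0.
  have Ek k : eta 0 k = h eta * (a^-1 * g 0 k) by rewrite {1}Ee G !mxE.
  have gi : g 0 i = s by rewrite /g (def_gradi Kde).
  have i0 : eta 0 i != 0.
    rewrite Ek gi; apply: mulf_neq0; first by rewrite gt_eqF.
    by apply: mulf_neq0 => //; rewrite invr_eq0 lt_eqF.
  split=> //; apply/rowP => k; rewrite !mxE dE mul0r addr0 !Ek gi.
  have -> : partial k d (support_pt eta) = g 0 k by rewrite /g mxE.
  by field; rewrite s0' (gt_eqF h0) (lt_eqF a0).
have Nd : \forall eta \near xi, defining K (support_pt eta) i s d.
  exact: near_continuous (support_pt_continuous xi0) (defining_near Kd).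
have [xii _] := scale_xi xi xi0 Kd.
have FP : \forall eta \near xi, {for eta, continuous support_pt} /\
    F (support_pt eta) = q eta.
  apply: filterS2 (near_neq xi0) Nd => eta eta0 Kde.
  by split; [exact: support_pt_continuous|have [] := scale_xi eta eta0 Kde].
have qC k : C1at (fun eta => q eta 0 k) xi.
  apply: (@C1at_near _ _ (fun eta => s * eta 0 k * (eta 0 i)^-1)).
    by near=> eta; rewrite mxE.
  apply: C1atM; last by apply: C1atV => //; exact: C1at_coord.
  by apply: C1atM; [exact: C1at_cst|exact: C1at_coord].
by have [+ _] := C1at_inverse (fun k => FC k (support_pt xi)) Ju FP qC; apply.
Unshelve. all: by end_near. Qed.

Lemma support_grad xi : xi != 0 -> grad h xi = support_pt xi.
Proof. by move=> /support_is_grad/is_grad_grad. Qed.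

Lemma support_partial xi j : xi != 0 ->
  \forall eta \near xi, partial j h eta = support_pt eta 0 j.
Proof.
move=> xi0; apply: filterS (near_neq xi0) => eta eta0.
by rewrite -(support_grad eta0) mxE.
Qed.

End support_point.

(** * The obstacle and its closest points *)

Section obstacle.
Context {R : realType} {n : nat}.

Record obstacle_data (K U : set 'rV[R]_n) (phi : 'rV[R]_n -> R) : Prop := ObstacleData {
  data_body : regular_body K ;
  data_bounded : bounded_set U ;
  data_open : open U ;
  data_defining : forall y, boundary U y -> exists i s d, defining U y i s d ;
  data_phi : C2 phi ;
  data_phi_grad : forall z, gauge_fun (polar K) (grad phi z) < 1 }.

Context (K U : set 'rV[R]_n) (phi : 'rV[R]_n -> R) (D : obstacle_data K U phi).
Let KB := data_body D.
Let CB := regular_convex_body KB.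
Implicit Types (x y z w V v xi : 'rV[R]_n) (d : 'rV[R]_n -> R).
Local Notation gamma := (gauge_fun K).
Local Notation h := (gauge_fun (polar K)).
Local Notation rho := (rho K U phi).
Local Notation closest := (rho_closest K U phi).

Lemma interior_U : interior U = U.
Proof. exact: (interior_id U).1 (data_open D). Qed.

Lemma boundary_notU y : boundary U y -> ~ U y.
Proof. by move=> [_]; rewrite interior_U. Qed.

Lemma boundary_neq x y : U x -> boundary U y -> x != y.
Proof. by move=> Ux by_; apply/eqP => xy; apply: (boundary_notU by_); rewrite -xy. Qed.

Lemma boundary_compact : compact (boundary U).
Proof.
have [M M0 HM] : exists2 M, 0 < M & forall x, U x -> `|x| <= M.
  by have /ex_strict_bound_gt0[M M0 HM] := data_bounded D; exists M => // x /HM/ltW.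
apply: bounded_closed_compact; last first.
  rewrite /boundary setDE; apply: closedI; first exact: closed_closure.
  by rewrite interior_U closedC; exact: data_open D.
exists M; split; first exact: gtr0_real.
move=> M' MM' x [cx _] /=.
apply: le_trans (ltW MM'); rewrite leNgt; apply/negP => xM.
have N : \forall w \near x, `|w - x| < `|x| - M.
  by apply: near_norm_lt; rewrite subr_gt0.
have [w [Uw /=]] := cx _ N.
have := HM _ Uw; have := lerB_dist x w; rewrite distrC; lra.
Qed.

Lemma phi_continuous : continuous phi.
Proof. by move=> x; apply: C1at_continuous; have [] := data_phi D x. Qed.

(** The mean value theorem turns the bound on [grad phi] into a strict Lipschitz condition in gamma.
    It makes a boundary point its own only closest point and keeps segments to closest points inside
    U. *)
Lemma phi_lt y z : y != z -> phi y - phi z < gamma (y - z).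
Proof.
move=> yz; have v0 : y - z != 0 by rewrite subr_eq0.
have g0 := gauge_gt0 CB v0.
pose f (t : R) := phi (z + t *: (y - z)).
have df (t : R) : is_derive t (1 : R) f (dotv (grad phi (z + t *: (y - z))) (y - z)).
  have [/C1at_is_grad/is_grad_differentiable[pd _] _] := data_phi D (z + t *: (y - z)).
  rewrite -diff_dotv// -deriveE//; apply: is_derive_line.
  exact: diff_derivable.
have fc : {within `[0, 1], continuous f}.
  by apply: derivable_within_continuous => t _; have [] := df t.
have [c _] := MVT ltr01 (fun t _ => df t) fc.
rewrite /f scale1r scale0r addr0 subr0 mulr1 [z + _]addrC subrK => ->.
rewrite (le_lt_trans (dotv_le_support_gauge CB _ _))//.
by rewrite gtr_pMl//; exact: data_phi_grad D _.
Qed.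

Lemma cost_continuous x : continuous (fun z => gamma (x - z) + phi z).
Proof.
move=> z; apply: (@continuous_atD _ _ _ (fun z => gamma (x - z)) phi).
  apply: (@continuous_at_comp _ _ _ _ (fun z => x - z) gamma).
    by apply: (@continuous_atB _ _ _ (fun=> x) id) => //; exact: continuous_at_cst.
  exact: (gauge_continuous CB).
exact: phi_continuous.
Qed.

Section nonempty_boundary.
Hypothesis bdry0 : boundary U !=set0.

Lemma closest_min x : exists2 z, boundary U z &
  rho x = gamma (x - z) + phi z /\
  forall w, boundary U w -> rho x <= gamma (x - w) + phi w.
Proof.
have [z] := EVT_min_rV bdry0 boundary_compact
  (continuous_subspaceT (cost_continuous (x := x))).
rewrite inE => bz zmin.
have rz : rho x = gamma (x - z) + phi z.
  apply/eqP; rewrite eq_le; apply/andP; split.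
    apply: ge_inf; last by exists z.
    by exists (gamma (x - z) + phi z) => _ [w bw <-]; apply: zmin; rewrite inE.
  apply: lb_le_inf; first by exists (gamma (x - z) + phi z); exists z.
  by move=> _ [w bw <-]; apply: zmin; rewrite inE.
by exists z => //; split=> // w bw; rewrite rz zmin ?inE.
Qed.

Lemma closest_exists x : exists z, closest x z.
Proof. by have [z bz [rz _]] := closest_min x; exists z. Qed.

Lemma rho_le x w : boundary U w -> rho x <= gamma (x - w) + phi w.
Proof. by have [z _ [_]] := closest_min x; apply. Qed.

Lemma closestP x z : closest x z <-> boundary U z /\
  forall w, boundary U w -> gamma (x - z) + phi z <= gamma (x - w) + phi w.
Proof.
split=> [[bz rz]|[bz H]].
  by split=> // w bw; rewrite -rz rho_le.
split=> //; apply/eqP; rewrite eq_le rho_le//=.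
by have [w [bw ->]] := closest_exists x; exact: H.
Qed.

(** Moving x changes all costs uniformly, because gamma is Lipschitz, so a unique minimizer is
    stable. *)
Lemma closest_stable x y e : closest x y -> (forall z, closest x z -> z = y) ->
  0 < e -> \forall x' \near x, forall y', closest x' y' -> `|y' - y| < e.
Proof.
move=> xy yu e0; have [by_ ymin] := (closestP x y).1 xy.
have min z : boundary U z -> z <> y ->
    gamma (x - y) + phi y < gamma (x - z) + phi z.
  move=> bz zy; rewrite lt_neqAle ymin// andbT; apply/eqP => E.
  by apply/zy/yu/closestP; split=> // w bw; rewrite -E ymin.
have [r r0 Hr] := argmin_stable boundary_compact (cost_continuous (x := x)) min by_ e0.
have [C C0 HC] := gauge_lipschitz CB.
apply: filterS (near_norm_le x (divr_gt0 r0 C0)) => x' xx' y' /closestP[by' y'min].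
apply: (Hr (fun z => gamma (x' - z) + phi z)) => // z _.
rewrite opprD addrACA subrr addr0 (le_trans (HC _ _))//.
rewrite opprB addrA subrK mulrC -ler_pdivlMr// .
Qed.

Lemma boundary_rho y : boundary U y ->
  closest y y /\ forall z, closest y z -> z = y.
Proof.
move=> by_.
have H z : z <> y -> gamma (y - y) + phi y < gamma (y - z) + phi z.
  move=> zy; rewrite subrr (gauge0 CB) add0r -ltrBlDr phi_lt//.
  by apply/eqP => /esym.
split.
  apply/closestP; split=> // w bw; have [->//|/eqP wy] := eqVneq w y.
  exact/ltW/H.
move=> z /closestP[bz zmin]; apply: contrapT => /H.
by rewrite ltNge zmin.
Qed.

Lemma closest_gauge x y : closest x y -> gamma (x - y) = rho x - phi y.
Proof. by move=> [_ ->]; rewrite addrK. Qed.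

(** A cheaper boundary point for the intermediate point would, by the triangle inequality, be
    cheaper for x as well. *)
Lemma closest_segment x y s : closest x y -> 0 <= s <= 1 ->
  closest (y + s *: (x - y)) y.
Proof.
move=> /closestP[by_ ymin] /andP[s0 s1]; apply/closestP; split=> // z bz.
have s1' : 0 <= 1 - s by rewrite subr_ge0.
have := ymin z bz.
have -> : gamma (y + s *: (x - y) - y) = s * gamma (x - y).
  by rewrite addrC addKr (gaugeZ CB).
have := gaugeD CB ((1 - s) *: (x - y)) (y + s *: (x - y) - z).
rewrite (gaugeZ CB _ s1') (_ : _ + _ = x - z); first by lra.
by apply/rowP => j; rewrite !mxE; ring.
Qed.

(** Otherwise the segment would meet the boundary at a point other than y, and by [phi_lt] that
    point would cost x strictly less than y does. *)
Lemma segment_interior x y s : U x -> closest x y -> 0 < s <= 1 ->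
  U (y + s *: (x - y)).
Proof.
move=> Ux /closestP[by_ ymin] /andP[s0 s1]; apply: contrapT => nU.
have xy := boundary_neq Ux by_.
pose w (t : R) := y + t *: (x - y).
have wc : continuous w.
  exact: affine_continuous.
pose S := [set t : R | s <= t <= 1 /\ ~ U (w t)].
have Ss : S s by split=> //; rewrite lexx s1.
have hsS : has_sup S by split; [exists s|exists 1 => t [/andP[]]].
(* The last time at which the segment is outside U. It is attained since U is open, and all later
   times are in U, so this point lies on the boundary. *)
pose t := sup S.
have st : s <= t by apply: ub_le_sup => //; case: hsS.
have t1 : t <= 1 by apply: ge_sup; [exists s|move=> a [/andP[]]].
have nUt : ~ U (w t).
  move=> Ut; have /near_normP[r r0 Hr] : \forall a \near t, U (w a).
    apply: (near_continuous (wc t)).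
    by apply: open_nbhs_nbhs; split=> //; exact: data_open D.
  have [a Sa ta] := sup_adherent r0 hsS.
  have [_] := Sa; apply; apply: Hr.
  have at_ : a <= t by apply: ub_le_sup => //; case: hsS.
  by rewrite ler0_norm ?subr_le0// opprB ltrBlDr addrC -ltrBlDr.
have t1' : t < 1.
  rewrite lt_neqAle t1 andbT; apply/eqP => t1'; apply: nUt.
  by rewrite /w t1' scale1r addrC subrK.
have bt : boundary U (w t).
  split; last by rewrite interior_U.
  move=> B Bt; have /near_normP[r r0 Hr] : \forall a \near t, B (w a).
    exact: (near_continuous (wc t)).
  pose a := Num.min (t + r / 2) 1.
  have ta : t < a by rewrite lt_min t1' andbT ltrDl divr_gt0.
  have a1 : a <= 1 by rewrite ge_min lexx orbT.
  have ar : a <= t + r / 2 by rewrite ge_min lexx.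
  exists (w a); split.
    apply: contrapT => nUa; have : a <= t.
      apply: ub_le_sup; first by case: hsS.
      by split=> //; rewrite a1 (le_trans st (ltW ta)).
    by rewrite leNgt ta.
  apply: Hr; rewrite gtr0_norm ?subr_gt0//; lra.
have t0 : 0 < t := lt_le_trans s0 st.
have t1'' : 0 <= 1 - t by rewrite subr_ge0.
have wy : w t != y.
  by rewrite /w -subr_eq0 addrC addKr scaler_eq0 gt_eqF// subr_eq0.
have := ymin _ bt; have := phi_lt wy.
rewrite (_ : w t - y = t *: (x - y)); last by rewrite /w addrC addKr.
rewrite (_ : x - w t = (1 - t) *: (x - y)); last first.
  by apply/rowP => j; rewrite !mxE; ring.
by rewrite (gaugeZ CB _ (ltW t0)) (gaugeZ CB _ t1''); lra.
Qed.

End nonempty_boundary.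

End obstacle.

Section translations.
Context {R : realType} {n : nat}.
Implicit Types (f : 'rV[R]_n -> R) (x y g v : 'rV[R]_n).

Lemma is_grad_subr f x y g : is_grad f (x - y) g -> is_grad (fun z => f (z - y)) x g.
Proof.
move=> fg e e0; have /near_normP[r r0 Hr] := fg e e0.
apply/near_normP; exists r => // z zx; have := Hr (z - y).
rewrite (_ : z - y - (x - y) = z - x); first exact.
by apply/rowP => j; rewrite !mxE; ring.
Qed.

Lemma is_grad_subl f x y g : is_grad f (x - y) g -> is_grad (fun z => f (x - z)) y (- g).
Proof.
move=> fg e e0; have /near_normP[r r0 Hr] := fg e e0.
apply/near_normP; exists r => // z zy; have := Hr (x - z).
rewrite (_ : x - z - (x - y) = - (z - y)); last first.
  by apply/rowP => j; rewrite !mxE; ring.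
by rewrite normrN dotvNr dotvNl; exact.
Qed.

Lemma is_derive0_min (f : R -> R) a : is_derive (0 : R) (1 : R) f a ->
  (\forall t \near (0 : R), f 0 <= f t) -> a = 0.
Proof.
move=> /is_derive0P H fmin; apply/eqP; rewrite eq_le; apply/andP; split.
  apply/ler_addgt0Pr => e e0; rewrite add0r.
  have /near_normP[r r0 Hr] := near_and (H e e0) fmin.
  have r2 : 0 < r / 2 by rewrite divr_gt0.
  have := Hr (- (r / 2)); rewrite subr0 normrN gtr0_norm//.
  have -> : (r / 2 < r) = true by rewrite ltr_pdivrMr// ltr_pMr// ltr1n.
  move=> /(_ isT) [+ m0]; rewrite /GRing.scale/= ler_norml => /andP[_ A].
  rewrite -(ler_pM2l r2); lra.
apply/ler_addgt0Pr => e e0.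
have /near_normP[r r0 Hr] := near_and (H e e0) fmin.
have r2 : 0 < r / 2 by rewrite divr_gt0.
have := Hr (r / 2); rewrite subr0 gtr0_norm//.
have -> : (r / 2 < r) = true by rewrite ltr_pdivrMr// ltr_pMr// ltr1n.
move=> /(_ isT) [+ m0]; rewrite /GRing.scale/= ler_norml => /andP[_ A].
rewrite -(ler_pM2l r2); lra.
Qed.

End translations.

(** * The gradient of rho and the multiplier at a closest point *)

Section rho_gradient.
Context {R : realType} {n : nat}.
Context (K U : set 'rV[R]_n) (phi : 'rV[R]_n -> R) (D : obstacle_data K U phi).
Hypothesis bdry0 : boundary U !=set0.
Let KB := data_body D.
Let CB := regular_convex_body KB.
Implicit Types (x y z w V v xi : 'rV[R]_n) (d : 'rV[R]_n -> R).
Local Notation gamma := (gauge_fun K).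
Local Notation h := (gauge_fun (polar K)).
Local Notation rho := (rho K U phi).
Local Notation closest := (rho_closest K U phi).

(** The point y is a competitor for x' and gives the upper bound; a closest point y' of x' is a
    competitor for x and gives the lower one. The latter compares gamma at two points that both move
    with y', hence strict differentiability. *)
Lemma rho_is_grad x y : U x -> closest x y -> (forall z, closest x z -> z = y) ->
  is_grad rho x (grad gamma (x - y)).
Proof.
move=> Ux xy yu e e0; have [by_ _] := xy.
have v0 : x - y != 0 by rewrite subr_eq0 (boundary_neq D).
have [r r0 Hr] := C1at_strict (gauge_C1 KB v0) e0.
have r2 : 0 < r / 2 by rewrite divr_gt0.
apply: filterS2 (near_norm_lt x r2) (closest_stable D bdry0 xy yu r2) => x' xx' Hy'.
have [y' xy'] := closest_exists D bdry0 x'; have yy' := Hy' _ xy'.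
have [by' _] := xy'.
have A := Hr (x' - y) (x - y).
have B := Hr (x' - y') (x - y').
have E z : x' - z - (x - z) = x' - x by apply/rowP => j; rewrite !mxE; ring.
rewrite !E subrr normr0 in A B.
have {}A : `|gamma (x' - y) - gamma (x - y) - dotv (grad gamma (x - y)) (x' - x)|
    <= e * `|x' - x| by apply: A => //; lra.
have {}B : `|gamma (x' - y') - gamma (x - y') - dotv (grad gamma (x - y)) (x' - x)|
    <= e * `|x' - x|.
  apply: B.
    rewrite (_ : _ - _ = (x' - x) - (y' - y)); last first.
      by apply/rowP => j; rewrite !mxE; ring.
    by rewrite (le_lt_trans (ler_normB _ _))//; lra.
  rewrite (_ : _ - _ = - (y' - y)); last by apply/rowP => j; rewrite !mxE; ring.
  by rewrite normrN; lra.
have U1 := rho_le D bdry0 x' by_.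
have U2 := rho_le D bdry0 x by'.
have E1 := closest_gauge xy; have E2 := closest_gauge xy'.
move: A B; rewrite !ler_norml => /andP[_ A] /andP[B _].
apply/andP; split; lra.
Qed.

(** The cost of y, as a function of its first point, touches rho from above at x, so the gradients
    agree there. Uniqueness of y is not assumed. *)
Lemma rho_grad_closest x y g : U x -> closest x y -> is_grad rho x g ->
  g = grad gamma (x - y).
Proof.
move=> Ux xy rg; have [by_ _] := xy.
have v0 : x - y != 0 by rewrite subr_eq0 (boundary_neq D).
have G := is_gradB (is_grad_subr (gauge_grad KB v0)) rg.
have P v : 0 <= dotv (grad gamma (x - y) - g) v.
  apply: is_grad_dir_ge G _ => t _; rewrite mulr0 addr0 (closest_gauge xy).
  by have := rho_le D bdry0 (x + t *: v) by_; lra.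
apply/esym/subr0_eq/eqP; rewrite -dotv_eq0 eq_le P andbT.
by rewrite -oppr_ge0 -dotvNr P.
Qed.

(** Lagrange multipliers: the cost is stationary along boundary curves. For the sign, pairing the
    multiple of [grad d y] with x - y gives a positive number since h (grad phi y) < 1, while the
    segment to x enters U. *)
Lemma stationarity x y i s d : U x -> closest x y -> defining U y i s d ->
  exists l, [/\ 0 < l, grad gamma (x - y) = grad phi y + l *: grad d y &
    0 < dotv (grad d y) (x - y)].
Proof.
move=> Ux xy Ud; have [by_ ymin] := (closestP D bdry0 x y).1 xy.
have v0 : x - y != 0 by rewrite subr_eq0 (boundary_neq D).
have g0 := gauge_gt0 CB v0.
have dy := (defining_boundary Ud).1 by_.
set N := grad gamma (x - y); set g := grad d y; set a := N - grad phi y.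
have gg0 : 0 < dotv g g by rewrite dotv_gt0 (def_grad_neq0 Ud).
have av v : dotv g v = 0 -> dotv a v = 0.
  move=> gv; have := bproj_curve Ud dy gv.
  set c : R -> 'rV[R]_n := (fun t => bproj i s d (y + t *: v)) => -[c0 cU cv].
  have G : is_grad (fun z => gamma (x - z) + phi z) (c 0) (- N + grad phi y).
    rewrite c0; apply: (@is_gradD _ _ (fun z => gamma (x - z)) phi).
      exact: is_grad_subl (gauge_grad KB v0).
    exact: C1at_is_grad (data_phi D y).1.
  have /is_derive0_min : is_derive (0 : R) (1 : R)
    (fun t => gamma (x - c t) + phi (c t)) (dotv (- N + grad phi y) v) := curve_chain G cv.
  rewrite (_ : - N + _ = - a); last by rewrite /a opprB addrC.
  rewrite dotvNl => /(_ _)/eqP; rewrite oppr_eq0 => H; apply/eqP/H.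
  by apply: filterS cU => t bt; rewrite c0 ymin.
pose l := dotv a g / dotv g g.
have aE : a = l *: g.
  apply: dotv_inj => w.
  have : dotv a (w - (dotv g w / dotv g g) *: g) = 0.
    by apply: av; rewrite dotvBr dotvZr divfK ?subrr// gt_eqF.
  rewrite dotvBr dotvZr dotvZl => /eqP; rewrite subr_eq0 => /eqP ->.
  by rewrite /l; ring.
have NE : N = grad phi y + l *: g by rewrite -aE addrC subrK.
have ge0 : 0 <= dotv g (x - y).
  apply: (interior_grad_ge0 Ud dy); near=> t.
  rewrite (interior_U D); apply: (segment_interior D bdry0 Ux xy); apply/andP; split=> //.
  by near: t; exact: nbhs_right_le.
have lp : 0 < l * dotv g (x - y).
  rewrite -dotvZl -aE dotvBl (gauge_grad_self KB v0).
  have := dotv_le_support_gauge CB (grad phi y) (x - y).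
  have : h (grad phi y) * gamma (x - y) < gamma (x - y).
    by rewrite gtr_pMl//; exact: (data_phi_grad D).
  by lra.
have gp : 0 < dotv g (x - y).
  by rewrite lt_def ge0 andbT; apply: contraTneq lp => ->; rewrite mulr0 ltxx.
by exists l; split=> //; move: lp; rewrite pmulr_lgt0.
Unshelve. all: by end_near. Qed.

(** Convexity of h along the line. It implies that the value 1 is taken only once on the half-line,
    which makes lambda and [level] well defined. *)
Lemma level_lt a b (l s : R) : h a < 1 -> h (a + l *: b) <= 1 -> 0 <= s < l ->
  h (a + s *: b) < 1.
Proof.
move=> ha hl /andP[s0 sl]; have l0 := le_lt_trans s0 sl.
have t0 : 0 <= s / l by rewrite divr_ge0// ltW.
have t1 : s / l < 1 by rewrite ltr_pdivrMr// mul1r.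
have t1' : 0 <= 1 - s / l by rewrite subr_ge0 ltW.
rewrite (_ : a + _ = (1 - s / l) *: a + (s / l) *: (a + l *: b)); last first.
  by apply/rowP => j; rewrite !mxE; field; rewrite gt_eqF.
rewrite (le_lt_trans (supportD CB _ _))//.
rewrite (supportZ CB _ t1') (supportZ CB _ t0).
have : (1 - s / l) * h a < (1 - s / l) * 1 by rewrite ltr_pM2l// subr_gt0.
have : s / l * h (a + l *: b) <= s / l * 1 by rewrite ler_wpM2l.
by lra.
Qed.

Lemma level_unique a b (l1 l2 : R) : h a < 1 -> 0 < l1 -> 0 < l2 ->
  h (a + l1 *: b) = 1 -> h (a + l2 *: b) = 1 -> l1 = l2.
Proof.
move=> ha l10 l20 h1 h2.
have eq_le1 (c : R) : c = 1 -> c <= 1 by move=> ->.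
apply/eqP; rewrite eq_le; apply/andP; split.
  rewrite leNgt; apply/negP => l12.
  by have := level_lt ha (eq_le1 _ h1) (s := l2); rewrite h2 ltxx l12 (ltW l20) => /(_ isT).
rewrite leNgt; apply/negP => l12.
by have := level_lt ha (eq_le1 _ h2) (s := l1); rewrite h1 ltxx l12 (ltW l10) => /(_ isT).
Qed.

(** The multiplier of [stationarity], times the length of [grad d y], solves the equation that
    defines lambda; by [level_unique] it is the value chosen there. *)
Lemma mu_closest x y : U x -> closest x y -> mu K U phi y = grad gamma (x - y).
Proof.
move=> Ux xy; have [by_ _] := xy.
have v0 : x - y != 0 by rewrite subr_eq0 (boundary_neq D).
have [i [s [d Ud]]] := data_defining D by_.
have dy := (defining_boundary Ud).1 by_.
have [l [l0 NE _]] := stationarity Ux xy Ud.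
set g := grad d y in NE.
have g0 : 0 < norm2 g by rewrite norm2_gt0 (def_grad_neq0 Ud).
have gE : g = norm2 g *: inward_normal U y.
  by rewrite (inward_normalE Ud dy) -/g scalerA divff ?scale1r// gt_eqF.
have NE' : grad gamma (x - y) = grad phi y + (l * norm2 g) *: inward_normal U y.
  by rewrite NE {1}gE scalerA.
rewrite /mu NE'; congr (_ + _ *: _).
apply: get_unique.
  by split; [rewrite mulr_gt0|rewrite -NE' (support_gauge_grad KB)].
move=> l' [l'0 hl']; apply: (@level_unique (grad phi y) (inward_normal U y)) => //.
- exact: (data_phi_grad D).
- by rewrite mulr_gt0.
- by rewrite -NE' (support_gauge_grad KB).
Qed.

End rho_gradient.

(** * The gradient of the obstacle at the boundary *)

Section level.
Context {R : realType} {n : nat}.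
Context (K U : set 'rV[R]_n) (phi : 'rV[R]_n -> R) (D : obstacle_data K U phi).
Let KB := data_body D.
Let CB := regular_convex_body KB.
Context (y0 : 'rV[R]_n) (i : 'I_n) (s : R) (d : 'rV[R]_n -> R).
Hypothesis Ud : defining U y0 i s d.
Implicit Types (x y z w q v xi : 'rV[R]_n).
Local Notation gamma := (gauge_fun K).
Local Notation h := (gauge_fun (polar K)).
Local Notation sp := (support_pt K).

Lemma level_exists a b : h a < 1 -> b != 0 -> exists l : R, 0 < l /\ h (a + l *: b) = 1.
Proof.
move=> ha b0; have hb := support_gt0 CB b0.
pose f (t : R) := h (a + t *: b).
(* Chosen so that subadditivity gives h (a + S b) >= S h b - h (- a) = 1. *)
pose S := (1 + h (- a)) / h b.
have S0 : 0 <= S by rewrite divr_ge0 ?addr_ge0 ?(support_ge0 CB)// ltW.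
have fS : 1 <= f S.
  have := supportD CB (a + S *: b) (- a); rewrite addrAC subrr add0r.
  by rewrite (supportZ CB _ S0) divfK ?gt_eqF// /f; lra.
have f0 : f 0 < 1 by rewrite /f scale0r addr0.
have fc : continuous f.
  move=> t; apply: (@continuous_at_comp _ _ _ _ (fun t : R => a + t *: b) h).
    exact: affine_continuous.
  exact: (support_continuous CB).
have [|l] := IVT S0 (continuous_subspaceT fc) (v := 1).
  by rewrite ge_min (ltW f0)/= le_max fS orbT.
rewrite in_itv/= => /andP[l0 _] fl; exists l; split=> //.
rewrite lt_def l0 andbT; apply/eqP => l0'; move: f0; rewrite -l0' fl ltxx //.
Qed.

(* [grad d q] is not normalized: at boundary points this is lambda divided by the
   length of [grad d q]. *)
Definition level q : R :=
  xget 0 [set l : R | 0 < l /\ h (grad phi q + l *: grad d q) = 1].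

Lemma levelP q : 0 < level q /\ h (grad phi q + level q *: grad d q) = 1.
Proof.
have [l hl] := level_exists (data_phi_grad D q) (def_grad_neq0 Ud q).
by rewrite /level; case: xgetP => [_ -> //|/(_ l)].
Qed.

(** The vector mu of the boundary, in terms of a defining function and extended by the same formula
    to all points, so that it can be differentiated in every direction. *)
Definition bdry_grad q := grad phi q + level q *: grad d q.

Lemma bdry_grad_neq0 q : bdry_grad q != 0.
Proof.
apply: contraTneq (ltr01 : 0 < (1 : R)) => M0; have [_ <-] := levelP q.
by rewrite -/(bdry_grad q) M0 (support0 CB) ltxx.
Qed.

(** The support point pairs to 1 with [bdry_grad q] but to less than 1 with [grad phi q]. Thus
    characteristics cross the boundary transversally. *)
Lemma bdry_grad_transversal q : 0 < dotv (grad d q) (sp (bdry_grad q)).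
Proof.
have [l0 hl] := levelP q; have [Kz hz] := support_ptP KB (bdry_grad q).
move: hz; rewrite {1 3}/bdry_grad hl dotvDl dotvZl => E.
have := support_ge CB (grad phi q) Kz; have := data_phi_grad D q => A B.
have : 0 < level q * dotv (grad d q) (sp (bdry_grad q)) by lra.
by rewrite pmulr_rgt0.
Qed.

Lemma closest_bdry_grad x y : boundary U !=set0 -> U x -> rho_closest K U phi x y ->
  defining U y i s d -> grad gamma (x - y) = bdry_grad y.
Proof.
move=> bdry0 Ux xy Udy; have [by_ _] := xy.
have v0 : x - y != 0 by rewrite subr_eq0 (boundary_neq D).
have [l [l0 NE _]] := stationarity D bdry0 Ux xy Udy.
rewrite NE; congr (_ + _ *: _); have [l'0 hl'] := levelP y.
apply: (level_unique D (data_phi_grad D y) l0 l'0 _ hl').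
by rewrite -NE (support_gauge_grad KB).
Qed.

Lemma grad_continuous (f : 'rV[R]_n -> R) q : C2 f -> {for q, continuous (grad f)}.
Proof. by move=> /(_ q)[[]]. Qed.

(** The value of h is strictly above 1 at l + e and strictly below 1 at l - e; both persist for
    nearby p and trap [level p]. The lower bound is automatic when l - e is not positive. *)
Lemma level_continuous q : {for q, continuous level}.
Proof.
apply/continuous_normP => e e0; have [l0 hl] := levelP q; set l := level q in l0 hl *.
have dC : C2 d by case: Ud.
have cont t : {for q, continuous (fun p => h (grad phi p + t *: grad d p))}.
  apply: (@continuous_at_comp _ _ _ _ (fun p => grad phi p + t *: grad d p) h).
    apply: (@continuous_atD _ _ _ (grad phi) (fun p => t *: grad d p)).
      exact: grad_continuous (data_phi D).
    apply: (@continuous_atZ _ _ _ (fun=> t) (grad d)); first exact: continuous_at_cst.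
    exact: grad_continuous.
  exact: (support_continuous CB).
have up : \forall p \near q, 1 < h (grad phi p + (l + e) *: grad d p).
  have c1 : {for q, continuous (fun p => h (grad phi p + (l + e) *: grad d p) - 1)}.
    exact: continuous_atB (cont (l + e)) (@continuous_at_cst _ _ _ (1 : R) q).
  have : 0 < h (grad phi q + (l + e) *: grad d q) - 1.
    rewrite subr_gt0 ltNge; apply/negP => H.
    have := level_lt D (data_phi_grad D q) H (s := l).
    by rewrite hl ltxx (ltW l0) ltrDl e0 => /(_ isT).
  by move=> /(near_gt0 c1); apply: filterS => p; rewrite subr_gt0.
have lo : \forall p \near q, 0 < l - e -> h (grad phi p + (l - e) *: grad d p) < 1.
  have [le0|le0] := ltP 0 (l - e); last by near=> p.
  have c1 : {for q, continuous (fun p => 1 - h (grad phi p + (l - e) *: grad d p))}.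
    exact: continuous_atB (@continuous_at_cst _ _ _ (1 : R) q) (cont (l - e)).
  have : 0 < 1 - h (grad phi q + (l - e) *: grad d q).
    rewrite subr_gt0; apply: (level_lt D (data_phi_grad D q) (l := l)).
      by rewrite hl.
    by rewrite (ltW le0) ltrBlDr ltrDl.
  by move=> /(near_gt0 c1); apply: filterS => p; rewrite subr_gt0.
apply: filterS2 up lo => p up lo; have [p0 hp] := levelP p.
rewrite ler_norml; apply/andP; split.
  rewrite lerBrDr addrC leNgt; apply/negP => H.
  have le0 : 0 < l - e := lt_trans p0 H.
  have := level_lt D (data_phi_grad D p) (ltW (lo le0)) (s := level p).
  by rewrite hp ltxx (ltW p0) H => /(_ isT).
rewrite lerBlDr addrC leNgt; apply/negP => H.
have hp1 : h (grad phi p + level p *: grad d p) <= 1 by rewrite hp.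
have := level_lt D (data_phi_grad D p) hp1 (s := l + e).
by rewrite H addr_ge0 ?(ltW l0) ?(ltW e0)// ltNge (ltW up) => /(_ isT).
Unshelve. all: by end_near. Qed.

Lemma support_C1 xi : xi != 0 -> C1at h xi.
Proof.
move=> xi0; apply: (@C1at_intro _ _ _ _ sp); last exact: support_pt_continuous.
by apply: filterS (near_neq xi0) => eta; exact: support_is_grad.
Qed.

(* The level is the last component of a local inverse of
   (p, t) |-> (p, h (grad phi p + t grad d p)). *)
Lemma level_C1 q : C1at level q.
Proof.
have dC : C2 d by case: Ud.
pose A (w : 'rV[R]_(n + 1)) : 'rV[R]_n := grad phi (lsubmx w) + w 0 (rshift n 0) *: grad d (lsubmx w).
pose F (w : 'rV[R]_(n + 1)) : 'rV[R]_(n + 1) := row_mx (lsubmx w) (h (A w))%:M.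
pose P (p : 'rV[R]_n) : 'rV[R]_(n + 1) := row_mx p (level p)%:M.
pose Q (p : 'rV[R]_n) : 'rV[R]_(n + 1) := row_mx p 1%:M.
have AP p : A (P p) = bdry_grad p.
  by rewrite /A /P row_mxKl row_mxEr mxE eqxx mulr1n.
have FP p : F (P p) = Q p.
  by rewrite /F /P row_mxKl; congr (row_mx _ _%:M); rewrite AP; have [] := levelP p.
have subC (f : 'rV[R]_n -> R) (w : 'rV[R]_(n + 1)) :
    C1at f (lsubmx w) -> C1at (fun w : 'rV[R]_(n + 1) => f (lsubmx w)) w.
  move=> fC; apply: (@C1at_comp _ _ _ f (fun w : 'rV[R]_(n + 1) => lsubmx w)) => // j.
  by apply: C1at_near (C1at_coord (lshift 1 j) w); near=> u; rewrite mxE.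
have AC j (w : 'rV[R]_(n + 1)) : C1at (fun w : 'rV[R]_(n + 1) => A w 0 j) w.
  apply: (@C1at_near _ _ (fun w : 'rV[R]_(n + 1) =>
      partial j phi (lsubmx w) + w 0 (rshift n 0) * partial j d (lsubmx w))).
    by near=> u; rewrite !mxE.
  have Cp := subC (partial j phi) w ((data_phi D (lsubmx w)).2 j).
  have Cd := subC (partial j d) w ((dC (lsubmx w)).2 j).
  have CM := C1atM (C1at_coord (rshift n 0) w) Cd.
  exact: (C1atD Cp CM).
have hAC : C1at (fun w : 'rV[R]_(n + 1) => h (A w)) (P q).
  apply: (@C1at_comp _ _ _ h A) => //; rewrite AP.
  exact/support_C1/bdry_grad_neq0.
have Fl j : (fun w : 'rV[R]_(n + 1) => F w 0 (lshift 1 j)) =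
    (fun w : 'rV[R]_(n + 1) => w 0 (lshift 1 j)).
  by apply/funext => w; rewrite row_mxEl mxE.
have Fr (k : 'I_1) : (fun w : 'rV[R]_(n + 1) => F w 0 (rshift n k)) =
    (fun w : 'rV[R]_(n + 1) => h (A w)).
  by apply/funext => w; rewrite row_mxEr (ord1 k) mxE eqxx mulr1n.
have FC j : C1at (fun w : 'rV[R]_(n + 1) => F w 0 j) (P q).
  case: (split_ordP j) => k ->; first by rewrite Fl; exact: C1at_coord.
  by rewrite Fr.
(* A kernel vector has no component along p, because F keeps p; its last component is multiplied by
   the positive number of [bdry_grad_transversal]. *)
have Ju : jac F (P q) \in unitmx.
  apply: unitmx_injective => v vJ.
  have vl : lsubmx v = 0.
    apply/rowP => j; have := mulmx_jac F (P q) v (lshift 1 j).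
    by rewrite vJ Fl (is_grad_grad (is_grad_coord _ _)) dotvC dotv_delta !mxE.
  have := mulmx_jac F (P q) v (rshift n 0); rewrite vJ Fr mxE => Hv.
  have G : is_grad (fun w : 'rV[R]_(n + 1) => h (A w)) (P q + 0 *: v)
      (grad (fun w : 'rV[R]_(n + 1) => h (A w)) (P q)).
    by rewrite scale0r addr0; exact: C1at_is_grad hAC.
  have := curve_chain G (is_derive_affine (P q) v); rewrite -Hv => D1.
  pose u := v 0 (rshift n 0) *: grad d q.
  have Ac t : A (P q + t *: v) = bdry_grad q + t *: u.
    have E : lsubmx (P q + t *: v) = q by rewrite linearD linearZ /= vl scaler0 addr0 row_mxKl.
    rewrite /A E mxE row_mxEr mxE eqxx mulr1n [in LHS]mxE scalerDl addrA.
    by rewrite /bdry_grad /u scalerA.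
  have G2 : is_grad h (bdry_grad q + 0 *: u) (sp (bdry_grad q)).
    by rewrite (scale0r u) (addr0 (bdry_grad q)); exact: support_is_grad (bdry_grad_neq0 q).
  have D2 := curve_chain G2 (is_derive_affine (bdry_grad q) u).
  have D3 : is_derive (0 : R) (1 : R) (fun t => h (A (P q + t *: v))) (dotv (sp (bdry_grad q)) u).
    by apply: is_derive_near D2; near=> t; rewrite Ac.
  have := is_derive_unique D1 D3.
  rewrite /u dotvZr dotvC => /esym/eqP; rewrite mulf_eq0 (gt_eqF (bdry_grad_transversal q)) orbF.
  move=> /eqP vr; rewrite -[v]hsubmxK vl; apply/rowP => j.
  case: (split_ordP j) => k ->; first by rewrite row_mxEl !mxE.
  by rewrite row_mxEr (ord1 k) !mxE.
have coordC j p : C1at (fun p => (row_mx p (1%:M : 'M[R]_1)) 0 j) p.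
  case: (split_ordP j) => k ->.
    by apply: C1at_near (C1at_coord k p); near=> u; rewrite row_mxEl.
  by apply: C1at_near (C1at_cst ((1%:M : 'M[R]_1) 0 k) p); near=> u; rewrite row_mxEr.
have Pc p : {for p, continuous P}.
  apply/continuous_at_mxP => k j; rewrite (ord1 k).
  case: (split_ordP j) => k' ->.
    have E : \forall u \near p, (u : 'rV[R]_n) 0 k' = P u 0 (lshift 1 k').
      by near=> u; rewrite row_mxEl.
    exact: (continuous_at_near E (C1at_continuous (C1at_coord k' p))).
  have E : \forall u \near p, level u = P u 0 (rshift n k').
    by near=> u; rewrite row_mxEr (ord1 k') mxE eqxx mulr1n.
  exact: (continuous_at_near E (@level_continuous p)).
have FPn : \forall p \near q, {for p, continuous P} /\ F (P p) = Q p by near=> p.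
have [+ _] := C1at_inverse FC Ju FPn (fun j => coordC _ j q).
move=> /(_ (rshift n 0)); apply: C1at_near; near=> p.
by rewrite row_mxEr mxE eqxx mulr1n.
Unshelve. all: by end_near. Qed.

Lemma bdry_grad_C1 j q : C1at (fun p => bdry_grad p 0 j) q.
Proof.
have dC : C2 d by case: Ud.
apply: (@C1at_near _ _ (fun p => partial j phi p + level p * partial j d p)).
  by near=> p; rewrite !mxE.
exact: C1atD ((data_phi D q).2 j) (C1atM (level_C1 q) ((dC q).2 j)).
Unshelve. all: by end_near. Qed.

End level.

(** * The obstacle near the boundary *)

Section jac_comp.
Context {R : realType}.

Lemma jac_comp m n p (F : 'rV[R]_n -> 'rV[R]_p) (G : 'rV[R]_m -> 'rV[R]_n) x :
  (forall j, C1at (fun y => F y 0 j) (G x)) -> (forall j, C1at (fun y => G y 0 j) x) ->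
  jac (fun y => F (G y)) x = jac G x *m jac F (G x).
Proof.
move=> FC GC; apply/matrixP => i j; rewrite [LHS]mxE [RHS]mxE.
have := is_grad_comp (C1at_is_grad (FC j)) (fun k => C1at_is_grad (GC k)).
move=> /is_grad_grad ->; rewrite summxE; apply: eq_bigr => k _.
by rewrite !mxE mulrC.
Qed.

Lemma jac_id n (x : 'rV[R]_n) : jac id x = 1%:M.
Proof.
apply/matrixP => i j; rewrite [LHS]mxE /= (is_grad_grad (is_grad_coord j x)).
by rewrite !mxE eqxx.
Qed.

End jac_comp.

Section near_boundary.
Context {R : realType} {n : nat}.
Context (K U : set 'rV[R]_n) (phi : 'rV[R]_n -> R) (D : obstacle_data K U phi).
Let KB := data_body D.
Let CB := regular_convex_body KB.
Context (y : 'rV[R]_n) (i : 'I_n) (s : R) (d : 'rV[R]_n -> R).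
Hypotheses (Ud : defining U y i s d) (by_ : boundary U y).
Let bdry0 : boundary U !=set0 := ex_intro _ y by_.
Implicit Types (x z w q p v xi : 'rV[R]_n).
Local Notation gamma := (gauge_fun K).
Local Notation h := (gauge_fun (polar K)).
Local Notation sp := (support_pt K).
Local Notation rho := (rho K U phi).
Local Notation closest := (rho_closest K U phi).
Local Notation bgrad := (bdry_grad K phi d).
Local Notation pi := (bproj i s d).
Local Notation e_i := (delta_mx 0 i : 'rV[R]_n).

(* [flow (z + t s e_i)] is the point reached at time t from the boundary
   point z along its characteristic. *)
Definition flow p := p + d p *: (sp (bgrad (pi p)) - s *: e_i).

Let G p := bgrad (pi p).

Lemma bgrad_pi_C1 j p : C1at (fun p => G p 0 j) p.
Proof.
apply: (@C1at_comp _ _ _ (fun q => bgrad q 0 j) pi); first exact: (bdry_grad_C1 D Ud).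
by move=> k; exact: (bproj_C1 Ud).
Qed.

Lemma sp_pi_C1 j p : C1at (fun p => sp (G p) 0 j) p.
Proof.
apply: (@C1at_comp _ _ _ (fun q => sp q 0 j) G); last by move=> k; exact: bgrad_pi_C1.
exact: (support_pt_C1 KB j (bdry_grad_neq0 D Ud _)).
Qed.

Let W j p := sp (G p) 0 j - s * e_i 0 j.

Lemma W_C1 j p : C1at (W j) p.
Proof. exact: C1atB (sp_pi_C1 j p) (C1at_cst (s * e_i 0 j) p). Qed.

Lemma flow_coord j p : flow p 0 j = p 0 j + d p * W j p.
Proof. by rewrite /flow /W /G !mxE. Qed.

Lemma flow_C1 j p : C1at (fun p => flow p 0 j) p.
Proof.
have [dC _ _ _ _] := Ud.
apply: (@C1at_near _ _ (fun p => p 0 j + d p * W j p)).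
  by near=> q; rewrite flow_coord.
exact: C1atD (C1at_coord j p) (C1atM (dC p).1 (W_C1 j p)).
Unshelve. all: by end_near. Qed.

(** As d vanishes at y, the derivative is a rank-one perturbation of the identity, v + a (V - s e_i)
    with a the product of [grad d y] and v. On a kernel vector, a times the product of [grad d y]
    and V is 0, and that product is positive. *)
Lemma jac_flow_unit : jac flow y \in unitmx.
Proof.
have [dC ss _ _ _] := Ud.
have dy := (defining_boundary Ud).1 by_.
apply: unitmx_injective => v vJ.
pose V := sp (G y); pose a := dotv (grad d y) v.
have E j : v 0 j + a * (V 0 j - s * e_i 0 j) = 0.
  have := mulmx_jac flow y v j; rewrite vJ mxE.
  have Fg : is_grad (fun p => flow p 0 j) y
      (delta_mx 0 j + (d y *: grad (W j) y + W j y *: grad d y)).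
    apply: (@is_grad_near _ _ (fun p => p 0 j + d p * W j p)).
      by near=> q; rewrite flow_coord.
    apply: is_gradD; first exact: is_grad_coord.
    exact: is_gradM (C1at_is_grad (dC y).1) (C1at_is_grad (W_C1 j y)).
  rewrite (is_grad_grad Fg) dy scale0r add0r dotvDl dotvZl dotvC dotv_delta => ->.
  by rewrite /a /W mulrC.
have vE : v = - a *: (V - s *: e_i).
  by apply/rowP => j; have := E j; rewrite !mxE => /eqP; rewrite addr_eq0 mulNr => /eqP.
have Piy : pi y = y by rewrite bproj_id.
have Vp : 0 < dotv (grad d y) V.
  by rewrite /V /G Piy; exact: (bdry_grad_transversal D Ud).
have : a = - a * (dotv (grad d y) V - 1).
  rewrite {1}/a {1}vE dotvZr dotvBr dotvZr dotv_delta (def_gradi Ud).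
  by rewrite ss.
move=> aE; have : a * dotv (grad d y) V = 0.
  by rewrite mulrBr mulr1 in aE; move: aE; rewrite mulNr opprK; lra.
move=> /eqP; rewrite mulf_eq0 (gt_eqF Vp) orbF => /eqP a0.
by rewrite vE a0 oppr0 scale0r.
Unshelve. all: by end_near. Qed.

(** Stores a boundary point and a travel time in one vector of the ambient space: [bproj] recovers
    the former, d the latter. *)
Definition lift_pt x z := z + (gamma (x - z) * s) *: e_i.

Lemma lift_ptP x z : U x -> closest x z -> defining U z i s d ->
  [/\ d (lift_pt x z) = gamma (x - z), pi (lift_pt x z) = z & flow (lift_pt x z) = x].
Proof.
move=> Ux xz Udz; have [bz _] := xz.
have [_ ss _ dl _] := Ud.
have dz := (defining_boundary Udz).1 bz.
have dp : d (lift_pt x z) = gamma (x - z).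
  by rewrite /lift_pt dl dz add0r -mulrA ss mulr1.
have pp : pi (lift_pt x z) = z.
  rewrite /bproj dp /lift_pt [s * _]mulrC addrK//.
split=> //; rewrite /flow pp dp.
have v0 : x - z != 0 by rewrite subr_eq0 (boundary_neq D).
rewrite -(closest_bdry_grad D Ud bdry0 Ux xz Udz) (support_pt_gauge_grad KB v0).
have g0 := gauge_gt0 CB v0.
by apply/rowP => j; rewrite !mxE; field; rewrite gt_eqF.
Qed.

(** Lifts of closest points are preimages under [flow] lying where it is injective: hence
    uniqueness, and P is a local inverse of [flow]. Then D rho = G (P x) is C^1, and its derivative
    has a limit because P x tends to y as x tends to y inside U. *)
Lemma near_boundary : exists r H0, [/\ 0 < r,
  forall x, U x -> `|x - y| < r ->
    (forall z1 z2, closest x z1 -> closest x z2 -> z1 = z2) /\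
    forall j, C1at (partial j rho) x &
  hessian rho x @[x --> within U (nbhs y)] --> (H0 : 'M[R]_n)].
Proof.
have dy := (defining_boundary Ud).1 by_.
have Fy : flow y = y by rewrite /flow dy scale0r addr0.
have [C C0 [r1 r10 Hinj]] := local_injectivity (fun j => flow_C1 j y) jac_flow_unit.
have Jc : {for y, continuous (jac flow)} by apply: jac_continuous => j; exact: flow_C1.
have /near_normP[r2 r20 Hu] := continuous_at_unitmx Jc jac_flow_unit.
pose r0 := Num.min r1 r2.
have r00 : 0 < r0 by rewrite lt_min r10.
have r01 : r0 <= r1 by rewrite ge_min lexx.
have r02 : r0 <= r2 by rewrite ge_min lexx orbT.
have [Cg Cg0 Hg] := gauge_le_norm CB.
have [yy yu] := boundary_rho D bdry0 by_.
have /near_normP[r3 r30 Hd] := defining_near Ud.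
(* If x and z are e-close to y, the lift of z moves by at most Cg (2e) |s| from z, so it stays
   within r0 of y. *)
pose e := Num.min r3 (r0 / (1 + 2 * (Cg * `|s|) + 1)).
have cs0 : 0 <= Cg * `|s| by rewrite mulr_ge0// ltW.
have cs1 : 0 < 1 + 2 * (Cg * `|s|) + 1 by lra.
have e0 : 0 < e by rewrite lt_min r30 divr_gt0.
have /near_normP[r4 r40 Hs] := closest_stable D bdry0 yy yu e0.
pose r := Num.min r4 e.
have r_gt0 : 0 < r by rewrite lt_min r40.
have Hpt x z : U x -> `|x - y| < r -> closest x z ->
    `|lift_pt x z - y| < r0 /\ defining U z i s d.
  move=> Ux; rewrite lt_min => /andP[xr4 xe] xz.
  have ze := Hs x xr4 z xz; split; last first.
    by apply: Hd; rewrite (lt_le_trans ze)// ge_min lexx.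
  have e_i1 : `|e_i| <= 1.
    by apply: rV_norm_le => // j; rewrite mxE; case: (_ && _); rewrite ?normr1 ?normr0.
  rewrite /lift_pt addrAC (le_lt_trans (ler_normD _ _))// normrZ normrM.
  have g0 := gauge_ge0 CB (x - z).
  have xz2 : `|x - z| <= 2 * e.
    rewrite (_ : x - z = (x - y) - (z - y)); last first.
      by apply/rowP => j; rewrite !mxE; ring.
    by rewrite (le_trans (ler_normB _ _))//; lra.
  have A : `|gamma (x - z)| * `|s| * `|e_i| <= 2 * (Cg * `|s|) * e.
    apply: (@le_trans _ _ (gamma (x - z) * `|s|)).
      by rewrite ger0_norm// ler_piMr// mulr_ge0.
    rewrite (_ : 2 * _ * e = Cg * (2 * e) * `|s|); last by ring.
    by rewrite ler_wpM2r// (le_trans (Hg _))// ler_wpM2l// ltW.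
  have B : e * (1 + 2 * (Cg * `|s|) + 1) <= r0.
    by rewrite -ler_pdivlMr// ge_min lexx orbT.
  nra.
have uniq x : U x -> `|x - y| < r -> forall z1 z2, closest x z1 -> closest x z2 -> z1 = z2.
  move=> Ux xr z1 z2 xz1 xz2.
  have [a1 b1] := Hpt x z1 Ux xr xz1; have [a2 b2] := Hpt x z2 Ux xr xz2.
  have [_ p1 f1] := lift_ptP Ux xz1 b1; have [_ p2 f2] := lift_ptP Ux xz2 b2.
  have := Hinj _ _ (lt_le_trans a1 r01) (lt_le_trans a2 r01).
  rewrite f1 f2 subrr normr0 mulr0 normr_le0 subr_eq0 => /eqP E.
  by rewrite -p1 E p2.
pose cp x := xget 0 [set z | closest x z].
have cpP x : closest x (cp x).
  have [z xz] := closest_exists D bdry0 x.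
  by rewrite /cp; case: xgetP => [_ -> //|/(_ z)].
pose P x := lift_pt x (cp x).
have PP x : U x -> `|x - y| < r -> [/\ `|P x - y| < r0, pi (P x) = cp x,
    flow (P x) = x & defining U (cp x) i s d].
  move=> Ux xr; have [a b] := Hpt x _ Ux xr (cpP x).
  by have [_ p1 f1] := lift_ptP Ux (cpP x) b.
have Plip x1 x2 : U x1 -> U x2 -> `|x1 - y| < r -> `|x2 - y| < r ->
    `|P x1 - P x2| <= C * `|x1 - x2|.
  move=> U1 U2 a1 a2; have [b1 _ f1 _] := PP _ U1 a1; have [b2 _ f2 _] := PP _ U2 a2.
  have := Hinj _ _ (lt_le_trans b1 r01) (lt_le_trans b2 r01).
  by rewrite f1 f2.
(* Here the comparison is with y = flow y, a boundary point, which gives the limit of P at y from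
   inside U. *)
have Ply x1 : U x1 -> `|x1 - y| < r -> `|P x1 - y| <= C * `|x1 - y|.
  move=> U1 a1; have [b1 _ f1 _] := PP _ U1 a1.
  have := Hinj (P x1) y (lt_le_trans b1 r01).
  by rewrite f1 Fy subrr normr0; apply.
have nearU x : U x -> `|x - y| < r -> \forall z \near x, U z /\ `|z - y| < r.
  move=> Ux xr; apply: near_and.
    by apply: open_nbhs_nbhs; split=> //; exact: data_open D.
  have xr' : 0 < r - `|x - y| by rewrite subr_gt0.
  apply: filterS (near_norm_lt x xr') => z zx.
  rewrite (_ : z - y = (z - x) + (x - y)); last by rewrite addrA subrK.
  by rewrite (le_lt_trans (ler_normD _ _))//; lra.
have Pcont x : U x -> `|x - y| < r -> {for x, continuous P}.
  move=> Ux xr; apply/continuous_normP => e' e'0.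
  apply: filterS2 (nearU x Ux xr) (near_norm_le x (divr_gt0 e'0 C0)) => z [Uz zr] zx.
  by rewrite (le_trans (Plip _ _ Uz Ux zr xr))// mulrC -ler_pdivlMr.
have PC x : U x -> `|x - y| < r -> (forall j, C1at (fun z => P z 0 j) x) /\
    jac P x = invmx (jac flow (P x)).
  move=> Ux xr; have [b1 _ f1 _] := PP _ Ux xr.
  have Ju : jac flow (P x) \in unitmx by apply: Hu; exact: lt_le_trans b1 r02.
  have N : \forall z \near x, {for z, continuous P} /\ flow (P z) = z.
    apply: filterS (nearU x Ux xr) => z [Uz zr]; split; first exact: Pcont.
    by have [] := PP _ Uz zr.
  have := C1at_inverse (fun j => flow_C1 j (P x)) Ju N (fun j => C1at_coord j x).
  by rewrite jac_id mul1mx.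
have rhoG x : U x -> `|x - y| < r -> grad rho x = G (P x).
  move=> Ux xr; have [_ p1 _ Udc] := PP _ Ux xr.
  have u z : closest x z -> z = cp x by move=> xz; exact: (uniq x Ux xr z (cp x) xz (cpP x)).
  rewrite /G p1 -(closest_bdry_grad D Ud bdry0 Ux (cpP x) Udc).
  exact: is_grad_grad (rho_is_grad D bdry0 Ux (cpP x) u).
have GP x j : U x -> `|x - y| < r -> \forall z \near x, G (P z) 0 j = partial j rho z.
  move=> Ux xr; apply: filterS (nearU x Ux xr) => z [Uz zr].
  by rewrite -rhoG// mxE.
have rhoC x j : U x -> `|x - y| < r -> C1at (partial j rho) x.
  move=> Ux xr; apply: C1at_near (GP x j Ux xr) _.
  apply: (@C1at_comp _ _ _ (fun p => G p 0 j) P); first exact: bgrad_pi_C1.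
  by have [] := PC x Ux xr.
have hessE x : U x -> `|x - y| < r -> hessian rho x = jac P x *m jac G (P x).
  move=> Ux xr; rewrite -jac_comp; last 2 first.
    by move=> j; exact: bgrad_pi_C1.
    by have [] := PC x Ux xr.
  apply/matrixP => a b; rewrite [LHS]mxE [RHS]mxE.
  have /C1at_is_grad rg := rhoC x b Ux xr.
  have := GP x b Ux xr.
  have E : \forall z \near x, partial b rho z = G (P z) 0 b.
    by apply: filterS (GP x b Ux xr) => z ->.
  by move=> _; rewrite (is_grad_grad (is_grad_near E rg)) mxE.
(* The chain rule for x |-> G (P x) with P x replaced by its limit y. *)
exists r, (invmx (jac flow y) *m jac G y); split => //.
  by move=> x Ux xr; split; [exact: uniq|move=> j; exact: rhoC].
have [cy _] := by_.
have FF : ProperFilter (within U (nbhs y)) by exact: within_nbhs_proper.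
have near_r : \forall x \near within U (nbhs y), U x /\ `|x - y| < r.
  rewrite near_withinE; apply: filterS (near_norm_lt y r_gt0) => x xr Ux.
  by split.
have Py : P x @[x --> within U (nbhs y)] --> y.
  apply/cvgrPdist_le => e' e'0; rewrite near_withinE.
  have e'1 := divr_gt0 e'0 C0.
  apply: filterS2 (near_norm_lt y r_gt0) (near_norm_le y e'1) => x xr xe Ux.
  by rewrite distrC (le_trans (Ply x Ux xr))// mulrC -ler_pdivlMr.
have GJc : {for y, continuous (jac G)} by apply: jac_continuous => j; exact: bgrad_pi_C1.
have L : invmx (jac flow (P x)) *m jac G (P x) @[x --> within U (nbhs y)] -->
    invmx (jac flow y) *m jac G y.
  apply: cvg_mulmx.
    by apply: cvg_invmx jac_flow_unit _; exact: continuous_cvg Jc Py.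
  exact: continuous_cvg GJc Py.
apply: cvg_trans L; apply: near_eq_cvg; apply: filterS near_r => x [Ux xr].
by rewrite hessE//; have [_ ->] := PC x Ux xr.
Qed.

End near_boundary.

(** * The ridge *)

Section auxiliary.
Context {R : realType}.

(** If X is the inverse of 1 + AB, then 1 - B X A is the inverse of 1 + BA. *)
Lemma unitmx_1DmulC n (A B : 'M[R]_n) : 1%:M + A *m B \in unitmx ->
  1%:M + B *m A \in unitmx.
Proof.
move=> u; set X := invmx (1%:M + A *m B).
have XE : X *m (1%:M + A *m B) = 1%:M by exact: mulVmx.
suff /mulmx1_unit[] : (1%:M - B *m X *m A) *m (1%:M + B *m A) = 1%:M by [].
rewrite mulmxBl mul1mx mulmxDr mulmx1.
have -> : B *m X *m A *m (B *m A) = B *m (X *m (A *m B)) *m A by rewrite !mulmxA.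
have -> : X *m (A *m B) = 1%:M - X.
  by rewrite -[in RHS]XE mulmxDr mulmx1 addrAC subrr add0r.
by rewrite mulmxBr mulmx1 mulmxBl [B *m X *m A + _]addrC subrK addrK.
Qed.

Lemma C1at_lipschitz n m (f : 'I_m -> 'rV[R]_n -> R) x : (forall j, C1at (f j) x) ->
  exists L r, [/\ 0 <= L, 0 < r & forall p q, `|p - x| < r -> `|q - x| < r ->
    forall j, `|f j p - f j q| <= L * `|p - q|].
Proof.
move=> fC; pose L := \sum_j (n%:R * `|grad (f j) x| + 1).
have L0 j : 0 <= n%:R * `|grad (f j) x| + 1 by rewrite addr_ge0// mulr_ge0.
have H : \forall r \near (0 : R)^'+, forall j, forall p q, `|p - x| < r -> `|q - x| < r ->
    `|f j p - f j q| <= L * `|p - q|.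
  apply: (@filter_forall _ 'I_m) => j; have [r r0 Hr] := C1at_strict (fC j) ltr01.
  near=> s => p q ps qs.
  have sr : s <= r by near: s; exact: nbhs_right_le.
  have := Hr p q (lt_le_trans ps sr) (lt_le_trans qs sr); rewrite mul1r => A.
  rewrite -(subrK (dotv (grad (f j) x) (p - q)) (f j p - f j q)).
  rewrite (le_trans (ler_normD _ _))//.
  apply: (@le_trans _ _ ((n%:R * `|grad (f j) x| + 1) * `|p - q|)).
    by rewrite addrC mulrDl mul1r lerD// dotv_norm_le.
  by rewrite ler_wpM2r// /L (bigD1 j)//= lerDl sumr_ge0.
have [r [r0 Hr]] : exists r, 0 < r /\ forall j, forall p q, `|p - x| < r -> `|q - x| < r ->
    `|f j p - f j q| <= L * `|p - q|.
  near (0 : R)^'+ => r; exists r; split => //.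
  by near: r; exact: H.
exists L, r; split=> //; first by rewrite sumr_ge0.
by move=> p q pr qr j; exact: Hr.
Unshelve. all: by end_near. Qed.

Lemma near_prodP {V : normedModType R} (x : V) (P : V -> V -> Prop) :
  (\forall p & q \near x, P p q) <->
  exists2 r, 0 < r & forall p q, `|p - x| < r -> `|q - x| < r -> P p q.
Proof.
split=> [[[A B] /= [/near_normP[r1 r10 H1] /near_normP[r2 r20 H2]] H]|[r r0 H]].
  exists (Num.min r1 r2); first by rewrite lt_min r10.
  move=> p q; rewrite !lt_min => /andP[p1 _] /andP[_ q2].
  by apply: (H (p, q)); split=> /=; [exact: H1|exact: H2].
exists ([set p | `|p - x| < r], [set p | `|p - x| < r]) => /=.
  by split; exact: near_norm_lt.
by move=> [p q] /= [pr qr]; exact: H.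
Qed.

End auxiliary.

Section ridge.
Context {R : realType} {n : nat}.
Context (K U : set 'rV[R]_n) (phi : 'rV[R]_n -> R) (D : obstacle_data K U phi).
Let KB := data_body D.
Let CB := regular_convex_body KB.
Context (x y : 'rV[R]_n).
Local Notation gamma := (gauge_fun K).
Local Notation h := (gauge_fun (polar K)).
Local Notation sp := (support_pt K).
Local Notation rho := (rho K U phi).
Local Notation closest := (rho_closest K U phi).
Hypotheses (Ux : U x) (xy : closest x y) (yu : forall z, closest x z -> z = y).
Context (r : R) (H0 : 'M[R]_n).
Hypotheses (r0 : 0 < r)
  (near_y : forall x, U x -> `|x - y| < r ->
    (forall z1 z2, closest x z1 -> closest x z2 -> z1 = z2) /\
    forall j, C1at (partial j rho) x)
  (hess_lim : hessian rho x @[x --> within U (nbhs y)] --> H0).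
Let by_ : boundary U y := xy.1.
Let bdry0 : boundary U !=set0 := ex_intro _ y by_.

Let t0 := gamma (x - y).
Let xi0 := grad gamma (x - y).
Let V0 : 'rV[R]_n := t0^-1 *: (x - y).
Let J0 : 'M[R]_n := 1%:M + t0 *: (H0 *m hessian h xi0).

Lemma xy_neq0 : x - y != 0.
Proof. by rewrite subr_eq0 (boundary_neq D). Qed.

Lemma t0_gt0 : 0 < t0.
Proof. by rewrite /t0 (gauge_gt0 CB xy_neq0). Qed.

Lemma xi0_neq0 : xi0 != 0.
Proof.
apply: contraTneq (ltr01 : 0 < (1 : R)) => N0.
by rewrite -(support_gauge_grad KB xy_neq0) -/xi0 N0 (support0 CB) ltxx.
Qed.

Lemma sp_xi0 : sp xi0 = V0.
Proof. exact: (support_pt_gauge_grad KB xy_neq0). Qed.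

(* Then [ye e] lies in the region near the boundary where rho is C^2. *)
Definition small_time e := 0 < e < t0 /\ `|e *: V0| < r.
Let ye (e : R) : 'rV[R]_n := y + e *: V0.
Let Phi (e : R) (z : 'rV[R]_n) : 'rV[R]_n := z + (t0 - e) *: sp (grad rho z).

Lemma ye_continuous : continuous ye.
Proof. exact: affine_continuous. Qed.

Lemma near_small : \forall e \near (0 : R)^'+, small_time e.
Proof.
have c : {for 0, continuous (fun e : R => e *: V0)}.
  by apply: (@continuous_atZ _ _ _ id (fun=> V0)); [exact: cvg_id|exact: continuous_at_cst].
have N : \forall e \near (0 : R), `|e *: V0| < r.
  have := near_continuous c (near_norm_lt (0 *: V0) r0).
  by apply: filterS => e; rewrite scale0r subr0.
near=> e; split.
  by apply/andP; split=> //; near: e; apply: nbhs_right_lt; exact: t0_gt0.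
by near: e; exact: cvg_within N.
Unshelve. all: by end_near. Qed.

Lemma ye_props e : small_time e -> [/\ U (ye e), `|ye e - y| < r, closest (ye e) y &
  grad rho (ye e) = xi0].
Proof.
move=> [/andP[e0 et] er]; have t00 := t0_gt0.
have E : ye e = y + (e / t0) *: (x - y) by rewrite /ye /V0 scalerA.
have q0 : 0 < e / t0 by rewrite divr_gt0.
have q1 : e / t0 <= 1 by rewrite ler_pdivrMr// mul1r ltW.
have Uy : U (ye e).
  by rewrite E; apply: (segment_interior D bdry0) => //; rewrite q0.
have yr : `|ye e - y| < r by rewrite /ye addrC addKr.
have cy : closest (ye e) y.
  by rewrite E; apply: (closest_segment D bdry0) => //; rewrite (ltW q0).
split=> //; have [u _] := near_y Uy yr.
have uu z : closest (ye e) z -> z = y by move=> cz; exact: u.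
rewrite (is_grad_grad (rho_is_grad D bdry0 Uy cy uu)) E addrC addKr.
by rewrite (gauge_gradZ KB)// xy_neq0.
Qed.

Let Je (e : R) : 'M[R]_n := 1%:M + (t0 - e) *: (hessian rho (ye e) *m hessian h xi0).

Lemma Je_lim : Je e @[e --> (0 : R)^'+] --> J0.
Proof.
(* The points [ye e] lie in U, so the one-sided limit of the Hessian applies along them. *)
have yl : ye e @[e --> (0 : R)^'+] --> within U (nbhs y).
  move=> A; rewrite /within /= => HA.
  have N : \forall e \near (0 : R), U (ye e) -> A (ye e).
    apply: (near_continuous (@ye_continuous 0) (P := fun z => U z -> A z)).
    by rewrite /ye scale0r addr0.
  have N' : \forall e \near (0 : R)^'+, U (ye e) -> A (ye e) by exact: cvg_within N.
  have N2 : \forall e \near (0 : R)^'+, A (ye e).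
    by apply: filterS2 near_small N' => e /ye_props[Ue _ _ _]; apply.
  exact: N2.
have hl : hessian rho (ye e) @[e --> (0 : R)^'+] --> H0 by exact: cvg_comp yl hess_lim.
apply: cvgD; first exact: cvg_cst.
rewrite -[t0 in X in _ --> X]subr0; apply: cvgZ.
  apply: cvgB; first exact: cvg_cst.
  by apply: cvg_within; exact: cvg_id.
by apply: cvg_mulmx hl _; exact: cvg_cst.
Unshelve. all: by end_near. Qed.

Lemma Phi_C1 e : small_time e -> (forall j, C1at (fun z => Phi e z 0 j) (ye e)) /\
  jac (Phi e) (ye e) = Je e.
Proof.
move=> se; have [Ue ye_r cy gy] := ye_props se; have [_ rC] := near_y Ue ye_r.
have gC j : C1at (fun z => grad rho z 0 j) (ye e).
  by apply: C1at_near (rC j); near=> z; rewrite mxE.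
have spC j : C1at (fun xi => sp xi 0 j) (grad rho (ye e)).
  by rewrite gy; exact: (support_pt_C1 KB j xi0_neq0).
pose S z := sp (grad rho z).
have SC j : C1at (fun z => S z 0 j) (ye e).
  exact: (@C1at_comp _ _ _ (fun xi => sp xi 0 j) (grad rho)).
have jS : jac S (ye e) = hessian rho (ye e) *m hessian h xi0.
  rewrite [LHS](jac_comp spC gC) gy; congr (_ *m _).
    apply/matrixP => a b; rewrite mxE [RHS]mxE [LHS]mxE /partial.
    by congr ('D_ _ _ _); apply/funext => z; rewrite mxE.
  apply/matrixP => a b; rewrite [LHS]mxE [RHS]mxE.
  have G := C1at_is_grad (support_pt_C1 KB b xi0_neq0).
  have N : \forall eta \near xi0, sp eta 0 b = partial b h eta.
    by apply: filterS (support_partial KB b xi0_neq0) => eta ->.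
  by rewrite -(is_grad_grad (is_grad_near N G)) mxE.
have PE j z : Phi e z 0 j = z 0 j + (t0 - e) * S z 0 j by rewrite !mxE.
split=> [j|].
  apply: (@C1at_near _ _ (fun z => z 0 j + (t0 - e) * S z 0 j)).
    by near=> z; rewrite PE.
  exact: C1atD (C1at_coord j _) (C1atM (C1at_cst _ _) (SC j)).
apply: is_grad_jac => j.
apply: (@is_grad_near _ _ (fun z => z 0 j + (t0 - e) * S z 0 j)).
  by near=> z; rewrite PE.
have := is_gradD (is_grad_coord j (ye e)) (is_gradZ (t0 - e) (C1at_is_grad (SC j))).
congr (is_grad _ _ _); apply/rowP => k; rewrite /Je -jS [RHS]mxE.
rewrite !mxE /=; congr (_ + _).
Unshelve. all: by end_near. Qed.

(** The point z' lies on the segment from z to x', at time gamma (x' - z) - (t0 - e), which is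
    positive since gamma (x' - z) is close to t0. So z remains closest to z' and the gradient is
    unchanged. The claim covers every closest point z of x', as their uniqueness is still open. *)
Lemma pull_back e eta : small_time e -> 0 < eta -> \forall x' \near x, U x' /\
  forall z, closest x' z ->
    let z' := x' - (t0 - e) *: sp (grad gamma (x' - z)) in
    [/\ `|z' - ye e| < eta, U z', `|z' - y| < r, closest z' z &
        grad rho z' = grad gamma (x' - z) /\ Phi e z' = x'].
Proof.
move=> se eta0; have [/andP[e0 et] er] := se; have [_ yr _ _] := ye_props se.
pose W (v : 'rV[R]_n) : 'rV[R]_n := (gamma v)^-1 *: v.
have Wc : {for x - y, continuous W} by exact: (normalized_continuous KB xy_neq0).
have te : 0 < t0 - e by rewrite subr_gt0.
(* The second entry keeps z' in the region near y where rho is C^2. *)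
pose eta' := Num.min eta (r - `|ye e - y|).
have eta'0 : 0 < eta' by rewrite lt_min eta0 subr_gt0.
have b0 : 0 < eta' / 2 / (t0 - e) by rewrite !divr_gt0.
have /near_normP[r1 r10 H1] := (continuous_normP _ _).1 Wc _ b0.
have /near_normP[r2 r20 H2] : \forall v \near x - y, 0 < gamma v - (t0 - e).
  apply: near_gt0; last by rewrite -/t0 opprB addrCA subrr addr0.
  apply: (@continuous_atB _ _ _ gamma (fun=> t0 - e)); last exact: continuous_at_cst.
  exact: (gauge_continuous CB).
(* Halved because x' - z differs from x - y by the sum of two displacements. *)
pose r3 := Num.min r1 r2 / 2.
have r30 : 0 < r3 by rewrite divr_gt0// lt_min r10.
have N1 := closest_stable D bdry0 xy yu r30.
have m0 : 0 < Num.min r3 (eta' / 2) by rewrite lt_min r30 divr_gt0.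
have N2 := near_norm_lt x m0.
have N3 : \forall x' \near x, U x'.
  by apply: open_nbhs_nbhs; split=> //; exact: data_open D.
apply: filterS3 N1 N2 N3 => x' {}N1 {}N2 Ux'; split; first exact: Ux'.
move=> z xz; pose z' := x' - (t0 - e) *: sp (grad gamma (x' - z)); rewrite -/z'.
move: N2; rewrite lt_min => /andP[N2 N2'].
have zy := N1 z xz; have [bz _] := xz.
have vd : `|x' - z - (x - y)| < r3 + r3.
  rewrite (_ : _ - _ = (x' - x) - (z - y)); last first.
    by apply/rowP => j; rewrite !mxE; ring.
  by rewrite (le_lt_trans (ler_normB _ _))// ltrD.
have v1 : `|x' - z - (x - y)| < r1.
  by rewrite (lt_le_trans vd)// /r3 -splitr ge_min lexx.
have v2 : `|x' - z - (x - y)| < r2.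
  by rewrite (lt_le_trans vd)// /r3 -splitr ge_min lexx orbT.
have {}H1 := H1 _ v1; have {}H2 := H2 _ v2.
have v0 : x' - z != 0 by rewrite subr_eq0 (boundary_neq D).
have spE : sp (grad gamma (x' - z)) = W (x' - z) by exact: (support_pt_gauge_grad KB v0).
set g := gamma (x' - z) in H2 spE.
have g0 : 0 < g by exact: (gauge_gt0 CB v0).
have t00 := t0_gt0.
have A1 : `|z' - ye e| < eta'.
  rewrite (_ : z' - ye e = (x' - x) - (t0 - e) *: (W (x' - z) - W (x - y))); last first.
    rewrite /z' spE; move: (W (x' - z)) => w; rewrite /ye /V0 /W -/t0.
    by apply/rowP => j; rewrite !mxE; field; rewrite gt_eqF.
  rewrite (le_lt_trans (ler_normB _ _))// normrZ gtr0_norm// [ltRHS]splitr.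
  rewrite ltr_leD// -ler_pdivlMl// mulrC; exact: H1.
have zE : z' = z + ((g - (t0 - e)) / g) *: (x' - z).
  by rewrite /z' spE /W -/g; apply/rowP => j; rewrite !mxE; field; rewrite gt_eqF.
have q0 : 0 < (g - (t0 - e)) / g by rewrite divr_gt0.
have q1 : (g - (t0 - e)) / g <= 1 by rewrite ler_pdivrMr// mul1r gerBl ltW.
have Uz' : U z' by rewrite zE; apply: (segment_interior D bdry0) => //; rewrite q0.
have cz' : closest z' z.
  by rewrite zE; apply: (closest_segment D bdry0) => //; rewrite (ltW q0).
have zr : `|z' - y| < r.
  rewrite (_ : z' - y = (z' - ye e) + (ye e - y)); last by rewrite addrA subrK.
  rewrite (le_lt_trans (ler_normD _ _))// -ltrBrDr (lt_le_trans A1)//.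
  by rewrite ge_min lexx orbT.
have gz' : grad rho z' = grad gamma (x' - z).
  have [u _] := near_y Uz' zr.
  have uu w : closest z' w -> w = z by move=> cw; exact: u.
  rewrite (is_grad_grad (rho_is_grad D bdry0 Uz' cz' uu)) zE addrC addKr.
  by rewrite (gauge_gradZ KB).
split=> //; first by rewrite (lt_le_trans A1)// ge_min lexx.
by split=> //; rewrite /Phi gz' subrK.
Qed.

Lemma regular_of_unit : J0 \in unitmx ->
  exists V, [/\ open V, V x, V `<=` U & Ckh 1 1 rho V].
Proof.
move=> Ju; have dJ : \det J0 != 0 by rewrite -unitfE -unitmxE.
have [e [se Jeu]] : exists e, small_time e /\ Je e \in unitmx.
  have N : \forall e \near (0 : R)^'+, \det (Je e) != 0.
    exact: cvgr_neq0 (cvg_det Je_lim) dJ.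
  near (0 : R)^'+ => e; exists e; split; first by near: e; exact: near_small.
  by rewrite unitmxE unitfE; near: e.
have [PC jP] := Phi_C1 se; rewrite -jP in Jeu.
have [C C0 [r1 r10 Hinj]] := local_injectivity PC Jeu.
have inj p q w w' : `|p - ye e| < r1 -> `|q - ye e| < r1 -> Phi e p = w -> Phi e q = w' ->
    `|p - q| <= C * `|w - w'|.
  by move=> pr qr <- <-; exact: Hinj.
have [Ue yer _ _] := ye_props se; have [_ rC] := near_y Ue yer.
have [L [r2 [L0 r20 HL]]] := C1at_lipschitz rC.
have rm : 0 < Num.min r1 r2 by rewrite lt_min r10.
have /near_normP[dl dl0 Hb] := pull_back se rm.
pose V := [set x' : 'rV[R]_n | `|x' - x| < dl].
pose cp x' := xget 0 [set z | closest x' z].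
have cpP x' : closest x' (cp x').
  have [z xz] := closest_exists D bdry0 x'.
  by rewrite /cp; case: xgetP => [_ -> //|/(_ z)].
pose b x' := x' - (t0 - e) *: sp (grad gamma (x' - cp x')).
have bP x' : V x' -> [/\ `|b x' - ye e| < r1, `|b x' - ye e| < r2,
    Phi e (b x') = x' & is_grad rho x' (grad rho (b x'))].
  move=> Vx'; have [Ux' H] := Hb _ Vx'.
  have [+ Ub br cb [gb Pb]] := H _ (cpP x').
  rewrite lt_min => /andP[A1 A2]; split=> //.
  rewrite gb; apply: (rho_is_grad D bdry0 Ux' (cpP x')) => z xz.
  (* Any two closest points of x' pull back to points with the same image x' under [Phi e], hence to
     one point; that point is near y and has only one closest point. *)
  have [+ Uz zr cz [gz Pz]] := H _ xz; rewrite lt_min => /andP[B1 B2].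
  have [u _] := near_y Ub br.
  have := inj _ _ _ _ B1 A1 Pz Pb.
  rewrite (subrr x') normr0 mulr0 normr_le0 subr_eq0 => /eqP E.
  by apply: (u _ _ _ cb); rewrite -E.
(* D rho at x' is D rho at the pulled back point. The map b has Lipschitz constant C, and D rho has
   constant L near [ye e], so L * C serves at x. *)
have rhoE x' j : V x' -> partial j rho x' = partial j rho (b x').
  by move=> /bP[_ _ _ /(is_grad_partial j)[_ ->]]; rewrite mxE.
have lip x1 x2 j : V x1 -> V x2 ->
    `|partial j rho x1 - partial j rho x2| <= L * C * `|x1 - x2|.
  move=> V1 V2; have [a1 a2 a3 _] := bP _ V1; have [b1 b2 b3 _] := bP _ V2.
  rewrite (rhoE _ _ V1) (rhoE _ _ V2) (le_trans (HL _ _ a2 b2 j))//.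
  by rewrite -mulrA ler_wpM2l// (inj _ _ _ _ a1 b1 a3 b3).
have nearV x' : V x' -> \forall w \near x', V w.
  rewrite /V /= => Vx'; have d0 : 0 < dl - `|x' - x| by rewrite subr_gt0.
  apply: filterS (near_norm_lt x' d0) => w wx.
  rewrite /= (_ : w - x = (w - x') + (x' - x)); last by rewrite addrA subrK.
  by rewrite (le_lt_trans (ler_normD _ _))// -ltrBrDr.
have LC1 : 0 < L * C + 1 by rewrite ltr_wpDl// mulr_ge0// ltW.
have pcont x' j : V x' -> {for x', continuous (partial j rho)}.
  move=> Vx'; apply/continuous_normP => a a0.
  apply: filterS2 (nearV _ Vx') (near_norm_le x' (divr_gt0 a0 LC1)) => w Vw wx.
  rewrite (le_trans (lip _ _ j Vw Vx'))//.
  rewrite (@le_trans _ _ ((L * C + 1) * `|w - x'|))//.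
    by rewrite ler_wpM2r// lerDl.
  by rewrite mulrC -ler_pdivlMr.
exists V; split.
- by rewrite openE => x' /nearV.
- by rewrite /V /= subrr normr0.
- by move=> x' /Hb[].
- split=> [x' /bP[_ _ _ /is_grad_continuous//]|j].
  split=> [x' /bP[_ _ _ /(is_grad_partial j)[]//]|].
  split=> [x' Vx'|x' Vx']; first exact: pcont.
  exists (L * C).
  have /near_normP[r4 r40 H4] := nearV _ Vx'.
  apply/near_prodP; exists r4 => // p q pr qr.
  by rewrite powRr1//; apply: lip; exact: H4.
Unshelve. all: by end_near. Qed.

Lemma unit_of_regular V : open V -> V x -> Ckh 1 1 rho V -> J0 \in unitmx.
Proof.
move=> oV Vx [_ rk].
have nearV x' : V x' -> \forall w \near x', V w.
  by move=> Vx'; apply: open_nbhs_nbhs.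
have rC x' : V x' -> C1at rho x'.
  move=> Vx'; apply: C1at_partial; apply: filterS (nearV _ Vx') => w Vw.
  by split=> j; have [d [c _]] := rk j; [exact: d|exact: c].
have [L [dl [L0 dl0 Hl]]] : exists L dl, [/\ 0 <= L, 0 < dl &
    forall p q, `|p - x| < dl -> `|q - x| < dl -> forall j : 'I_n,
      `|partial j rho p - partial j rho q| <= L * `|p - q|].
  have cj j : exists C, \forall p & q \near x,
      `|partial j rho p - partial j rho q| <= C * `|p - q|.
    have [_ [_ /(_ x Vx)[C HC]]] := rk j; exists C.
    by apply: filterS HC => -[p q] /=; rewrite powRr1.
  have [C HC] := choice cj.
  have H : \forall r \near (0 : R)^'+, forall j, forall p q, `|p - x| < r -> `|q - x| < r ->
      `|partial j rho p - partial j rho q| <= (\sum_j `|C j|) * `|p - q|.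
    apply: (@filter_forall _ 'I_n) => j.
    have /near_prodP[r' r'0 Hr] := HC j.
    near=> a => p q pa qa.
    have ar : a <= r' by near: a; exact: nbhs_right_le.
    rewrite (le_trans (Hr p q (lt_le_trans pa ar) (lt_le_trans qa ar)))//.
    rewrite ler_wpM2r// (le_trans (ler_norm _))// (bigD1 j)//= lerDl.
    by rewrite sumr_ge0.
  have [dl [dl0 Hl]] : exists dl, 0 < dl /\ forall j, forall p q, `|p - x| < dl ->
      `|q - x| < dl ->
      `|partial j rho p - partial j rho q| <= (\sum_j `|C j|) * `|p - q|.
    near (0 : R)^'+ => a; exists a; split=> //.
    by near: a; exact: H.
  exists (\sum_j `|C j|), dl; split=> //; first by rewrite sumr_ge0.
  by move=> p q pd qd j; exact: Hl.
have gx : grad rho x = xi0.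
  by rewrite (rho_grad_closest D bdry0 Ux xy (C1at_is_grad (rC x Vx))).
have [L' [dl' [L'0 dl'0 Hl']]] := C1at_lipschitz (fun j => support_pt_C1 KB j xi0_neq0).
pose S z := sp (grad rho z).
(* Lam bounds the displacement of x' - (t0 - e) S x' relative to that of x', for all small e at
   once, since t0 - e < t0. *)
have Lam0 : 0 < 1 + t0 * (L' * L) by rewrite ltr_pwDl// !mulr_ge0// ltW// t0_gt0.
set Lam := 1 + t0 * (L' * L) in Lam0 *.
have gl x' : `|x' - x| < dl -> `|grad rho x' - grad rho x| <= L * `|x' - x|.
  move=> xd; apply: rV_norm_le => [|j]; first by rewrite mulr_ge0.
  by rewrite !mxE; apply: Hl => //; rewrite subrr normr0.
have SL : \forall x' \near x, `|S x' - S x| <= L' * L * `|x' - x|.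
  have [_ gc] := rC x Vx.
  have N := near_continuous gc (near_norm_lt (grad rho x) dl'0).
  apply: filterS2 N (near_norm_lt x dl0) => x' N xd.
  rewrite -mulrA (@le_trans _ _ (L' * `|grad rho x' - grad rho x|))//; last first.
    by rewrite ler_wpM2l// gl.
  apply: rV_norm_le => [|j]; first by rewrite mulr_ge0.
  rewrite !mxE; apply: Hl'; first by rewrite -gx.
  by rewrite gx subrr normr0.
have zlip e : small_time e -> \forall x' \near x,
    `|x' - (t0 - e) *: S x' - ye e| <= Lam * `|x' - x| /\
    Phi e (x' - (t0 - e) *: S x') = x'.
  move=> se; have [/andP[e0 et] _] := se.
  apply: filterS3 SL (pull_back se ltr01) (nearV x Vx) => x' Sx' [Ux' Hb] Vx'; split.
    rewrite (_ : _ - ye e = (x' - x) - (t0 - e) *: (S x' - S x)); last first.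
      rewrite /ye /V0 /S gx sp_xi0 /V0; apply/rowP => j; rewrite !mxE.
      by field; rewrite gt_eqF// t0_gt0.
    rewrite (le_trans (ler_normB _ _))// /Lam mulrDl mul1r lerD2l normrZ.
    have te : 0 <= t0 - e by rewrite subr_ge0 ltW.
    rewrite (ger0_norm te) -[leRHS]mulrA ler_pM//.
    by rewrite gerBl ltW.
  have [z xz] := closest_exists D bdry0 x'.
  have [_ _ _ _ [_ Pz]] := Hb z xz.
  by rewrite /S (rho_grad_closest D bdry0 Ux' xz (C1at_is_grad (rC x' Vx'))).
(* After transposition, l is orthogonal to the image of J0. *)
rewrite -unitmx_tr; apply: unitmx_injective => l lJ.
(* Move x by t l and let k be the displacement of the pulled back point. Then t l = k Je + o(k),
   while l is nearly orthogonal to the image of Je. Pairing with l bounds t times the square of l by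
   eta times the norm of k, which is at most Lam t times the norm of l. As e depends on eta, Lam
   must not depend on e. *)
have key eta : 0 < eta -> dotv l l <= n%:R * Lam * `|l| * (eta * `|l| + eta).
  move=> eta0.
  have mlim : l *m (Je e)^T @[e --> (0 : R)^'+] --> (0 : 'rV[R]_n).
    rewrite -lJ; apply: cvg_mulmx; first exact: cvg_cst.
    apply/cvg_mxP => i j; rewrite mxE; under eq_fun do rewrite mxE.
    by have /cvg_mxP := Je_lim; apply.
  have N : \forall e \near (0 : R)^'+, `|l *m (Je e)^T| <= eta.
    have /cvgrPdist_le/(_ _ eta0) := mlim; apply: filterS => e.
    by rewrite sub0r normrN.
  have [e [se me]] : exists e, small_time e /\ `|l *m (Je e)^T| <= eta.
    near (0 : R)^'+ => e; exists e; split; first by near: e; exact: near_small.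
    by near: e.
  have [PC jP] := Phi_C1 se.
  have PG j := C1at_is_grad (PC j).
  have [_ _ _ gy] := ye_props se.
  have Pye : Phi e (ye e) = x.
    rewrite /Phi gy sp_xi0 /ye /V0; apply/rowP => j; rewrite !mxE.
    by field; rewrite gt_eqF// t0_gt0.
  have /near_normP[a a0 Ha] := (is_jacE _ _ _).1 (jac_is_grad PG) _ eta0.
  have /near_normP[b b0 Hb] := zlip e se.
  have l1 : 0 < Lam * (`|l| + 1) by rewrite mulr_gt0// ltr_wpDl.
  (* Small enough that x + t l admits the Lipschitz estimate, by b, and that k falls under the
     linearization estimate, by a. *)
  pose t := Num.min (a / (Lam * (`|l| + 1))) (b / (`|l| + 1)) / 2.
  have t_gt0 : 0 < t by rewrite divr_gt0// lt_min !divr_gt0// ltr_wpDl.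
  have ta : t * (Lam * (`|l| + 1)) < a.
    rewrite -ltr_pdivlMr// (@lt_le_trans _ _ (Num.min (a / (Lam * (`|l| + 1))) (b / (`|l| + 1))))//.
      by rewrite /t ltr_pdivrMr// ltr_pMr ?ltr1n// lt_min !divr_gt0// ltr_wpDl.
    by rewrite ge_min lexx.
  have l10 : 0 < `|l| + 1 by rewrite ltr_wpDl.
  have tb : t * (`|l| + 1) < b.
    rewrite -ltr_pdivlMr// (@lt_le_trans _ _ (Num.min (a / (Lam * (`|l| + 1))) (b / (`|l| + 1))))//.
      by rewrite /t ltr_pdivrMr// ltr_pMr ?ltr1n// lt_min !divr_gt0.
    by rewrite ge_min lexx orbT.
  pose x' := x + t *: l.
  have xx' : x' - x = t *: l by rewrite /x' addrC addKr.
  have xn : `|x' - x| = t * `|l| by rewrite xx' normrZ gtr0_norm.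
  have [] := Hb x'; first by rewrite xn (le_lt_trans _ tb)// ler_pM2l// lerDl.
  set k := x' - (t0 - e) *: S x' - ye e => kl Pk.
  have ka : `|k| < a.
    rewrite (le_lt_trans kl)// xn (le_lt_trans _ ta)// mulrCA ler_pM2l//.
    by rewrite ler_pM2l// lerDl.
  have := Ha _ ka; rewrite Pk Pye xx' jP -/k => Hk.
  have E : t * dotv l l = dotv (t *: l - k *m Je e) l + dotv k (l *m (Je e)^T).
    by rewrite -dotv_mulmx dotvBl subrK dotvZl.
  have B1 : dotv (t *: l - k *m Je e) l <= n%:R * (eta * `|k|) * `|l|.
    rewrite (le_trans (ler_norm _))// (le_trans (dotv_norm_le _ _))//.
    by rewrite ler_wpM2r// ler_wpM2l.
  have B2 : dotv k (l *m (Je e)^T) <= n%:R * `|k| * eta.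
    rewrite (le_trans (ler_norm _))// (le_trans (dotv_norm_le _ _))//.
    by rewrite ler_wpM2l// mulr_ge0.
  rewrite -(ler_pM2l t_gt0) E.
  apply: (@le_trans _ _ (n%:R * `|k| * (eta * `|l| + eta))).
    by rewrite mulrDr lerD// (le_trans B1)// le_eqVlt; apply/orP; left; apply/eqP; ring.
  rewrite (_ : t * _ = n%:R * (Lam * (t * `|l|)) * (eta * `|l| + eta)); last by ring.
  rewrite ler_wpM2r ?addr_ge0 ?mulr_ge0// ?(ltW eta0)// ler_wpM2l//.
  by rewrite -xn.
apply/eqP; rewrite -dotv_eq0 eq_le dotv_ge0 andbT.
apply/ler_addgt0Pr => c c0; rewrite add0r.
(* With eta = c / B the bound of [key] becomes c (B - 1) / B, at most c. *)
pose B := n%:R * Lam * `|l| * (`|l| + 1) + 1.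
have B0 : 0 < B.
  have Lam1 := ltW Lam0.
  have l1 : 0 <= `|l| + 1 by rewrite addr_ge0.
  by rewrite ltr_wpDl// !mulr_ge0.
have := key (c / B) (divr_gt0 c0 B0) => /le_trans; apply.
have BE : n%:R * Lam * `|l| * (`|l| + 1) = B - 1 by rewrite /B addrK.
rewrite [leLHS](_ : _ = c * ((B - 1) / B)); last by rewrite -BE; ring.
rewrite ler_piMr ?(ltW c0)// ler_pdivrMr// mul1r.
by rewrite gerBl.
Unshelve. all: by end_near. Qed.

End ridge.

(** * The criterion in terms of Q *)

Unset Implicit Arguments.
Set Strict Implicit.

Theorem theorem3 (R : realType) (n k : nat) (alpha : R)
    (K U : set 'rV[R]_n) (phi : 'rV[R]_n -> R) (x y : 'rV[R]_n)
    (hk : (2 <= k)%N) (halpha : 0 <= alpha <= 1)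
    (K_compact : compact K) (K_convex : convex_set K)
    (K_origin : interior K 0)
    (K_boundary : Ckh_boundary k alpha K)
    (K_curv : forall (z : 'rV[R]_n) (kappa : R),
        boundary K z -> principal_curvature K z kappa -> 0 < kappa)
    (U_bounded : bounded_set U) (U_open : open U)
    (U_boundary : Ckh_boundary k alpha U)
    (phi_reg : Ckh k alpha phi setT)
    (phi_grad : forall z : 'rV[R]_n, gauge_fun (polar K) (grad phi z) < 1)
    (xU : U x) (x_ridge0 : ~ rho_ridge0 K U phi x)
    (y_closest : rho_closest K U phi x y) :
  rho_ridge K U phi x <-> \det (Qmat K U phi x y) = 0.
Proof.
have KB : regular_body K := RegularBody (ConvexBody K_compact K_convex K_origin)
  (fun V => defining_exists hk K_boundary) K_curv.
have D : obstacle_data K U phi := ObstacleData KB U_bounded U_open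
  (fun z => defining_exists hk U_boundary) (Ckh_C2 hk phi_reg) phi_grad.
have yu z : rho_closest K U phi x z -> z = y.
  move=> xz; apply: contrapT => zy; apply: x_ridge0.
  by split=> //; exists z, y.
have [by_ _] := y_closest.
have bdry0 : boundary U !=set0 by exists y.
have [i [s [d Ud]]] := data_defining D by_.
have [r [H0 [r0 near_y hess_lim]]] := near_boundary D Ud by_.
have [cy _] := by_.
have FF : ProperFilter (within U (nbhs y)) by exact: within_nbhs_proper.
(* The trace on U of the neighborhoods of y is a proper filter, as y lies in the closure of U, so
   the limit is unique. *)
have HE : rho_bdry_hessian K U phi y = H0.
  by apply: cvg_lim hess_lim; exact: norm_hausdorff.
set J := 1%:M + gauge_fun K (x - y) *:
  (H0 *m hessian (gauge_fun (polar K)) (grad (gauge_fun K) (x - y))).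
(* With mu(y) = D gamma(x - y) and rho(x) - phi(y) = gamma(x - y), the matrix Q is J with the two
   Hessians exchanged. *)
have QJ : (Qmat K U phi x y \in unitmx) = (J \in unitmx).
  rewrite /Qmat /Wmat HE (mu_closest D bdry0 xU y_closest) scalerN opprK.
  rewrite -(closest_gauge y_closest) /J !scalemxAr.
  set A := hessian _ _; set t := gauge_fun K _.
  apply/idP/idP => u.
    by have := unitmx_1DmulC u; rewrite -scalemxAl scalemxAr.
  by have := unitmx_1DmulC u; rewrite -scalemxAl scalemxAr.
have detQ : \det (Qmat K U phi x y) = 0 <-> ~ (J \in unitmx).
  rewrite -QJ unitmxE unitfE; split=> [->|/negP]; first by rewrite eqxx.
  by rewrite negbK => /eqP.
rewrite detQ; split=> [[_ nreg] Ju|nJu].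
  exact/nreg/(regular_of_unit D xU y_closest yu r0 near_y hess_lim Ju).
split=> // -[V [oV Vx _ rV]]; apply: nJu.
exact: (unit_of_regular D xU y_closest yu r0 near_y hess_lim oV Vx rV).
Qed.
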